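(* For each prime $p$, $k\in\mathbb N$ and $r\in\mathbb Z/p^k$, let $\delta_{(r,p^k)}$ denote the unit point mass at $B(r,p^k)\in X_p$. For $\beta>1$, the series $$\mu_{\beta,p}=(1-p^{1-\beta})\sum_{k\in\mathbb N}\sum_{r\in\mathbb Z/p^k}p^{-\beta k}\delta_{(r,p^k)}$$ defines a Borel probability measure on $X_p$; for $\beta=1$, let $\mu_{1,p}$ be the probability measure on $X_p$ coming from normalised additive Haar measure on $\mathbb Z_p$ via the embedding $r\mapsto B(r,p^\infty)$ of $\mathbb Z_p$ in $X_p$. Let $\mu_\beta$ be the measure on $\Omega_B$ coming from the product measure $\prod_{p\in\mathcal P}\mu_{\beta,p}$ on $\prod_{p\in\mathcal P}X_p$ via the homeomorphism $\Omega_B\cong\prod_pX_p$, $B(r,N)\mapsto\{B(r(p^{e_p(N)}),p^{e_p(N)})\}_p$; let $\mu_\beta^*:f\mapsto\int f\,d\mu_\beta$ be the associated state on $C(\Omega)$, and view $\mu_\beta^*$ as a state on $\mathcal T(\mathbb N\rtimes\mathbb N^\times)^\delta=\overline{\operatorname{span}}\{s^mv_av_a^*s^{*m}:(m,a)\in\mathbb N\rtimes\mathbb N^\times\}$ using the isomorphism of this algebra onto $C(\Omega)$ which takes $s^mv_av_a^*s^{*m}$ to $1_{m,a}$. Then $\psi_\beta:=\mu_\beta^*\circ E_{\mathbb Q\rtimes\mathbb Q_+^*}$ is a KMS$_\beta$ state of $(\mathcal T(\mathbb N\rtimes\mathbb N^\times),\sigma)$ for $1\le\beta\le\infty$, and it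 satisfies $$\psi_\beta(s^mv_av_b^*s^{*n})=\begin{cases}0&\text{unless }a=b\text{ and }m=n,\\ a^{-\beta}&\text{if }a=b\text{ and }m=n.\end{cases}$$
   Context: $\mathcal P$ is the set of primes; $\mathbb N=\{0,1,2,\dots\}$; $\mathbb N^\times$ is the multiplicative semigroup of positive integers; $P=\mathbb N\rtimes\mathbb N^\times$ has product $(m,a)(n,b)=(m+an,ab)$ and partial order $(m,a)\le(n,b)\iff a^{-1}(n-m)\in\mathbb N$ and $a^{-1}b\in\mathbb N^\times$. $\mathcal T(P)$ is the $C^*$-algebra generated by the isometries $T_ye_x=e_{yx}$ on $\ell^2(P)$; $s:=T_{(1,1)}$, $v_a:=T_{(0,a)}$. The dynamics satisfies $\sigma_t(s)=s$, $\sigma_t(v_p)=p^{it}v_p$. For $\beta\in(0,\infty)$ a state $\phi$ is KMS$_\beta$ if $\phi(dc)=\phi(c\,\sigma_{i\beta}(d))$ for all $\sigma$-analytic $c,d$; a KMS$_\infty$ state is a weak* limit of a net of KMS$_{\beta_i}$ states with $\beta_i\to\infty$. $E_{\mathbb Q\rtimes\mathbb Q_+^*}$ is the faithful conditional expectation of $\mathcal T(P)$ onto $\mathcal T(P)^\delta$ (coming from the dual coaction $\delta$ of $\mathbb Q\rtimes\mathbb Q_+^*$), determined by $E(s^mv_av_b^*s^{*n})=s^mv_av_b^*s^{*n}$ if $(m,a)=(n,b)$ and $0$ otherwise. The Nica spectrum $\Omega$ is the set of nonempty hereditary (downward closed) directed subsets of $P$, topologised as a subset of $\{0,1\}^P$;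 $1_{m,a}\in C(\Omega)$ is the characteristic function of $\{\omega:(m,a)\in\omega\}$. Supernatural numbers are formal products $N=\prod_pp^{e_p(N)}$, $e_p(N)\in\mathbb N\cup\{\infty\}$, with divisibility defined by comparing exponents; $\mathbb Z/N:=\varprojlim\{\mathbb Z/a\mathbb Z:a\in\mathbb N^\times,a\mid N\}$ (so $\mathbb Z/p^\infty=\mathbb Z_p$), and $r(M)\in\mathbb Z/M$ is the image of $r\in\mathbb Z/N$ when $M\mid N$. $B(r,N):=\{(m,a)\in P:a\mid N,\ m\in r(a)\}$. $\Omega_B:=\{B(r,N):N\text{ supernatural},\ r\in\mathbb Z/N\}$ is a closed subset of $\Omega$, and $X_p:=\{B(r,p^k):k\in\mathbb N\cup\{\infty\},\ r\in\mathbb Z/p^k\}$; the map $\Omega_B\to\prod_pX_p$ above is a homeomorphism. For $\beta=\infty$ interpret $a^{-\infty}=0$ for $a>1$ and $1^{-\infty}=1$, so that $\mu_{\infty,p}$ is the point mass at $B(0,1)$. *)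

(* Defs.v *)
From HB Require Import structures.
From mathcomp Require Import all_boot all_order all_algebra.
From mathcomp Require Import all_classical all_reals all_analysis.
From mathcomp Require Import complex ring lra.

Set Implicit Arguments.
Unset Strict Implicit.
Unset Printing Implicit Defensive.

Import Order.TTheory GRing.Theory Num.Theory.
Import numFieldNormedType.Exports.
Local Open Scope classical_set_scope.
Local Open Scope complex_scope.
Local Open Scope ring_scope.

Section summation.
Variables (R : realType) (I : choiceType).
Implicit Types (f g : I -> R).

Definition rsummable f : Prop := (\esum_(i in [set: I]) `|f i|%:E < +oo)%E.

(* The unconditional sum of an absolutely summable real family. *)
Definition rsum f : R :=
  fine (\esum_(i in [set: I]) (Num.max (f i) 0)%:E)
  - fine (\esum_(i in [set: I]) (Num.max (- f i) 0)%:E).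

Definition csum (f : I -> R[i]) : R[i] :=
  rsum (fun i => complex.Re (f i)) +i* rsum (fun i => complex.Im (f i)).

Lemma esum_fin (f : I -> R) : (forall i, 0 <= f i) ->
  (\esum_(i in [set: I]) (f i)%:E < +oo)%E ->
  (\esum_(i in [set: I]) (f i)%:E)%E \is a fin_num.
Proof.
move=> f0 foo; rewrite ge0_fin_numE//; apply: esum_ge0 => i _.
by rewrite lee_fin.
Qed.

Lemma esum_le_fin (f g : I -> R) : (forall i, f i <= g i) ->
  (\esum_(i in [set: I]) (g i)%:E < +oo)%E ->
  (\esum_(i in [set: I]) (f i)%:E < +oo)%E.
Proof.
move=> fg; apply: le_lt_trans; apply: le_esum => i _.
by rewrite lee_fin.
Qed.

Lemma rsummable_le f g : (forall i, `|f i| <= g i) ->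
  (\esum_(i in [set: I]) (g i)%:E < +oo)%E -> rsummable f.
Proof. by move=> fg; exact: esum_le_fin. Qed.

Lemma rsummableD f g : rsummable f -> rsummable g ->
  rsummable (fun i => f i + g i).
Proof.
move=> sf sg; apply: (@rsummable_le _ (fun i => `|f i| + `|g i|)).
  by move=> i; exact: ler_normD.
under eq_esum do rewrite EFinD.
rewrite esumD ?lte_add_pinfty// => i _; by rewrite lee_fin.
Qed.

Lemma esumZ (c : R) (f : I -> R) : 0 <= c -> (forall i, 0 <= f i) ->
  (\esum_(i in [set: I]) (f i)%:E < +oo)%E ->
  (\esum_(i in [set: I]) (c * f i)%:E =
   c%:E * \esum_(i in [set: I]) (f i)%:E)%E.
Proof.
move=> c0 f0 foo.
have le1 (d : R) (g : I -> R) : 0 < d -> (forall i, 0 <= g i) ->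
  (\esum_(i in [set: I]) (d * g i)%:E <=
   d%:E * \esum_(i in [set: I]) (g i)%:E)%E.
  move=> d0 g0; apply: ge_ereal_sup => _ [X [finX XI]] <-.
  under eq_fsbigr do rewrite EFinM.
  rewrite fsbig_finite//= -ge0_sume_distrr; last by move=> i _; rewrite lee_fin.
  rewrite lee_pmul2l// -fsbig_finite//.
  by apply: ereal_sup_ubound; exists X.
move: c0; rewrite le_eqVlt => /predU1P[<-|c0].
  by rewrite mul0e esum1// => i _; rewrite mul0r.
apply/eqP; rewrite eq_le le1//=.
have ci : 0 < c^-1 by rewrite invr_gt0.
have := le1 _ (fun i => c * f i) ci (fun i => mulr_ge0 (ltW c0) (f0 i)).
under eq_esum do rewrite mulKf ?gt_eqF//.
by rewrite lee_pdivlMl.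
Qed.

Lemma esumZ_fin (c : R) (f : I -> R) : 0 <= c -> (forall i, 0 <= f i) ->
  (\esum_(i in [set: I]) (f i)%:E < +oo)%E ->
  (\esum_(i in [set: I]) (c * f i)%:E < +oo)%E.
Proof. by move=> c0 f0 foo; rewrite esumZ// -(fineK (esum_fin f0 foo)) -EFinM ltry. Qed.

Lemma rsummableZ (c : R) f : rsummable f -> rsummable (fun i => c * f i).
Proof.
move=> sf; rewrite /rsummable.
under eq_esum do rewrite normrM.
exact: esumZ_fin.
Qed.

Lemma rsum_def (p q : I -> R) f : (forall i, 0 <= p i) -> (forall i, 0 <= q i) ->
  (\esum_(i in [set: I]) (p i)%:E < +oo)%E ->
  (\esum_(i in [set: I]) (q i)%:E < +oo)%E ->
  (forall i, f i = p i - q i) ->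
  rsum f = fine (\esum_(i in [set: I]) (p i)%:E)
         - fine (\esum_(i in [set: I]) (q i)%:E).
Proof.
move=> p0 q0 ps qs fE; rewrite /rsum.
have P0 i : 0 <= Num.max (f i) 0 by rewrite le_max lexx orbT.
have Q0 i : 0 <= Num.max (- f i) 0 by rewrite le_max lexx orbT.
have Ps : (\esum_(i in [set: I]) (Num.max (f i) 0)%:E < +oo)%E.
  apply: esum_le_fin ps => i; rewrite ge_max p0 andbT fE.
  by rewrite lerBlDr lerDl.
have Qs : (\esum_(i in [set: I]) (Num.max (- f i) 0)%:E < +oo)%E.
  apply: esum_le_fin qs => i; rewrite ge_max q0 andbT fE.
  by rewrite opprB lerBlDr lerDl.
have H : (\esum_(i in [set: I]) (Num.max (f i) 0)%:E
           + \esum_(i in [set: I]) (q i)%:E =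
         \esum_(i in [set: I]) (p i)%:E
           + \esum_(i in [set: I]) (Num.max (- f i) 0)%:E)%E.
  rewrite -!esumD => *; rewrite ?lee_fin//.
  apply: eq_esum => i _; rewrite -!EFinD; congr (_%:E).
  rewrite fE /Num.max; case: ifPn; case: ifPn; rewrite -?leNgt; lra.
have := congr1 fine H.
rewrite !fineD; try exact: esum_fin.
lra.
Qed.

Lemma rsummable_pos f : rsummable f ->
  (\esum_(i in [set: I]) (Num.max (f i) 0)%:E < +oo)%E.
Proof.
apply: esum_le_fin => i; by rewrite ge_max ler_norm normr_ge0.
Qed.

Lemma rsummableN f : rsummable f -> rsummable (fun i => - f i).
Proof. by rewrite /rsummable; under [in X in _ -> X]eq_esum do rewrite normrN. Qed.

Lemma rsummable_neg f : rsummable f ->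
  (\esum_(i in [set: I]) (Num.max (- f i) 0)%:E < +oo)%E.
Proof. by move=> /rsummableN/rsummable_pos. Qed.

Lemma maxr_ge0r (x : R) : 0 <= Num.max x 0.
Proof. by rewrite le_max lexx orbT. Qed.

Lemma maxr_decomp (x : R) : x = Num.max x 0 - Num.max (- x) 0.
Proof. rewrite /Num.max; case: ifPn; case: ifPn; rewrite -?leNgt; lra. Qed.

Lemma pos_fin f : rsummable f ->
  (\esum_(i in [set: I]) (Num.max (f i) 0)%:E)%E \is a fin_num.
Proof.
by move=> sf; apply: esum_fin (rsummable_pos sf) => i; rewrite maxr_ge0r.
Qed.

Lemma neg_fin f : rsummable f ->
  (\esum_(i in [set: I]) (Num.max (- f i) 0)%:E)%E \is a fin_num.
Proof. by move=> /rsummableN/pos_fin. Qed.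

Lemma rsumD f g : rsummable f -> rsummable g ->
  rsum (fun i => f i + g i) = rsum f + rsum g.
Proof.
move=> sf sg.
rewrite (@rsum_def (fun i => Num.max (f i) 0 + Num.max (g i) 0)
  (fun i => Num.max (- f i) 0 + Num.max (- g i) 0)).
- under eq_esum do rewrite EFinD.
  under [in X in _ - X]eq_esum do rewrite EFinD.
  rewrite !esumD; try by move=> *; rewrite lee_fin maxr_ge0r.
  by rewrite !fineD ?(neg_fin sf) ?(pos_fin sf) ?(neg_fin sg) ?(pos_fin sg)// /rsum opprD addrACA.
- by move=> i; rewrite addr_ge0 ?maxr_ge0r.
- by move=> i; rewrite addr_ge0 ?maxr_ge0r.
- under eq_esum do rewrite EFinD.
  rewrite esumD ?lte_add_pinfty ?rsummable_pos//;
  by move=> *; rewrite lee_fin maxr_ge0r.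
- under eq_esum do rewrite EFinD.
  rewrite esumD ?lte_add_pinfty ?rsummable_neg//;
  by move=> *; rewrite lee_fin maxr_ge0r.
- move=> i; rewrite {1}(maxr_decomp (f i)) {1}(maxr_decomp (g i)); lra.
Qed.

Lemma rsumN f : rsum (fun i => - f i) = - rsum f.
Proof.
by rewrite /rsum opprB; congr (_ - fine _); apply: eq_esum => i _; rewrite opprK.
Qed.

Lemma rsumZ (c : R) f : rsummable f -> rsum (fun i => c * f i) = c * rsum f.
Proof.
wlog c0 : c f / 0 <= c => [H sf|sf].
  have [c0|c0] := leP 0 c; first exact: H.
  have := @H (- c) f; rewrite oppr_ge0 (ltW c0) => /(_ isT sf).
  under [X in rsum X]eq_fun do rewrite mulNr.
  by rewrite rsumN mulNr => /oppr_inj.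
rewrite (@rsum_def (fun i => c * Num.max (f i) 0) (fun i => c * Num.max (- f i) 0)).
- rewrite !esumZ ?(rsummable_pos sf) ?(rsummable_neg sf)//;
    try by move=> *; rewrite maxr_ge0r.
  by rewrite !fineM ?(neg_fin sf) ?(pos_fin sf)// /rsum mulrBr.
- by move=> i; rewrite mulr_ge0 ?maxr_ge0r.
- by move=> i; rewrite mulr_ge0 ?maxr_ge0r.
- by rewrite esumZ_fin ?rsummable_pos// => i; rewrite maxr_ge0r.
- by rewrite esumZ_fin ?rsummable_neg// => i; rewrite maxr_ge0r.
- by move=> i; rewrite -mulrBr -maxr_decomp.
Qed.

Lemma rsum0 : rsum (fun=> 0) = 0.
Proof.
by rewrite /rsum !esum1 ?subrr// => i _; rewrite ?oppr0 /Num.max ltxx.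
Qed.

Lemma rsum_ge0E f : (forall i, 0 <= f i) ->
  rsum f = fine (\esum_(i in [set: I]) (f i)%:E).
Proof.
move=> f0; rewrite /rsum [X in _ - fine X]esum1; last first.
  by move=> i _; rewrite max_r// oppr_le0.
rewrite subr0; congr fine; apply: eq_esum => i _.
by rewrite max_l.
Qed.

Definition csummable (f : I -> R[i]) :=
  rsummable (fun i => complex.Re (f i)) /\ rsummable (fun i => complex.Im (f i)).

Lemma csumD (f g : I -> R[i]) : csummable f -> csummable g ->
  csum (fun i => f i + g i) = csum f + csum g.
Proof.
move=> [f1 f2] [g1 g2]; rewrite /csum.
rewrite -[RHS]/(_ +i* _) -!rsumD//.
by congr (rsum _ +i* rsum _); apply/funext => i; case: (f i) (g i) => a b [c d].
Qed.

Lemma csumZ (c : R[i]) (f : I -> R[i]) : csummable f ->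
  csum (fun i => c * f i) = c * csum f.
Proof.
case: c => a b [f1 f2].
have -> : a +i* b * csum f =
    (a * rsum (fun i => complex.Re (f i)) + (- b) * rsum (fun i => complex.Im (f i)))
    +i* (a * rsum (fun i => complex.Im (f i)) + b * rsum (fun i => complex.Re (f i))).
  by rewrite mulNr.
rewrite -!rsumZ// -!rsumD; try exact: rsummableZ.
rewrite /csum; congr (rsum _ +i* rsum _); apply/funext => i.
  by case: (f i) => c d /=; rewrite mulNr.
by case: (f i) => c d.
Qed.

Lemma csum_conj (f : I -> R[i]) : csum (fun i => (f i)^*) = (csum f)^*.
Proof.
rewrite /csum -[RHS]/(_ +i* _) -rsumN.
by congr (rsum _ +i* rsum _); apply/funext => i; case: (f i).
Qed.

End summation.

Section ell2.
Variables (R : realType) (I : choiceType).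

Definition normsq (z : R[i]) : R := complex.Re z ^+ 2 + complex.Im z ^+ 2.

Lemma normsq_ge0 z : 0 <= normsq z.
Proof. by rewrite addr_ge0 ?sqr_ge0. Qed.

Lemma normsqM z w : normsq (z * w) = normsq z * normsq w.
Proof. by case: z w => a b [c d]; rewrite /normsq /=; ring. Qed.

Lemma normsq_eq0 z : normsq z = 0 -> z = 0.
Proof.
case: z => a b /eqP; rewrite /normsq /= paddr_eq0 ?sqr_ge0// !sqrf_eq0.
by move=> /andP[/eqP-> /eqP->].
Qed.

Definition ell2_pred : {pred I -> R[i]} :=
  [pred f | `[< (\esum_(i in [set: I]) (normsq (f i))%:E < +oo)%E >]].

Lemma ell2_predP (f : I -> R[i]) : reflect
  (\esum_(i in [set: I]) (normsq (f i))%:E < +oo)%E (f \in ell2_pred).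
Proof. by rewrite inE; exact: asboolP. Qed.

Lemma ell2_submod_closed : submod_closed ell2_pred.
Proof.
split.
  by apply/ell2_predP; rewrite esum1// => i _; rewrite /normsq/= expr0n addr0.
move=> c f g /ell2_predP f2 /ell2_predP g2; apply/ell2_predP.
apply: (@esum_le_fin _ _ _ (fun i => (2 * normsq c) * normsq (f i) + 2 * normsq (g i))).
  move=> i; rewrite -mulrA -normsqM -[X in normsq X]/(c * f i + g i).
  case: (c * f i) (g i) => a1 b1 [a2 b2]; rewrite /normsq /=.
  have := sqr_ge0 (a1 - a2); have := sqr_ge0 (b1 - b2); nra.
under eq_esum do rewrite EFinD.
rewrite esumD; try by move=> i _; rewrite lee_fin !mulr_ge0 ?normsq_ge0.
by rewrite lte_add_pinfty//; apply: esumZ_fin => // *;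
  rewrite ?mulr_ge0 ?normsq_ge0.
Qed.

HB.instance Definition _ :=
  GRing.isSubmodClosed.Build R[i] (I -> R[i]) ell2_pred ell2_submod_closed.

Record ell2 := Ell2 { ell2_fun :> I -> R[i] ; _ : ell2_fun \in ell2_pred }.

HB.instance Definition _ := [isSub for ell2_fun].
HB.instance Definition _ := [Choice of ell2 by <:].
HB.instance Definition _ := [SubChoice_isSubLmodule of ell2 by <:].

End ell2.

Section hilbert.
Variables (R : realType) (I : choiceType).
Notation ell2 := (ell2 R I).
Implicit Types (x y z : ell2) (c : R[i]).

Definition dot x y : R[i] := csum (fun i => x i * (y i)^*).

Definition hnorm2 x : R := rsum (fun i => normsq (x i)).

Definition hnorm x : R := Num.sqrt (hnorm2 x).

Lemma ell2P x : (\esum_(i in [set: I]) (normsq (x i))%:E < +oo)%E.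
Proof. by apply/ell2_predP; case: x. Qed.

Lemma ell2_ext x y : (forall i, x i = y i) -> x = y.
Proof. by move=> xy; apply/val_inj/funext. Qed.

Lemma normsq_summable x : rsummable (fun i => normsq (x i)).
Proof.
by apply: rsummable_le (ell2P x) => i; rewrite ger0_norm// normsq_ge0.
Qed.

Lemma dot_summable x y : csummable (fun i => x i * (y i)^*).
Proof.
have H : rsummable (fun i => normsq (x i) + normsq (y i)).
  by apply: rsummableD; exact: normsq_summable.
have H' : (\esum_(i in [set: I]) (normsq (x i) + normsq (y i))%:E < +oo)%E.
  apply: esum_le_fin H => i; exact: ler_norm.
split; apply: (rsummable_le _ H') => i; rewrite /normsq;
  case: (x i) (y i) => a b [c d] /=; rewrite ler_norml; apply/andP; split;
  have := sqr_ge0 (a + c); have := sqr_ge0 (b + d); have := sqr_ge0 (a - c);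
  have := sqr_ge0 (b - d); have := sqr_ge0 (a + d); have := sqr_ge0 (a - d);
  have := sqr_ge0 (b + c); have := sqr_ge0 (b - c); nra.
Qed.

Lemma dotDl x y z : dot (x + y) z = dot x z + dot y z.
Proof.
rewrite /dot -csumD; try exact: dot_summable.
by congr csum; apply/funext => i; rewrite -mulrDl.
Qed.

Lemma dotZl c x y : dot (c *: x) y = c * dot x y.
Proof.
rewrite /dot -csumZ; last exact: dot_summable.
by congr csum; apply/funext => i; rewrite mulrA.
Qed.

Lemma dotC x y : dot y x = (dot x y)^*.
Proof.
rewrite /dot -csum_conj; congr csum; apply/funext => i.
by rewrite rmorphM/= conjCK mulrC.
Qed.

Lemma dotDr x y z : dot x (y + z) = dot x y + dot x z.
Proof. by rewrite dotC dotDl rmorphD/= -!dotC. Qed.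

Lemma dotZr c x y : dot x (c *: y) = c^* * dot x y.
Proof. by rewrite dotC dotZl rmorphM/= -dotC. Qed.

Lemma dotxx x : dot x x = (hnorm2 x)%:C.
Proof.
rewrite /dot /csum /hnorm2 -[RHS]/(_ +i* 0); congr (_ +i* _).
  by congr rsum; apply/funext => i; rewrite /normsq; case: (x i) => a b /=; ring.
rewrite -[RHS](@rsum0 R I); congr rsum; apply/funext => i.
by case: (x i) => a b /=; ring.
Qed.

Lemma hnorm2_ge0 x : 0 <= hnorm2 x.
Proof.
rewrite /hnorm2 rsum_ge0E; last by move=> i; exact: normsq_ge0.
by apply/fine_ge0/esum_ge0 => i _; rewrite lee_fin normsq_ge0.
Qed.

Lemma hnorm2_eq0 x : hnorm2 x = 0 -> x = 0.
Proof.
rewrite /hnorm2 rsum_ge0E; last by move=> i; exact: normsq_ge0.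
move=> H; apply: ell2_ext => i; apply: normsq_eq0; apply/eqP.
rewrite eq_le normsq_ge0 andbT -lee_fin.
have f : (\esum_(i in [set: I]) (normsq (x i))%:E)%E \is a fin_num.
  by apply: esum_fin (ell2P x) => j; exact: normsq_ge0.
rewrite -H fineK//; apply: esum_ge; exists [set i]; first by split.
by rewrite fsbig_set1.
Qed.

Lemma hnorm2D x y :
  hnorm2 (x + y) = hnorm2 x + 2 * complex.Re (dot x y) + hnorm2 y.
Proof.
have := dotxx (x + y); rewrite dotDl !dotDr !dotxx (dotC x y).
by case: (dot x y) => a b [<- _] /=; ring.
Qed.

Lemma hnorm2Z c x : hnorm2 (c *: x) = normsq c * hnorm2 x.
Proof.
have := dotxx (c *: x); rewrite dotZl dotZr dotxx.
by case: c => a b [<- _]; rewrite /normsq /=; ring.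
Qed.

Lemma hnormE x : hnorm x ^+ 2 = hnorm2 x.
Proof. by rewrite sqr_sqrtr ?hnorm2_ge0. Qed.

Lemma hnorm_ge0 x : 0 <= hnorm x.
Proof. exact: sqrtr_ge0. Qed.

Lemma hnorm_eq0 x : hnorm x = 0 -> x = 0.
Proof. by move=> x0; apply: hnorm2_eq0; rewrite -hnormE x0 expr0n. Qed.

Lemma hnorm0 : hnorm 0 = 0.
Proof.
by rewrite /hnorm -(scale0r (0 : ell2)) hnorm2Z /normsq/= expr0n addr0 mul0r sqrtr0.
Qed.

Lemma hnormZ c x : hnorm (c *: x) = Num.sqrt (normsq c) * hnorm x.
Proof. by rewrite /hnorm hnorm2Z sqrtrM// normsq_ge0. Qed.

Lemma cauchy_schwarz x y : normsq (dot x y) <= hnorm2 x * hnorm2 y.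
Proof.
have [y0|y0] := eqVneq (hnorm2 y) 0.
  rewrite (hnorm2_eq0 y0) -(scale0r (0 : ell2)) dotZr normsqM conjC0.
  by rewrite {1}/normsq /= expr0n addr0 mul0r mulr_ge0 ?hnorm2_ge0.
have yp : 0 < hnorm2 y by rewrite lt_def y0 hnorm2_ge0.
pose c := - (dot x y) * ((hnorm2 y)^-1)%:C.
have := hnorm2_ge0 (x + c *: y).
rewrite hnorm2D hnorm2Z dotZr {}/c.
rewrite -(pmulr_rge0 _ yp).
case: (dot x y) => a b; rewrite /normsq /= => H.
rewrite -subr_ge0; apply: le_trans H _; rewrite le_eqVlt; apply/orP; left.
by apply/eqP; field.
Qed.

Lemma Re_dot_le x y : complex.Re (dot x y) <= hnorm x * hnorm y.
Proof.
apply: le_trans (ler_norm _) _.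
rewrite -(@ler_pXn2r _ 2)// ?nnegrE ?mulr_ge0 ?hnorm_ge0//.
rewrite exprMn !hnormE real_normK ?num_real//.
by apply: le_trans (cauchy_schwarz x y); rewrite lerDl sqr_ge0.
Qed.

Lemma ler_hnormD x y : hnorm (x + y) <= hnorm x + hnorm y.
Proof.
rewrite -(@ler_pXn2r _ 2)// ?nnegrE ?addr_ge0 ?hnorm_ge0//.
rewrite hnormE hnorm2D sqrrD !hnormE -[X in _ <= _ + X + _]mulr_natl.
by rewrite lerD2r lerD2l ler_pM2l// Re_dot_le.
Qed.

Lemma dot_nondeg y z : (forall x, dot x y = dot x z) -> y = z.
Proof.
move=> H; apply/eqP; rewrite -subr_eq0; apply/eqP/hnorm2_eq0.
have : dot (y - z) (y - z) = 0.
  by rewrite dotDr -scaleN1r dotZr rmorphN1 mulN1r H subrr.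
by rewrite dotxx => -[].
Qed.

End hilbert.

Section operators.
Variables (R : realType) (I : choiceType).
Notation ell2 := (ell2 R I).
Implicit Types (x y z : ell2) (c : R[i]).

(* Bounded linear operators on the Hilbert space ell2, carrying their Hilbert
   adjoint.  By Riesz every bounded operator has a unique adjoint, so the extra
   component is no restriction. *)
Record bop := Bop {
  bop_fun :> ell2 -> ell2 ;
  bop_adj : ell2 -> ell2 ;
  bop_linear : forall c x y, bop_fun (c *: x + y) = c *: bop_fun x + bop_fun y ;
  bop_bounded : exists M : R, forall x, hnorm (bop_fun x) <= M * hnorm x ;
  bop_adjoint : forall x y, dot (bop_fun x) y = dot x (bop_adj y) }.

Implicit Types (S T U : bop).

Lemma bop_ext S T : (forall x, S x = T x) -> S = T.
Proof.
move=> ST; have STf : bop_fun S = bop_fun T by exact/funext.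
have STa : bop_adj S = bop_adj T.
  apply/funext => y; apply: dot_nondeg => x.
  by rewrite -!bop_adjoint ST.
case: S T STf STa {ST} => f a l b p [g a' l' b' p'] /= fg aa'.
move: l b p l' b' p'; rewrite fg aa' => *; congr Bop; exact: Prop_irrelevance.
Qed.

Lemma dotr0 x : dot x 0 = 0.
Proof. by rewrite -(scale0r (0 : ell2)) dotZr conjC0 mul0r. Qed.

Lemma bop0 T : T 0 = 0.
Proof.
have := bop_linear T 1 0 0; rewrite !scale1r addr0 => /eqP.
by rewrite -subr_eq subrr => /eqP <-.
Qed.

Lemma bop_bounded0 T : exists2 M : R, 0 <= M &
  forall x, hnorm (T x) <= M * hnorm x.
Proof.
have [M TM] := bop_bounded T; exists `|M| => // x.
by apply: le_trans (TM x) _; rewrite ler_wpM2r ?hnorm_ge0 ?ler_norm.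
Qed.

Lemma adj_linear T c x y :
  bop_adj T (c *: x + y) = c *: bop_adj T x + bop_adj T y.
Proof.
apply: dot_nondeg => z.
by rewrite -bop_adjoint !dotDr !dotZr -!bop_adjoint.
Qed.

Lemma adj_bounded T : exists M : R, forall x, hnorm (bop_adj T x) <= M * hnorm x.
Proof.
have [M M0 TM] := bop_bounded0 T; exists M => y.
set z := bop_adj T y; have [z0|z0] := eqVneq (hnorm z) 0.
  by rewrite z0 mulr_ge0 ?hnorm_ge0.
have zp : 0 < hnorm z by rewrite lt_def z0 hnorm_ge0.
rewrite -(ler_pM2l zp) -expr2 hnormE.
have -> : hnorm2 z = complex.Re (dot (T z) y) by rewrite bop_adjoint dotxx.
apply: le_trans (Re_dot_le _ _) _; rewrite mulrA ler_wpM2r ?hnorm_ge0//.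
by rewrite [hnorm z * M]mulrC.
Qed.

Lemma adj_adjoint T x y : dot (bop_adj T x) y = dot x (T y).
Proof. by rewrite dotC -bop_adjoint -dotC. Qed.

Definition adj T : bop :=
  Bop (@adj_linear T) (adj_bounded T) (@adj_adjoint T).

Lemma add_linear S T c x y :
  S (c *: x + y) + T (c *: x + y) = c *: (S x + T x) + (S y + T y).
Proof. by rewrite !bop_linear scalerDr addrACA. Qed.

Lemma add_bounded S T : exists M : R, forall x,
  hnorm (S x + T x) <= M * hnorm x.
Proof.
have [M SM] := bop_bounded S; have [N TN] := bop_bounded T.
exists (M + N) => x; rewrite mulrDl.
by apply: le_trans (ler_hnormD _ _) _; rewrite lerD.
Qed.

Lemma add_adjoint S T x y :
  dot (S x + T x) y = dot x (bop_adj S y + bop_adj T y).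
Proof. by rewrite dotDl dotDr !bop_adjoint. Qed.

Definition add_bop S T : bop :=
  Bop (@add_linear S T) (add_bounded S T) (@add_adjoint S T).

Lemma scale_linear (a : R[i]) T c x y :
  a *: T (c *: x + y) = c *: (a *: T x) + a *: T y.
Proof. by rewrite bop_linear scalerDr !scalerA mulrC. Qed.

Lemma scale_bounded (a : R[i]) T : exists M : R, forall x,
  hnorm (a *: T x) <= M * hnorm x.
Proof.
have [M TM] := bop_bounded T; exists (Num.sqrt (normsq a) * M) => x.
by rewrite hnormZ -mulrA ler_wpM2l ?sqrtr_ge0.
Qed.

Lemma scale_adjoint (a : R[i]) T x y :
  dot (a *: T x) y = dot x (a^* *: bop_adj T y).
Proof. by rewrite dotZl dotZr conjCK bop_adjoint. Qed.

Definition scale_bop (a : R[i]) T : bop :=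
  Bop (@scale_linear a T) (scale_bounded a T) (@scale_adjoint a T).

Lemma mul_linear S T c x y : S (T (c *: x + y)) = c *: S (T x) + S (T y).
Proof. by rewrite !bop_linear. Qed.

Lemma mul_bounded S T : exists M : R, forall x, hnorm (S (T x)) <= M * hnorm x.
Proof.
have [M M0 SM] := bop_bounded0 S; have [N N0 TN] := bop_bounded0 T.
exists (M * N) => x; apply: le_trans (SM _) _.
by rewrite -mulrA ler_wpM2l.
Qed.

Lemma mul_adjoint S T x y : dot (S (T x)) y = dot x (bop_adj T (bop_adj S y)).
Proof. by rewrite !bop_adjoint. Qed.

Definition mul_bop S T : bop :=
  Bop (@mul_linear S T) (mul_bounded S T) (@mul_adjoint S T).

Lemma one_bounded : exists M : R, forall x : ell2, hnorm x <= M * hnorm x.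
Proof. by exists 1 => x; rewrite mul1r. Qed.

Definition one_bop : bop :=
  @Bop id id (fun _ _ _ => erefl) one_bounded (fun _ _ => erefl).

Definition zero_bop : bop := scale_bop 0 one_bop.

Definition opp_bop T : bop := scale_bop (-1) T.

HB.instance Definition _ := gen_eqMixin bop.
HB.instance Definition _ := gen_choiceMixin bop.

Fact add_bopA : associative add_bop.
Proof. by move=> S T U; apply: bop_ext => x /=; rewrite addrA. Qed.

Fact add_bopC : commutative add_bop.
Proof. by move=> S T; apply: bop_ext => x /=; rewrite addrC. Qed.

Fact add_0bop : left_id zero_bop add_bop.
Proof. by move=> T; apply: bop_ext => x /=; rewrite scale0r add0r. Qed.

Fact add_Nbop : left_inverse zero_bop opp_bop add_bop.
Proof. by move=> T; apply: bop_ext => x /=; rewrite scaleN1r addNr scale0r. Qed.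

HB.instance Definition _ :=
  GRing.isZmodule.Build bop add_bopA add_bopC add_0bop add_Nbop.

Fact mul_bopA : associative mul_bop.
Proof. by move=> S T U; apply: bop_ext. Qed.

Fact mul_1bop : left_id one_bop mul_bop.
Proof. by move=> T; apply: bop_ext. Qed.

Fact mul_bop1 : right_id one_bop mul_bop.
Proof. by move=> T; apply: bop_ext. Qed.

Fact mul_bopDl : left_distributive mul_bop +%R.
Proof. by move=> S T U; apply: bop_ext. Qed.

Fact mul_bopDr : right_distributive mul_bop +%R.
Proof.
move=> S T U; apply: bop_ext => x /=.
by have := bop_linear S 1 (T x) (U x); rewrite !scale1r.
Qed.

HB.instance Definition _ := GRing.Zmodule_isPzRing.Build bop
  mul_bopA mul_1bop mul_bop1 mul_bopDl mul_bopDr.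

Fact scale_bopA (a b : R[i]) T : scale_bop a (scale_bop b T) = scale_bop (a * b) T.
Proof. by apply: bop_ext => x /=; rewrite scalerA. Qed.

Fact scale_1bop : left_id 1 scale_bop.
Proof. by move=> T; apply: bop_ext => x /=; rewrite scale1r. Qed.

Fact scale_bopDr : right_distributive scale_bop +%R.
Proof. by move=> a S T; apply: bop_ext => x /=; rewrite scalerDr. Qed.

Fact scale_bopDl T : {morph scale_bop^~ T : a b / a + b}.
Proof. by move=> a b; apply: bop_ext => x /=; rewrite scalerDl. Qed.

HB.instance Definition _ := GRing.Zmodule_isLmodule.Build R[i] bop
  scale_bopA scale_1bop scale_bopDr scale_bopDl.

Definition opnorm T : R :=
  inf [set M : R | 0 <= M /\ forall x, hnorm (T x) <= M * hnorm x].

Lemma opnorm_ge0 T : 0 <= opnorm T.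
Proof.
apply: lb_le_inf; last by move=> M [].
by have [M M0 TM] := bop_bounded0 T; exists M.
Qed.

Lemma opnorm_le T (M : R) : 0 <= M -> (forall x, hnorm (T x) <= M * hnorm x) ->
  opnorm T <= M.
Proof. by move=> M0 TM; apply: ge_inf; [exists 0 => N []|split]. Qed.

Lemma hnorm_opnorm T x : hnorm (T x) <= opnorm T * hnorm x.
Proof.
have [x0|x0] := eqVneq (hnorm x) 0.
  by rewrite (hnorm_eq0 x0) bop0 hnorm0 mulr0.
have xp : 0 < hnorm x by rewrite lt_def x0 hnorm_ge0.
rewrite -ler_pdivrMr//; apply: lb_le_inf.
  by have [M M0 TM] := bop_bounded0 T; exists M.
by move=> M [_ TM]; rewrite ler_pdivrMr.
Qed.

Lemma ler_opnormD S T : opnorm (S + T) <= opnorm S + opnorm T.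
Proof.
apply: opnorm_le => [|x]; first by rewrite addr_ge0 ?opnorm_ge0.
by apply: le_trans (ler_hnormD _ _) _; rewrite mulrDl lerD ?hnorm_opnorm.
Qed.

Lemma opnormZ_le c T : opnorm (c *: T) <= Num.sqrt (normsq c) * opnorm T.
Proof.
apply: opnorm_le => [|x]; first by rewrite mulr_ge0 ?sqrtr_ge0 ?opnorm_ge0.
by rewrite hnormZ -mulrA ler_wpM2l ?sqrtr_ge0 ?hnorm_opnorm.
Qed.

Lemma normsq0 : normsq (0 : R[i]) = 0.
Proof. by rewrite /normsq/= expr0n addr0. Qed.

Lemma opnormZ c T : opnorm (c *: T) = Num.sqrt (normsq c) * opnorm T.
Proof.
apply/eqP; rewrite eq_le opnormZ_le/=.
have [->|c0] := eqVneq c 0.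
  by rewrite normsq0 sqrtr0 mul0r opnorm_ge0.
have n0 : 0 < Num.sqrt (normsq c).
  rewrite sqrtr_gt0 lt_def normsq_ge0 andbT.
  by apply: contra_neq c0; exact: normsq_eq0.
rewrite -ler_pdivlMl// -[X in opnorm X <= _](scalerK c0).
apply: le_trans (opnormZ_le _ _) _; rewrite ler_wpM2r ?opnorm_ge0//.
rewrite -(ler_pM2l n0) divff ?gt_eqF// -sqrtrM ?normsq_ge0// -normsqM divff//.
by rewrite /normsq/= expr0n addr0 expr1n sqrtr1.
Qed.

Lemma opnorm_eq0 T : opnorm T = 0 -> T = 0.
Proof.
move=> T0; apply: bop_ext => x; rewrite [RHS]scale0r; apply: hnorm_eq0.
apply/eqP; rewrite eq_le hnorm_ge0 andbT.
by have := hnorm_opnorm T x; rewrite T0 mul0r.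
Qed.

Fact cnormD S T : (opnorm (S + T))%:C <= (opnorm S)%:C + (opnorm T)%:C.
Proof. by rewrite -rmorphD/= lecR ler_opnormD. Qed.

Fact cnormZ c T : (opnorm (c *: T))%:C = `|c| * (opnorm T)%:C.
Proof. by rewrite opnormZ rmorphM/=; congr (_ * _); case: c. Qed.

Fact cnorm_eq0 T : (opnorm T)%:C = 0 -> T = 0.
Proof. by move=> [] /opnorm_eq0. Qed.

HB.instance Definition _ := Lmodule_isNormed.Build R[i] bop
  cnormD cnormZ cnorm_eq0.

Lemma normE T : `|T| = (opnorm T)%:C.
Proof. by []. Qed.

End operators.

Section shift.
Variables (R : realType) (I : choiceType) (h : I -> I) (h_inj : injective h).
Notation ell2 := (ell2 R I).
Implicit Types (x y : ell2) (c : R[i]).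

(* The isometry e_z |-> e_(h z) attached to an injective map h. *)
Definition shift_fun (f : I -> R[i]) (w : I) : R[i] :=
  if pselect (exists z, h z = w) is left e then f (projT1 (cid e)) else 0.

Lemma shift_funE f z : shift_fun f (h z) = f z.
Proof.
rewrite /shift_fun; case: pselect => [e|[]]; last by exists z.
by case: cid => /= z' /h_inj ->.
Qed.

Lemma shift_fun_out f w : ~ range h w -> shift_fun f w = 0.
Proof. by rewrite /shift_fun; case: pselect => // e w0; case: w0; case: e => z zw; exists z. Qed.

Lemma esum_shift (F : I -> \bar R) : (forall w, ~ range h w -> F w = 0%E) ->
  \esum_(w in [set: I]) F w = \esum_(z in [set: I]) F (h z).
Proof.
move=> F0; rewrite -(esum_image setT h); last by move=> ? ? _ _ /h_inj.
rewrite [RHS]esum_mkcond; apply: eq_esum => w _.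
by case: ifPn => // /negP; rewrite inE => /F0.
Qed.

Lemma rsum_shift (F : I -> R) : (forall w, ~ range h w -> F w = 0) ->
  rsum F = rsum (F \o h).
Proof.
move=> F0; rewrite /rsum; congr (fine _ - fine _);
  by apply: esum_shift => w /F0 ->; rewrite ?oppr0 maxxx.
Qed.

Lemma csum_shift (F : I -> R[i]) : (forall w, ~ range h w -> F w = 0) ->
  csum F = csum (F \o h).
Proof.
by move=> F0; rewrite /csum; congr (_ +i* _); apply: rsum_shift => w /F0 ->.
Qed.

Fact shift_ell2 x : shift_fun x \in @ell2_pred R I.
Proof.
apply/ell2_predP; rewrite esum_shift; last first.
  by move=> w /shift_fun_out ->; rewrite normsq0.
by under eq_esum do rewrite shift_funE; exact: ell2P.
Qed.

Fact coshift_ell2 x : (x \o h) \in @ell2_pred R I.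
Proof.
apply/ell2_predP; apply: le_lt_trans (ell2P x).
rewrite -(@esum_image _ _ _ _ h (fun i => (normsq (x i))%:E)); last first.
  by move=> ? ? _ _ /h_inj.
rewrite esum_mkcond; apply: le_esum => i _.
by case: ifPn; rewrite lee_fin// normsq_ge0.
Qed.

Definition shift x : ell2 := Ell2 (shift_ell2 x).
Definition coshift x : ell2 := Ell2 (coshift_ell2 x).

Fact shift_linear c x y : shift (c *: x + y) = c *: shift x + shift y.
Proof.
apply: ell2_ext => w; rewrite /= -[RHS]/(c * shift_fun x w + shift_fun y w).
rewrite /shift_fun; case: pselect => // _.
by rewrite mulr0 addr0.
Qed.

Fact shift_bounded : exists M : R, forall x, hnorm (shift x) <= M * hnorm x.
Proof.
exists 1 => x; rewrite mul1r le_eqVlt; apply/orP; left; apply/eqP.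
rewrite /hnorm /hnorm2 rsum_shift; last first.
  by move=> w /shift_fun_out /= ->; rewrite normsq0.
by congr (Num.sqrt (rsum _)); apply/funext => z; rewrite /= shift_funE.
Qed.

Fact shift_adjoint x y : dot (shift x) y = dot x (coshift y).
Proof.
rewrite /dot csum_shift; last by move=> w /shift_fun_out /= ->; rewrite mul0r.
by congr csum; apply/funext => z; rewrite /= shift_funE.
Qed.

Definition shift_op : bop R I := Bop shift_linear shift_bounded shift_adjoint.

End shift.

Section basis.
Variables (R : realType) (I : choiceType).

Fact ebasis_ell2 (i : I) : (fun j => (j == i)%:R) \in @ell2_pred R I.
Proof.
apply/ell2_predP; rewrite (_ : esum _ _ = \esum_(j in [set i]) 1%:E).
  by rewrite esum_set1 ?ltry// lee_fin.
rewrite [RHS]esum_mkcond; apply: eq_esum => j _.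
by rewrite in_set1; case: eqP => _; rewrite /normsq/= ?expr1n expr0n addr0.
Qed.

Definition ebasis (i : I) : ell2 R I := Ell2 (ebasis_ell2 i).

Lemma shift_op_ebasis (h : I -> I) (h_inj : injective h) (i : I) :
  shift_op R h_inj (ebasis i) = ebasis (h i).
Proof.
apply: ell2_ext => w /=; rewrite /shift_fun; case: pselect => [e|w0].
  by case: cid => /= z <-; rewrite (inj_eq h_inj).
by case: eqP => // wE; case: w0; exists i.
Qed.

End basis.

Notation posnat := {a : nat | (0 < a)%N}.

(* N x| N^x, the pair (m, a) carrying the positive integer a. *)
Definition PP : choiceType := (nat * posnat)%type.

Fact pos_mul_gt0 (a b : posnat) : (0 < val a * val b)%N.
Proof. by rewrite muln_gt0 (valP a) (valP b). Qed.

Definition pos_mul (a b : posnat) : posnat := exist _ (val a * val b)%N (pos_mul_gt0 a b).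

Definition pos_one : posnat := exist _ 1%N isT.

Definition pmul (x y : PP) : PP :=
  ((x.1 + val x.2 * y.1)%N, pos_mul x.2 y.2).

Definition ple (x y : PP) : bool :=
  [&& (x.1 <= y.1)%N, (val x.2 %| y.1 - x.1)%N & (val x.2 %| val y.2)%N].

Lemma pmul_inj x : injective (pmul x).
Proof.
case: x => m [a a0] [n [b b0]] [n' [b' b0']] [] /addnI /eqP.
rewrite eqn_pmul2l// => /eqP -> /eqP; rewrite eqn_pmul2l// => /eqP bb'.
by congr pair; apply: val_inj.
Qed.

Lemma pleP x y : ple x y <-> exists z, y = pmul x z.
Proof.
case: x y => m [a a0] [n [b b0]]; rewrite /ple /=; split.
  case/and3P => mn /dvdnP[k nk] /dvdnP[c bc].
  have c0 : (0 < c)%N by move: b0; rewrite bc muln_gt0 => /andP[].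
  exists (k, exist _ c c0); congr pair; last by apply: val_inj; rewrite /= mulnC.
  by rewrite /= mulnC -nk subnKC.
move=> [[k [c c0]]] [-> ->]; rewrite leq_addr addKn !dvdn_mulr//.
Qed.

Section toeplitz.
Variable R : realType.
Local Notation bop := (bop R PP).
Implicit Types (S T : bop) (A B : set bop).

(* T_x on l^2(P); shift_op_ebasis shows that T_x e_y = e_(xy). *)
Definition Tiso (x : PP) : bop := shift_op R (@pmul_inj x).

Definition s_op : bop := Tiso (1%N, pos_one).
Definition v_op (a : posnat) : bop := Tiso (0%N, a).

Definition cstar_subalgebra A : Prop :=
  [/\ closed A,
      forall (c : R[i]) S T, A S -> A T -> A (c *: S + T),
      forall S T, A S -> A T -> A (S * T)
    & forall T, A T -> A (adj T)].

Definition toeplitz : set bop := smallest cstar_subalgebra (range Tiso).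

(* s^m v_a v_b^* s^{*n} *)
Definition mono (m : nat) (a b : posnat) (n : nat) : bop :=
  s_op ^+ m * v_op a * adj (v_op b) * adj s_op ^+ n.

(* T(P)^delta, the closed span of the s^m v_a v_a^* s^{*m} *)
Definition toeplitz_fix : set bop :=
  closure [set T | exists (n : nat) (c : 'I_n -> R[i]) (x : 'I_n -> PP),
    T = \sum_(i < n) c i *: mono (x i).1 (x i).2 (x i).2 (x i).1].

Definition is_state A (phi : bop -> R[i]) : Prop :=
  [/\ forall (c : R[i]) S T, A S -> A T -> phi (c *: S + T) = c * phi S + phi T,
      forall T, A T -> 0 <= phi (adj T * T)
    & phi 1 = 1].

Definition star_endomorphism A (f : bop -> bop) : Prop :=
  [/\ forall T, A T -> A (f T),
      forall (c : R[i]) S T, A S -> A T -> f (c *: S + T) = c *: f S + f T,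
      forall S T, A S -> A T -> f (S * T) = f S * f T
    & forall T, A T -> f (adj T) = adj (f T)].

Definition prime_nat := {p : nat | prime p}.

Fact prime_pos_gt0 (p : prime_nat) : (0 < val p)%N.
Proof. exact: prime_gt0 (valP p). Qed.

Definition prime_pos (p : prime_nat) : posnat := exist _ (val p) (prime_pos_gt0 p).

(* p^{it} *)
Definition ipow (p : nat) (t : R) : R[i] :=
  cos (t * ln p%:R) +i* sin (t * ln p%:R).

Definition is_dynamics (sigma : R -> bop -> bop) : Prop :=
  [/\ forall t, star_endomorphism toeplitz (sigma t),
      forall T, toeplitz T -> sigma 0 T = T,
      forall t u T, toeplitz T -> sigma (t + u) T = sigma t (sigma u T)
    & forall T, toeplitz T -> continuous (fun t : R => sigma t T)] /\
  [/\ forall t, sigma t s_op = s_op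
    & forall t (p : prime_nat),
        sigma t (v_op (prime_pos p)) = ipow (val p) t *: v_op (prime_pos p)].

Definition analytic_extension (sigma : R -> bop -> bop) T (F : R[i]^o -> bop) :=
  [/\ forall z, toeplitz (F z),
      forall z, derivable F z 1
    & forall t : R, F t%:C = sigma t T].

Definition analytic (sigma : R -> bop -> bop) T : Prop :=
  toeplitz T /\ exists F, analytic_extension sigma T F.

(* F (0 +i* beta) is sigma_{i beta} (d). *)
Definition KMS_fin (sigma : R -> bop -> bop) (beta : R)
    (phi : bop -> R[i]) : Prop :=
  [/\ 0 < beta, is_state toeplitz phi
    & forall c d F, analytic sigma c -> analytic sigma d ->
        analytic_extension sigma d F ->
        phi (d * c) = phi (c * F (0 +i* beta))].

Definition directed (D : Type) (le : D -> D -> Prop) : Prop :=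
  [/\ inhabited D, forall i, le i i,
      forall i j k, le i j -> le j k -> le i k
    & forall i j, exists k, le i k /\ le j k].

Definition net_filter (D : Type) (le : D -> D -> Prop) : set_system D :=
  filter_from [set: D] (fun i => [set j | le i j]).

Definition KMS_infty (sigma : R -> bop -> bop) (phi : bop -> R[i]) : Prop :=
  is_state toeplitz phi /\
  exists (D : Type) (le : D -> D -> Prop) (beta_ : D -> R)
         (phi_ : D -> bop -> R[i]),
    [/\ directed le,
        forall i, KMS_fin sigma (beta_ i) (phi_ i),
        beta_ @ net_filter le --> +oo
      & forall T, toeplitz T ->
          (fun i => phi_ i T : R[i]^o) @ net_filter le --> (phi T : R[i]^o)].

Definition is_KMS (sigma : R -> bop -> bop) (beta : \bar R)
    (phi : bop -> R[i]) : Prop :=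
  match beta with
  | b%:E => KMS_fin sigma b phi
  | +oo%E => KMS_infty sigma phi
  | -oo%E => False
  end.

(* Positive elements of a C*-algebra are those of the form S^* S. *)
Definition faithful_cond_exp A B (E : bop -> bop) : Prop :=
  [/\ forall T, A T -> B (E T),
      forall T, B T -> E T = T,
      forall (c : R[i]) S T, A S -> A T -> E (c *: S + T) = c *: E S + E T
    & forall T, A T -> `|E T| <= `|T|] /\
  [/\ forall T, A T -> exists S, B S /\ E (adj T * T) = adj S * S,
      forall S T U, B S -> A T -> B U -> E (S * T * U) = S * E T * U
    & forall T, A T -> E (adj T * T) = 0 -> T = 0].

Definition is_canonical_expectation (E : bop -> bop) : Prop :=
  faithful_cond_exp toeplitz toeplitz_fix E /\
  forall m n a b, E (mono m a b n) =
    if (m == n) && (a == b) then mono m a b n else 0.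

End toeplitz.

Section nica.

Definition nica_set : set {ptws PP -> bool} :=
  [set w | [/\ exists x, w x,
               forall x y, ple x y -> w y -> w x
             & forall x y, w x -> w y -> exists z, [/\ w z, ple x z & ple y z]]].

Definition Omega : Type := set_type nica_set.
HB.instance Definition _ := Topological.on Omega.

(* Supernatural numbers: the exponent of each prime, None standing for
   infinity. *)
Definition supernat := prime_nat -> option nat.

Definition exp_le (e f : option nat) : bool :=
  match e, f with
  | _, None => true
  | Some k, Some l => (k <= l)%N
  | None, Some _ => false
  end.

Definition sdvd (M N : supernat) : Prop := forall p, exp_le (M p) (N p).

Definition snat (a : posnat) : supernat := fun p => Some (logn (val p) (val a)).

Definition ppow (p : prime_nat) (e : option nat) : supernat :=
  fun q => if q == p then e else Some 0%N.

Definition divisor (N : supernat) := {a : posnat | `[< sdvd (snat a) N >]}.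

Definition dval N (d : divisor N) : nat := val (val d).

(* Z/N is the inverse limit of the Z/aZ, a | N, each Z/aZ being identified with
   the discrete space of residues 'I_a. *)
Definition Zmod_set (N : supernat) :
    set (prod_topology (fun d : divisor N => discrete_topology 'I_(dval d))) :=
  [set r | forall d e : divisor N, (dval e %| dval d)%N ->
     (r d %% dval e)%N = r e :> nat].

Definition Zmod (N : supernat) : Type := set_type (@Zmod_set N).
HB.instance Definition _ N := Topological.on (Zmod N).

Definition residue N (r : Zmod N) (d : divisor N) : 'I_(dval d) := val r d.

End nica.

Section nica_sets.
Implicit Types (N M : supernat) (p : prime_nat).

Lemma exp_le_trans e f g : exp_le e f -> exp_le f g -> exp_le e g.
Proof. by case: e f g => [k|] [l|] [m|] //=; exact: leq_trans. Qed.

Lemma sdvd_trans M N (MN : sdvd M N) (d : divisor M) :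
  `[< sdvd (snat (val d)) N >].
Proof.
apply/asboolP => p; apply: exp_le_trans (MN p).
by have /asboolP := valP d; apply.
Qed.

Definition widen_divisor M N (MN : sdvd M N) (d : divisor M) : divisor N :=
  exist _ (val d) (sdvd_trans MN d).

Lemma dval_gt0 N (d : divisor N) : (0 < dval d)%N.
Proof. exact: (valP (val d)). Qed.

Lemma residueP N (r : Zmod N) (d e : divisor N) : (dval e %| dval d)%N ->
  (residue r d %% dval e)%N = residue r e.
Proof. by have := valP r; rewrite inE; apply. Qed.

Definition int_fun (N : supernat) (m : nat) :
    prod_topology (fun d : divisor N => discrete_topology 'I_(dval d)) :=
  fun d => Ordinal (ltn_pmod m (dval_gt0 d)).

Fact int_funP N m : @int_fun N m \in @Zmod_set N.
Proof. by rewrite inE => d e ed /=; rewrite modn_dvdm. Qed.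

Definition Zint N (m : nat) : Zmod N := exist _ (@int_fun N m) (int_funP N m).

HB.instance Definition _ N := isPointed.Build (Zmod N) (Zint N 0).

Definition add_fun N (r s : Zmod N) :
    prod_topology (fun d : divisor N => discrete_topology 'I_(dval d)) :=
  fun d => Ordinal (ltn_pmod (residue r d + residue s d) (dval_gt0 d)).

Fact add_funP N (r s : Zmod N) : add_fun r s \in @Zmod_set N.
Proof.
rewrite inE => d e ed /=.
by rewrite modn_dvdm// -modnDm (residueP r ed) (residueP s ed).
Qed.

Definition Zadd N (r s : Zmod N) : Zmod N := exist _ (add_fun r s) (add_funP r s).

Definition res_fun M N (MN : sdvd M N) (r : Zmod N) :
    prod_topology (fun d : divisor M => discrete_topology 'I_(dval d)) :=
  fun d => residue r (widen_divisor MN d).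

Fact res_funP M N (MN : sdvd M N) (r : Zmod N) : res_fun MN r \in @Zmod_set M.
Proof.
rewrite inE => d e ed.
exact: (@residueP N r (widen_divisor MN d) (widen_divisor MN e) ed).
Qed.

Definition Zres M N (MN : sdvd M N) (r : Zmod N) : Zmod M :=
  exist _ (res_fun MN r) (res_funP MN r).

Definition B_fun N (r : Zmod N) : {ptws PP -> bool} :=
  fun x => `[< exists2 d : divisor N, val d = x.2 &
                 (x.1 %% val x.2)%N = residue r d >].

Lemma logn_lcm_le (q a b : nat) (e : option nat) : (0 < a)%N -> (0 < b)%N ->
  exp_le (Some (logn q a)) e -> exp_le (Some (logn q b)) e ->
  exp_le (Some (logn q (lcmn a b))) e.
Proof.
case: e => //= k a0 b0 ak bk.
by rewrite logn_lcm// geq_max ak.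
Qed.

Lemma B_fun_nica N (r : Zmod N) : B_fun r \in nica_set.
Proof.
rewrite inE; split.
- have h : `[< sdvd (snat pos_one) N >].
    by apply/asboolP => p; rewrite /snat /= logn1; case: (N p).
  exists (0%N, pos_one); apply/asboolP; exists (exist _ pos_one h) => //.
  by have := ltn_ord (residue r (exist _ pos_one h)); case: (residue _ _) => -[].
- move=> [m a] [n b] /and3P[/= mn /dvdnP[k nk] ab] /asboolP[d db /= nr].
  have h : `[< sdvd (snat a) N >].
    apply/asboolP => p; have /asboolP/(_ p) := valP d; rewrite (db : val d = b).
    move=> H; apply: exp_le_trans H => /=; apply: dvdn_leq_log => //; exact: (valP b).
  apply/asboolP; exists (exist _ a h) => //=.
  rewrite -(@residueP _ _ d); last by rewrite /dval (db : val d = b).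
  rewrite -nr modn_dvdm// -(subnKC mn) nk.
  by rewrite addnC modnMDl.
- move=> [m a] [n b] /asboolP[d da /= mr] /asboolP[e eb /= nr].
  have c0 : (0 < lcmn (val a) (val b))%N by rewrite lcmn_gt0 (valP a) (valP b).
  pose c : posnat := exist _ (lcmn (val a) (val b)) c0.
  have h : `[< sdvd (snat c) N >].
    apply/asboolP => p; apply: logn_lcm_le.
    - exact: (valP a).
    - exact: (valP b).
    - by have /asboolP/(_ p) := valP d; rewrite (da : val d = a).
    - by have /asboolP/(_ p) := valP e; rewrite (eb : val e = b).
  pose f : divisor N := exist _ c h.
  pose l := ((m + n) * val c + residue r f)%N.
  have lr : (l %% val c)%N = residue r f.
    by rewrite modnMDl modn_small// (ltn_ord (residue r f)).
  have mnl : (m + n <= l)%N by rewrite (leq_trans _ (leq_addr _ _))// leq_pmulr.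
  exists (l, c); split.
  + by apply/asboolP; exists f.
  + apply/and3P; split; rewrite /= ?dvdn_lcml//.
      by rewrite (leq_trans _ mnl)// leq_addr.
    rewrite -eqn_mod_dvd; last by rewrite (leq_trans _ mnl)// leq_addr.
    rewrite mr -(modn_dvdm l (dvdn_lcml (val a) (val b))) lr.
    rewrite -(@residueP _ r f d); last by rewrite /dval (da : val d = a) dvdn_lcml.
    by rewrite /dval (da : val d = a).
  + apply/and3P; split; rewrite /= ?dvdn_lcmr//.
      by rewrite (leq_trans _ mnl)// leq_addl.
    rewrite -eqn_mod_dvd; last by rewrite (leq_trans _ mnl)// leq_addl.
    rewrite nr -(modn_dvdm l (dvdn_lcmr (val a) (val b))) lr.
    rewrite -(@residueP _ r f e); last by rewrite /dval (eb : val e = b) dvdn_lcmr.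
    by rewrite /dval (eb : val e = b).
Qed.

Definition Bset N (r : Zmod N) : Omega := exist _ (B_fun r) (B_fun_nica r).

Definition OmegaB_set : set Omega :=
  [set w | exists N (r : Zmod N), w = Bset r].

Definition OmegaB : Type := set_type OmegaB_set.
HB.instance Definition _ := Topological.on OmegaB.

Definition X_set p : set Omega :=
  [set w | exists (e : option nat) (r : Zmod (ppow p e)), w = Bset r].

Definition Xp p : Type := set_type (X_set p).
HB.instance Definition _ p := Topological.on (Xp p).

Fact OmegaB_elP N (r : Zmod N) : Bset r \in OmegaB_set.
Proof. by rewrite inE; exists N, r. Qed.

Definition OmegaB_el N (r : Zmod N) : OmegaB := exist _ (Bset r) (OmegaB_elP r).

Fact Xp_elP p e (r : Zmod (ppow p e)) : Bset r \in X_set p.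
Proof. by rewrite inE; exists e, r. Qed.

Definition Xp_el p e (r : Zmod (ppow p e)) : Xp p :=
  exist _ (Bset r) (Xp_elP r).

HB.instance Definition _ :=
  isPointed.Build OmegaB (OmegaB_el (point : Zmod (fun=> None))).
HB.instance Definition _ p :=
  isPointed.Build (Xp p) (Xp_el (point : Zmod (ppow p None))).

Lemma ppow_dvd p N : sdvd (ppow p (N p)) N.
Proof.
move=> q; rewrite /ppow; case: eqP => [->|_]; last by case: (N q).
by case: (N p) => //= k.
Qed.

Lemma OmegaB_inv (w : OmegaB) : exists t : {N : supernat & Zmod N},
  w = OmegaB_el (projT2 t).
Proof.
have := valP w; rewrite inE => -[N [r wE]].
by exists (existT _ N r); apply: val_inj.
Qed.

(* The p-th component of the homeomorphism: B(r, N) |-> B(r(p^e), p^e) with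
   e = e_p(N).  The pair (r, N) is determined by the set B(r, N). *)
Definition Xproj p (w : OmegaB) : Xp p :=
  let t := projT1 (cid (OmegaB_inv w)) in
  Xp_el (Zres (ppow_dvd p (projT1 t)) (projT2 t)).

End nica_sets.

(* T with its Borel sigma-algebra. *)
Notation Borel T := (g_sigma_algebraType (@open T)).

Section measures.
Variable R : realType.
Implicit Types (beta : \bar R) (p : prime_nat).

(* a^e for a >= 1 and e < +oo, with a^{-oo} = 0 if a > 1 and 1^{-oo} = 1. *)
Definition epow (a : nat) (e : \bar R) : R :=
  match e with
  | b%:E => a%:R `^ b
  | -oo%E => (a == 1)%:R
  | +oo%E => 0
  end.

Definition mu_series beta p (A : set (Borel (Xp p))) : \bar R :=
  ((1 - epow (val p) (1 - beta))%:E *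
   \sum_(0 <= k <oo) \esum_(r in [set: Zmod (ppow p (Some k))])
      (epow (val p) (- (beta * k%:R%:E)))%:E * \d_(Xp_el r : Borel (Xp p)) A)%E.

Definition is_haar N (lambda : probability (Borel (Zmod N)) R) : Prop :=
  forall (s : Zmod N) (A : set (Borel (Zmod N))), measurable A ->
    lambda ((fun r : Zmod N => Zadd s r) @^-1` A) = lambda A.

(* For beta = +oo the series reduces to the point mass at B(0, 1). *)
Definition is_mu_p beta p (mu : probability (Borel (Xp p)) R) : Prop :=
  if beta == 1%E then
    exists lambda : probability (Borel (Zmod (ppow p None))) R,
      is_haar lambda /\
      forall A : set (Borel (Xp p)), measurable A ->
        mu A = lambda ((fun r : Zmod (ppow p None) => Xp_el r) @^-1` A)
  else forall A : set (Borel (Xp p)), measurable A -> mu A = mu_series beta A.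

(* The image of mu under the homeomorphism (Xproj p)_p is the product of the
   mu_p. *)
Definition is_mu (mu_p : forall p, probability (Borel (Xp p)) R)
    (mu : probability (Borel OmegaB) R) : Prop :=
  forall (F : seq prime_nat) (A : forall p, set (Borel (Xp p))), uniq F ->
    (forall p, measurable (A p)) ->
    mu [set w : OmegaB | forall p, p \in F -> A p (Xproj p w)] =
    (\prod_(p <- F) mu_p p (A p))%E.

Definition mu_state (mu : probability (Borel OmegaB) R) (f : Omega -> R[i]) :
    R[i] :=
  (\int[mu]_w complex.Re (f (val (w : OmegaB))))%R +i*
  (\int[mu]_w complex.Im (f (val (w : OmegaB))))%R.

Local Notation bop := (bop R PP).

(* A *-isomorphism of T(P)^delta onto C(Omega) sending s^m v_a v_a^* s^{*m} to
   the characteristic function of {w : (m, a) in w}. *)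
Definition is_spectral_iso (Theta : bop -> Omega -> R[i]^o) : Prop :=
  [/\ forall T, toeplitz_fix T -> continuous (Theta T),
      forall T, toeplitz_fix T -> Theta T = (fun=> 0) -> T = 0
    & forall f : Omega -> R[i]^o, continuous f ->
        exists2 T, toeplitz_fix T & Theta T = f] /\
  [/\ forall (c : R[i]) S T w, toeplitz_fix S -> toeplitz_fix T ->
        Theta (c *: S + T) w = c * Theta S w + Theta T w,
      forall S T w, toeplitz_fix S -> toeplitz_fix T ->
        Theta (S * T) w = Theta S w * Theta T w,
      forall T w, toeplitz_fix T -> Theta (adj T) w = (Theta T w)^*
    & forall m a w, Theta (mono R m a a m) w = (val w (m, a))%:R].

End measures.

(* Main.v *)
(** A state mu^* o E only depends on the diagonal of an operator of l^2(P), and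
    mu_beta is used only through mu_beta {w : (m, a) in w} = a^-beta.

    For monomials d = T_x T_y^* and c = T_z T_w^*, the diagonal of d c is either
    0 or that of T_w T_w^* T_x T_x^*.  Hence psi (d c) is 0 or lcm(w_2, x_2)^-beta,
    where x_2 is the second coordinate of x, and
    psi (d c) = (w_2 / z_2)^-beta psi (c d) is an identity between least common
    multiples.  By density it holds for every d.  The operator sigma_t multiplies
    the (x, y) matrix coefficient by (y_2 / x_2)^(it): this passes from generators
    to limits because *-endomorphisms are contractive.  By uniqueness of analytic
    continuation, sigma_(i beta) of an analytic d has the coefficients of d
    multiplied by (y_2 / x_2)^-beta.  So c sigma_(i beta)(d) and
    (w_2 / z_2)^-beta c d have the same diagonal, which gives the KMS condition
    for c a monomial, and then for every c by density.

    For beta = oo, psi is the limit of the KMS states attached to the atomic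
    measures sum_a sum_(r < a) a^-s delta_(B(r, a)) / zeta(s - 1), s = 3, 4, ... *)

(* The obstacle is that sigma_(i beta) is unbounded: approximating an analytic d by monomials gives
   no control over F(i beta), where F is any entire operator-valued extension of t |-> sigma_t(d).
   Single matrix coefficients avoid this, since each turns F into a scalar entire function whose
   values on the real line are known. Uniqueness is then needed only in the form that an entire
   function vanishing on R vanishes at iB, and a Gaussian weight in Goursat's theorem for rectangles
   yields this without power series. Diagonals suffice because the elements of T(P)^delta are
   diagonal matrices and E preserves the diagonal. E, Theta and sigma are known by their algebraic
   properties. The norm bounds for Theta and sigma, on which the density arguments rest, are derived
   from the Neumann series rather than from spectral theory or compactness of Omega. The atomic
   measures of the limit case live directly on Omega_B, and s >= 3 makes the sum of a^(1-s) converge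
   by comparison with that of a^-2. *)
Require Import Defs.
From HB Require Import structures.
From mathcomp Require Import all_boot all_order all_algebra finmap.
From mathcomp Require Import all_classical all_reals all_analysis.
From mathcomp Require Import complex zify ring lra.

Set Implicit Arguments.
Unset Strict Implicit.
Unset Printing Implicit Defensive.

Import Order.TTheory GRing.Theory Num.Theory.
Import numFieldNormedType.Exports.
Local Open Scope classical_set_scope.
Local Open Scope complex_scope.
Local Open Scope ring_scope.

(** * Operators on a Hilbert space *)

Section modulus.
Variable R : realType.
Implicit Types z w : R[i].

(* The norm of the library on R[i] takes values in R[i]. *)
Definition cabs z : R := Num.sqrt (normsq z).

Lemma cabsE z : `|z| = (cabs z)%:C.
Proof. by case: z. Qed.

Lemma cabs_ge0 z : 0 <= cabs z.
Proof. exact: sqrtr_ge0. Qed.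

Lemma cabs2 z : cabs z ^+ 2 = normsq z.
Proof. by rewrite sqr_sqrtr// normsq_ge0. Qed.

Lemma cabsM z w : cabs (z * w) = cabs z * cabs w.
Proof. by rewrite /cabs normsqM sqrtrM// normsq_ge0. Qed.

Lemma ler_cabsD z w : cabs (z + w) <= cabs z + cabs w.
Proof. by rewrite -lecR rmorphD/= -!cabsE ler_normD. Qed.

Lemma cabsN z : cabs (- z) = cabs z.
Proof. by case: z => a b; rewrite /cabs /normsq /= !sqrrN. Qed.

Lemma cabs0 : cabs 0 = 0.
Proof. by rewrite /cabs normsq0 sqrtr0. Qed.

Lemma cabs_real (x : R) : cabs x%:C = `|x|.
Proof. by rewrite /cabs /normsq/= expr0n addr0 sqrtr_sqr. Qed.

Lemma cabs_eq0 z : cabs z = 0 -> z = 0.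
Proof. by move=> z0; apply: normsq_eq0; rewrite -cabs2 z0 expr0n. Qed.

Lemma ler_Re_cabs z : `|complex.Re z| <= cabs z.
Proof. by rewrite -sqrtr_sqr ler_sqrt ?normsq_ge0// lerDl sqr_ge0. Qed.

Lemma ler_Im_cabs z : `|complex.Im z| <= cabs z.
Proof. by rewrite -sqrtr_sqr ler_sqrt ?normsq_ge0// lerDr sqr_ge0. Qed.

Lemma ler_cabs_ReIm z : cabs z <= `|complex.Re z| + `|complex.Im z|.
Proof.
rewrite -(@ler_pXn2r _ 2) ?nnegrE ?cabs_ge0 ?addr_ge0// cabs2 sqrrD.
by rewrite !real_normK ?num_real// -addrA lerD2l lerDr mulrn_wge0 ?mulr_ge0.
Qed.

End modulus.

(** * Completeness of l^2 *)

Section ell2_complete.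
Variables (R : realType) (I : choiceType).
Notation ell2 := (ell2 R I).
Implicit Types x y z : ell2.

Lemma normsq_le_hnorm2 x i : normsq (x i) <= hnorm2 x.
Proof.
rewrite /hnorm2 rsum_ge0E; last by move=> j; exact: normsq_ge0.
rewrite -lee_fin fineK; last first.
  by apply: esum_fin (ell2P x) => j; exact: normsq_ge0.
by apply: esum_ge; exists [set i]; [split|rewrite fsbig_set1].
Qed.

Lemma hnormN x : hnorm (- x) = hnorm x.
Proof. by rewrite -scaleN1r hnormZ /normsq/= sqrrN expr1n oppr0 expr0n addr0 sqrtr1
  mul1r. Qed.

Lemma cabs_le_hnorm x i : cabs (x i) <= hnorm x.
Proof. by rewrite ler_sqrt ?hnorm2_ge0// normsq_le_hnorm2. Qed.

Lemma hnorm2_le_fsum x (M : R) : 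
  (forall X : {fset I}, \sum_(i <- X) normsq (x i) <= M) -> hnorm2 x <= M.
Proof.
move=> H; rewrite /hnorm2 rsum_ge0E; last by move=> j; exact: normsq_ge0.
rewrite -lee_fin fineK; last first.
  by apply: esum_fin (ell2P x) => j; exact: normsq_ge0.
apply: ge_ereal_sup => _ [X [finX _]] <-.
by rewrite fsbig_finite//= sumEFin lee_fin.
Qed.

Lemma fsum_le_hnorm2 x (X : {fset I}) : \sum_(i <- X) normsq (x i) <= hnorm2 x.
Proof.
rewrite /hnorm2 rsum_ge0E; last by move=> j; exact: normsq_ge0.
rewrite -lee_fin fineK; last first.
  by apply: esum_fin (ell2P x) => j; exact: normsq_ge0.
apply: esum_ge; exists [set` X]; first by split.
by rewrite fsbig_finite// set_fsetK sumEFin.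
Qed.

(** Since [e n] bounds the whole tail after n, a single small value of [e] settles the Cauchy
    property for a given precision. *)
Lemma real_cauchy_rate (u e : nat -> R) :
  (forall eps, 0 < eps -> exists n, e n < eps) ->
  (forall n m, (n <= m)%N -> `|u m - u n| <= e n) ->
  exists l : R, u @ \oo --> l.
Proof.
move=> e0 H; exists (lim (u @ \oo)).
suff : cvg (u @ \oo) by [].
apply/cauchy_cvgP; apply: (@cauchy_exP R R) => eps eps0.
have [n en] := e0 _ eps0; exists (u n).
suff : \forall m \near \oo, ball (u n) eps (u m) by [].
near=> m; rewrite -ball_normE /= distrC; apply: le_lt_trans en; apply: H.
by near: m; exact: nbhs_infty_ge.
Unshelve. all: by end_near.
Qed.

Lemma complex_cauchy_rate (u : nat -> R[i]) (e : nat -> R) :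
  (forall eps, 0 < eps -> exists n, e n < eps) ->
  (forall n m, (n <= m)%N -> cabs (u m - u n) <= e n) ->
  exists l : R[i], (fun n => complex.Re (u n)) @ \oo --> complex.Re l /\
                   (fun n => complex.Im (u n)) @ \oo --> complex.Im l.
Proof.
move=> e0 H.
have [a ua] : exists a : R, (fun n => complex.Re (u n)) @ \oo --> a.
  apply: (real_cauchy_rate e0) => n m nm; apply: le_trans (H _ _ nm).
  by apply: le_trans (ler_Re_cabs _); case: (u m) (u n) => ? ? [].
have [b ub] : exists b : R, (fun n => complex.Im (u n)) @ \oo --> b.
  apply: (real_cauchy_rate e0) => n m nm; apply: le_trans (H _ _ nm).
  by apply: le_trans (ler_Im_cabs _); case: (u m) (u n) => ? ? [].
by exists (a +i* b).
Qed.

(** The coordinates converge, and each finite sum of squares of [u n - l] is a limit of sums bounded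
    by [e n ^+ 2]. The limit thus inherits the rate [e] with the same constant, which [bop_complete]
    relies on. *)
Lemma ell2_complete (u : nat -> ell2) (e : nat -> R) :
  (forall eps, 0 < eps -> exists n, e n < eps) ->
  (forall n m, (n <= m)%N -> hnorm (u m - u n) <= e n) ->
  exists x, forall n, hnorm (u n - x) <= e n.
Proof.
move=> e0 H.
have H' i n m : (n <= m)%N -> cabs (u m i - u n i) <= e n.
  by move=> nm; apply: le_trans (H _ _ nm); exact: (cabs_le_hnorm (u m - u n)).
pose l i := projT1 (cid (complex_cauchy_rate e0 (H' i))).
have lre i : (fun n => complex.Re (u n i)) @ \oo --> complex.Re (l i).
  by rewrite /l; case: cid => z [].
have lim_ i : (fun n => complex.Im (u n i)) @ \oo --> complex.Im (l i).
  by rewrite /l; case: cid => z [].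
have bnd n (X : {fset I}) : \sum_(i <- X) normsq (u n i - l i) <= e n ^+ 2.
  have : (fun m => \sum_(i <- X) normsq (u n i - u m i)) @ \oo -->
      \sum_(i <- X) normsq (u n i - l i).
    apply: cvg_big => [|i _]; first exact: add_continuous.
    have -> : (fun m => normsq (u n i - u m i)) =
      (fun m => (complex.Re (u n i) - complex.Re (u m i)) ^+ 2
              + (complex.Im (u n i) - complex.Im (u m i)) ^+ 2).
      by apply/funext => m; case: (u n i) (u m i) => ? ? [].
    have -> : normsq (u n i - l i) =
      (complex.Re (u n i) - complex.Re (l i)) ^+ 2
              + (complex.Im (u n i) - complex.Im (l i)) ^+ 2.
      by case: (u n i) (l i) => ? ? [].
    rewrite !expr2; under eq_fun do rewrite !expr2.
    by apply: cvgD; apply: cvgM; apply: cvgB => //; apply: cvg_cst.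
  move=> cv; apply: (ler_cvg_to cv (cvg_cst (e n ^+ 2))); near=> m.
  have nm : (n <= m)%N by near: m; exact: nbhs_infty_ge.
  have := H _ _ nm; rewrite -hnormN opprB => nm'.
  apply: le_trans (fsum_le_hnorm2 (u n - u m) X) _.
  by rewrite -hnormE ler_pXn2r// nnegrE ?hnorm_ge0// (le_trans _ nm')// hnorm_ge0.
have dl n : (fun i => u n i - l i) \in @ell2_pred R I.
  apply/ell2_predP; apply: (@le_lt_trans _ _ (e n ^+ 2)%:E); last by rewrite ltry.
  apply: ge_ereal_sup => _ [X [finX _]] <-.
  by rewrite fsbig_finite//= sumEFin lee_fin.
(* It is the differences [u n - l] that are known to be square summable, so [l] becomes an element
   of [ell2] as [u 0] minus one of them. *)
pose x : ell2 := u 0%N - Ell2 (dl 0%N).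
have xE i : x i = l i by rewrite /= opprB addrC subrK.
exists x => n; rewrite -(@ler_pXn2r _ 2) ?nnegrE ?hnorm_ge0//; last first.
  by apply: le_trans (H n n _); rewrite ?hnorm_ge0.
rewrite hnormE; apply: hnorm2_le_fsum => X; apply: le_trans (bnd n X).
apply: ler_sum => i _; rewrite (_ : (u n - x) i = u n i - x i)//.
by rewrite xE.
Unshelve. all: by end_near.
Qed.

Lemma hnorm_small x : (forall eps, 0 < eps -> hnorm x <= eps) -> x = 0.
Proof.
move=> H; apply: hnorm_eq0; apply/eqP; rewrite eq_le hnorm_ge0 andbT.
by apply/ler_addgt0Pl => eps /H; rewrite addr0.
Qed.

Lemma dotNl x y : dot (- x) y = - dot x y.
Proof. by rewrite -scaleN1r dotZl mulN1r. Qed.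

Lemma dotNr x y : dot x (- y) = - dot x y.
Proof. by rewrite -scaleN1r dotZr rmorphN1 mulN1r. Qed.

Lemma cabs_dot x y : cabs (dot x y) <= hnorm x * hnorm y.
Proof.
rewrite /hnorm -sqrtrM ?hnorm2_ge0// ler_sqrt ?cauchy_schwarz//.
by rewrite mulr_ge0 ?hnorm2_ge0.
Qed.

End ell2_complete.

(** * The algebra of bounded operators: completeness, Neumann series, contractive homomorphisms *)

Section bop_complete.
Variables (R : realType) (I : choiceType).
Notation bop := (bop R I).
Notation ell2 := (ell2 R I).
Implicit Types (S T U : bop) (x y z : ell2).

Lemma bopD S T x : (S + T) x = S x + T x. Proof. by []. Qed.
Lemma bopM S T x : (S * T) x = S (T x). Proof. by []. Qed.
Lemma bop1 x : (1 : bop) x = x. Proof. by []. Qed.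
Lemma bopZ c T x : (c *: T) x = c *: T x. Proof. by []. Qed.
Lemma bopN T x : (- T) x = - T x. Proof. exact: scaleN1r. Qed.
Lemma bopB S T x : (S - T) x = S x - T x. Proof. by rewrite bopD bopN. Qed.
Lemma bop0E x : (0 : bop) x = 0. Proof. exact: scale0r. Qed.
Lemma bop_sum (J : Type) (r : seq J) (F : J -> bop) x :
  (\sum_(j <- r) F j) x = \sum_(j <- r) F j x.
Proof.
by elim: r => [|j r IH]; rewrite ?big_nil ?bop0E// !big_cons bopD IH.
Qed.

Lemma bop_scaler T c x : T (c *: x) = c *: T x.
Proof. by have := bop_linear T c x 0; rewrite bop0 !addr0. Qed.

Lemma dot_adj T x y : dot (T x) y = dot x (adj T y).
Proof. exact: bop_adjoint. Qed.

Lemma adjK T : adj (adj T) = T.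
Proof. exact: bop_ext. Qed.
Lemma adjM S T : adj (S * T) = adj T * adj S.
Proof. exact: bop_ext. Qed.
Lemma adjD S T : adj (S + T) = adj S + adj T.
Proof. exact: bop_ext. Qed.
Lemma adjZ c T : adj (c *: T) = c^* *: adj T.
Proof. exact: bop_ext. Qed.
Lemma adj_one : adj (1 : bop) = 1.
Proof. exact: bop_ext. Qed.
Lemma adjN T : adj (- T) = - adj T.
Proof. by rewrite -scaleN1r adjZ rmorphN1 scaleN1r. Qed.
Lemma adjB S T : adj (S - T) = adj S - adj T.
Proof. by rewrite adjD adjN. Qed.

Lemma bopZAl c S T : (c *: S) * T = c *: (S * T).
Proof. exact: bop_ext. Qed.
Lemma bopZAr c S T : S * (c *: T) = c *: (S * T).
Proof. by apply: bop_ext => x; rewrite bopZ !bopM bopZ bop_scaler. Qed.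

Lemma opnormM S T : opnorm (S * T) <= opnorm S * opnorm T.
Proof.
apply: opnorm_le => [|x]; first by rewrite mulr_ge0 ?opnorm_ge0.
rewrite bopM -mulrA; apply: le_trans (hnorm_opnorm _ _) _.
by rewrite ler_wpM2l ?opnorm_ge0 ?hnorm_opnorm.
Qed.

Lemma opnormN T : opnorm (- T) = opnorm T.
Proof. by rewrite -scaleN1r opnormZ /normsq/= sqrrN expr1n oppr0 expr0n addr0 sqrtr1
  mul1r. Qed.

Lemma opnormB S T : opnorm (S - T) = opnorm (T - S).
Proof. by rewrite -opnormN opprB. Qed.

Lemma opnorm1 : opnorm (1 : bop) <= 1.
Proof. by apply: opnorm_le => // x; rewrite mul1r. Qed.

Lemma opnorm_adj_le T : opnorm (adj T) <= opnorm T.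
Proof.
apply: opnorm_le => [|y]; first exact: opnorm_ge0.
set z := adj T y; have [z0|z0] := eqVneq (hnorm z) 0.
  by rewrite z0 mulr_ge0 ?hnorm_ge0 ?opnorm_ge0.
have zp : 0 < hnorm z by rewrite lt_def z0 hnorm_ge0.
rewrite -(ler_pM2l zp) -expr2 hnormE.
have -> : hnorm2 z = complex.Re (dot (T z) y) by rewrite bop_adjoint dotxx.
apply: le_trans (Re_dot_le _ _) _; rewrite mulrA ler_wpM2r ?hnorm_ge0//.
by rewrite mulrC hnorm_opnorm.
Qed.

Lemma opnorm_adj T : opnorm (adj T) = opnorm T.
Proof. by apply/eqP; rewrite eq_le opnorm_adj_le/= -{1}(adjK T) opnorm_adj_le. Qed.

Lemma opnormX (T : bop) n : opnorm (T ^+ n) <= opnorm T ^+ n.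
Proof.
elim: n => [|n IH]; first by rewrite !expr0 opnorm1.
rewrite !exprS; apply: le_trans (opnormM _ _) _.
by rewrite ler_wpM2l ?opnorm_ge0.
Qed.

Lemma normbopE T : `|T| = (opnorm T)%:C. Proof. by []. Qed.

(** The norm takes values in [R[i]], so balls have complex radii. Positivity of a radius forces its
    imaginary part to vanish, which reduces everything to real estimates of [opnorm]. *)
Lemma bop_closureP (A : set bop) T :
  closure A T <-> forall e : R, 0 < e -> exists2 S, A S & opnorm (T - S) < e.
Proof.
split=> [AT e e0|H B].
  have /AT[S [AS]] : nbhs T (ball T e%:C).
    by apply: nbhsx_ballx; rewrite ltcR.
  rewrite -ball_normE /= normbopE ltcR => TS.
  by exists S.
move=> /nbhs_ballP[[e e'] /= e0 eB].
have [/eqP e'0 e1] : e' == 0 /\ 0 < e by move: e0; rewrite ltcE /= => /andP[].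
have [S AS TS] := H _ e1; exists S; split=> //; apply: eB.
by rewrite -ball_normE /= normbopE e'0 ltcR.
Qed.

Lemma bop_closed_mem (A : set bop) T : closed A ->
  (forall e : R, 0 < e -> exists2 S, A S & opnorm (T - S) < e) -> A T.
Proof. by move=> cA /bop_closureP; exact: cA. Qed.

(** A [bop] carries its adjoint, so the limit of the adjoints is built alongside; they converge at
    the same rate because [adj] preserves [opnorm]. Linearity and the adjoint relation hold up to
    arbitrarily small errors, hence exactly. *)
Lemma bop_complete (S : nat -> bop) (e : nat -> R) :
  (forall eps, 0 < eps -> exists n, e n < eps) ->
  (forall n m, (n <= m)%N -> opnorm (S m - S n) <= e n) ->
  exists T, forall n, opnorm (S n - T) <= e n.
Proof.
move=> e0 H.
have e_ge0 n : 0 <= e n by apply: le_trans (H n n _); rewrite ?opnorm_ge0.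
have lims (V : nat -> bop) : (forall n m, (n <= m)%N -> opnorm (V m - V n) <= e n) ->
    exists f : ell2 -> ell2, forall x n, hnorm (V n x - f x) <= e n * hnorm x.
  move=> HV; have Hx x : exists y, forall n, hnorm (V n x - y) <= e n * hnorm x.
    apply: (@ell2_complete _ _ (fun n => V n x)) => [eps eps0|n m nm].
      have h0 : 0 < hnorm x + 1 by rewrite ltr_wpDl// hnorm_ge0.
      have [n en] := e0 _ (divr_gt0 eps0 h0); exists n.
      apply: (@le_lt_trans _ _ (e n * (hnorm x + 1))).
        by rewrite ler_wpM2l// lerDl.
      by rewrite -ltr_pdivlMr.
    rewrite -bopB; apply: le_trans (hnorm_opnorm _ _) _.
    by rewrite ler_wpM2r ?hnorm_ge0 ?HV.
  by exists (fun x => projT1 (cid (Hx x))) => x n; case: cid.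
have [f Hf] := lims S H.
have [g Hg] : exists g : ell2 -> ell2, forall x n, hnorm (adj (S n) x - g x) <= e n *
  hnorm x.
  by apply: (lims (fun n => adj (S n))) => n m nm; rewrite -adjB opnorm_adj H.
have small (c : R) : 0 <= c -> forall eps, 0 < eps -> exists n, e n * c <= eps.
  move=> c0 eps eps0; have c1 : 0 < c + 1 by rewrite ltr_wpDl.
  have [n en] := e0 _ (divr_gt0 eps0 c1); exists n.
  apply: (@le_trans _ _ (e n * (c + 1))); first by rewrite ler_wpM2l// lerDl.
  by rewrite -ler_pdivlMr// ltW.
have f_lin c x y : f (c *: x + y) = c *: f x + f y.
  apply/eqP; rewrite -subr_eq0; apply/eqP; apply: hnorm_small => eps eps0.
  have [|n en] := small (hnorm (c *: x + y) + Num.sqrt (normsq c) * hnorm x + hnorm y) _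
    _ eps0.
    by rewrite !addr_ge0 ?mulr_ge0 ?hnorm_ge0 ?sqrtr_ge0.
  apply: le_trans en.
  have -> : f (c *: x + y) - (c *: f x + f y) =
    - (S n (c *: x + y) - f (c *: x + y)) + c *: (S n x - f x) + (S n y - f y).
    rewrite bop_linear scalerBr opprB -!addrA; congr (_ + _).
    by rewrite [c *: S n x + (- (c *: f x) + _)]addrA [in RHS]addrACA -opprD addKr.
  apply: le_trans (ler_hnormD _ _) _; rewrite !mulrDr lerD//.
  apply: le_trans (ler_hnormD _ _) _; rewrite lerD ?hnormN//.
  by rewrite hnormZ mulrCA ler_wpM2l ?sqrtr_ge0.
have f_bnd : exists M : R, forall x, hnorm (f x) <= M * hnorm x.
  exists (opnorm (S 0%N) + e 0%N) => x.
  rewrite -[f x](subKr (S 0%N x)) mulrDl.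
  apply: le_trans (ler_hnormD _ _) _; rewrite hnormN lerD//.
  exact: hnorm_opnorm.
have fg x y : dot (f x) y = dot x (g y).
  apply/eqP; rewrite -subr_eq0; apply/eqP; apply: cabs_eq0; apply/eqP.
  rewrite eq_le cabs_ge0 andbT; apply/ler_addgt0Pl => eps eps0; rewrite addr0.
  have [|n en] := small (hnorm x * hnorm y + hnorm x * hnorm y) _ _ eps0.
    by rewrite addr_ge0 ?mulr_ge0 ?hnorm_ge0.
  apply: le_trans en.
  have -> : dot (f x) y - dot x (g y) =
      - dot (S n x - f x) y + dot x (adj (S n) y - g y).
    rewrite dotDl dotDr dotNl dotNr dot_adj.
    by rewrite opprB -addrA; congr (_ + _); rewrite addKr.
  apply: le_trans (ler_cabsD _ _) _; rewrite cabsN mulrDr lerD//.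
    apply: le_trans (cabs_dot _ _) _.
    by rewrite mulrA ler_wpM2r ?hnorm_ge0.
  apply: le_trans (cabs_dot _ _) _.
  by rewrite mulrCA ler_wpM2l ?hnorm_ge0.
exists (Bop f_lin f_bnd fg) => n; apply: opnorm_le => // x.
by rewrite bopB; exact: Hf.
Qed.

Lemma geometric_small (r : R) : 0 <= r < 1 -> forall c eps, 0 <= c -> 0 < eps ->
  exists n, r ^+ n * c < eps.
Proof.
move=> /andP[r0 r1] c eps c0 eps0.
have : (fun n => r ^+ n * c) @ \oo --> (0 * c : R).
  by apply: cvgM; [apply: cvg_expr; rewrite ger0_norm|apply: cvg_cst].
rewrite mul0r => /cvgr_lt/(_ _ eps0)[n _ H].
by exists n; apply: H => /=.
Qed.

(** What the Neumann series asks of an algebra. Both [toeplitz] and [toeplitz_fix] qualify. *)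
Definition closed_unital_algebra (A : set bop) : Prop :=
  [/\ closed A, forall (c : R[i]) S T, A S -> A T -> A (c *: S + T),
      forall S T, A S -> A T -> A (S * T) & A 1].

(** The partial sums of the powers of [X] are Cauchy with rate r^n / (1 - r). That [Y] stays inside
    [A] is the point: homomorphisms and characters are controlled only there, and they will be
    applied to [Y]. *)
Lemma neumann_inverse (A : set bop) X : closed_unital_algebra A -> A X ->
  opnorm X < 1 -> exists2 Y, A Y & Y * (1 - X) = 1.
Proof.
move=> [cA lA mA A1] AX X1.
set r := opnorm X; have r01 : 0 <= r < 1 by rewrite opnorm_ge0.
have r1 : 0 < 1 - r by rewrite subr_gt0.
pose S n := \sum_(i < n) X ^+ i.
have SS n : S n.+1 = S n + X ^+ n by rewrite /S big_ord_recr.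
have AXn n : A (X ^+ n).
  by elim: n => [|n IH]; rewrite ?expr0// exprS; exact: mA.
have A0 : A 0 by have := lA (-1) 1 1 A1 A1; rewrite scaleN1r addNr.
have AS n : A (S n).
  elim: n => [|n IH]; first by rewrite /S big_ord0.
  by rewrite SS -[S n]scale1r; exact: lA.
pose e n := r ^+ n * (1 - r)^-1.
have [||Y YS] := @bop_complete S e.
- by move=> eps eps0; apply: geometric_small => //; rewrite invr_ge0 ltW.
- move=> n m nm; apply: (@le_trans _ _ ((r ^+ n - r ^+ m) * (1 - r)^-1)); last first.
    by rewrite ler_wpM2r ?invr_ge0 ?(ltW r1)// lerBlDr lerDl exprn_ge0 ?opnorm_ge0.
  move: nm => /subnKC <-; elim: (m - n)%N => [|k IH].
    by rewrite addn0 !subrr mul0r -(scale0r (0 : bop)) opnormZ normsq0 sqrtr0 mul0r.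
  rewrite addnS SS addrAC; apply: le_trans (ler_opnormD _ _) _.
  have -> : (r ^+ n - r ^+ (n + k).+1) * (1 - r)^-1 =
      (r ^+ n - r ^+ (n + k)) * (1 - r)^-1 + r ^+ (n + k).
    by rewrite exprS; field; rewrite gt_eqF.
  by rewrite lerD// opnormX.
have e_small eps c : 0 < eps -> 0 <= c -> exists n, e n * c < eps.
  move=> eps0 c0; have [|//|n en] := @geometric_small r r01 ((1 - r)^-1 * c) eps.
    by rewrite mulr_ge0// invr_ge0 ltW.
  by exists n; rewrite /e -mulrA.
exists Y.
  apply: bop_closed_mem cA _ => eps eps0.
  have [//|n en] := e_small eps 1 eps0; exists (S n) => //.
  by rewrite opnormB; apply: le_lt_trans (YS n) _; rewrite -[e n]mulr1.
apply/eqP; rewrite -subr_eq0; apply/eqP/opnorm_eq0/eqP.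
rewrite eq_le opnorm_ge0 andbT; apply/ler_addgt0Pl => eps eps0; rewrite addr0.
have c0 : 0 <= opnorm (1 - X) + (1 - r) by rewrite addr_ge0 ?opnorm_ge0 ?(ltW r1).
have [n /ltW en] := e_small eps _ eps0 c0; apply: le_trans en.
have -> : Y * (1 - X) - 1 = - ((S n - Y) * (1 - X)) - X ^+ n.
  have SX : S n * (1 - X) = 1 - X ^+ n.
    elim: n => [|n IH]; first by rewrite /S big_ord0 mul0r expr0 subrr.
    rewrite SS mulrDl IH mulrBr mulr1 -exprSr.
    by rewrite addrA subrK.
  by rewrite mulrBl SX !opprB -!addrA; congr (_ + _); rewrite addrC subrK.
apply: le_trans (ler_opnormD _ _) _; rewrite !opnormN [leRHS]mulrDr lerD//.
  by apply: le_trans (opnormM _ _) _; rewrite ler_wpM2r ?opnorm_ge0.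
by rewrite /e divfK ?gt_eqF// opnormX.
Qed.

(* If K = f T had |K| > |T|, then 1 - T^* T / |K|^2 would be invertible in A, so
   1 - K^* K / |K|^2 would be bounded below; it is not, because K almost attains
   its norm. *)
Lemma star_hom_contractive (A : set bop) (f : bop -> bop) T :
  closed_unital_algebra A -> (forall T, A T -> A (adj T)) ->
  (forall (c : R[i]) S T, A S -> A T -> f (c *: S + T) = c *: f S + f T) ->
  (forall S T, A S -> A T -> f (S * T) = f S * f T) ->
  (forall T, A T -> f (adj T) = adj (f T)) -> f 1 = 1 ->
  A T -> opnorm (f T) <= opnorm T.
Proof.
move=> cA aA fl fM fa f1 AT; have [_ lA mA A1] := cA.
rewrite leNgt; apply/negP => Tk.
set k := opnorm (f T) in Tk; have k0 : 0 < k by apply: le_lt_trans Tk; exact: opnorm_ge0.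
have k20 : 0 < k ^+ 2 by rewrite exprn_gt0.
have A0 : A 0 by have := lA (-1) 1 1 A1 A1; rewrite scaleN1r addNr.
have f0 : f 0 = 0.
  by have := fl (-1) 1 1 A1 A1; rewrite !scaleN1r !addNr.
pose c : R[i] := ((k ^+ 2)^-1)%:C.
pose X := c *: (adj T * T).
have AX : A X by rewrite -[X]addr0; apply: lA => //; apply: mA => //; exact: aA.
have X1 : opnorm X < 1.
  rewrite /X opnormZ -[Num.sqrt _]/(cabs c) cabs_real ger0_norm ?invr_ge0 ?(ltW k20)//.
  rewrite mulrC ltr_pdivrMr// mul1r; apply: le_lt_trans (opnormM _ _) _.
  by rewrite opnorm_adj -expr2 ltr_pXn2r// nnegrE ?opnorm_ge0 ?(ltW k0).
have [Y AY YX] := neumann_inverse cA AX X1.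
set K := f T.
have fX : f X = c *: (adj K * K).
  have := fl c (adj T * T) 0 (mA _ _ (aA _ AT) AT) A0.
  by rewrite f0 !addr0 fM ?fa//; exact: aA.
have f1X : f (1 - X) = 1 - f X.
  have := fl (-1) X 1 AX A1; rewrite !scaleN1r f1.
  by rewrite addrC => ->; rewrite addrC.
have A1X : A (1 - X) by have := lA (-1) X 1 AX A1; rewrite scaleN1r addrC.
have YK : f Y * (1 - c *: (adj K * K)) = 1 by rewrite -fX -f1X -fM// YX.
set M := opnorm (f Y).
(* [f Y] sends z = x - K^* K x / k^2 to x, and expanding the square gives |z|^2 <= |x|^2 - |K x|^2 /
   k^2, because K^* has norm k. *)
have est x : hnorm2 x <= M ^+ 2 * (hnorm2 x - (k ^+ 2)^-1 * hnorm2 (K x)).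
  set z := x - c *: adj K (K x).
  have zE : f Y z = x by rewrite -[RHS]/((1 : bop) x) -YK bopM bopB bop1.
  apply: (@le_trans _ _ (M ^+ 2 * hnorm2 z)).
    rewrite -!hnormE -exprMn ler_pXn2r ?nnegrE ?mulr_ge0 ?hnorm_ge0 ?opnorm_ge0//.
    by rewrite -{1}zE hnorm_opnorm.
  rewrite ler_wpM2l ?sqr_ge0//.
  have -> : hnorm2 z = hnorm2 x - 2 * ((k ^+ 2)^-1 * hnorm2 (K x))
     + (k ^+ 2)^-1 ^+ 2 * hnorm2 (adj K (K x)).
    rewrite /z -scaleN1r scalerA hnorm2D hnorm2Z dotZr normsqM.
    rewrite -dot_adj dotxx /c /normsq/=.
    by simpl; ring.
  have H : hnorm2 (adj K (K x)) <= k ^+ 2 * hnorm2 (K x).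
    rewrite -!hnormE -exprMn ler_pXn2r ?nnegrE ?mulr_ge0 ?hnorm_ge0 ?(ltW k0)//.
    by apply: le_trans (hnorm_opnorm _ _) _; rewrite opnorm_adj.
  rewrite -addrA lerD2l mulr_natl mulr2n opprD -addrA gerDl addrC subr_le0.
  apply: le_trans (ler_wpM2l (sqr_ge0 _) H) _.
  by rewrite expr2 -mulrA mulKf ?gt_eqF.
(* The estimate solved for |K x|; M^2 + 1 replaces M^2 so that it can be inverted. The factor is
   less than k^2, against k being the norm of K. *)
have Ke x : hnorm2 (K x) <= (k ^+ 2 * (1 - (M ^+ 2 + 1)^-1)) * hnorm2 x.
  have M1 : 0 < M ^+ 2 + 1 by rewrite ltr_wpDl ?sqr_ge0.
  have := est x; set a := hnorm2 x; set b := hnorm2 (K x) => E.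
  have a0 : 0 <= a := hnorm2_ge0 _.
  have b0 : 0 <= b := hnorm2_ge0 _.
  have d0 : 0 <= a - (k ^+ 2)^-1 * b.
    rewrite subr_ge0 ler_pdivrMl// /a /b -!hnormE -exprMn.
    by rewrite ler_pXn2r ?nnegrE ?mulr_ge0 ?hnorm_ge0 ?(ltW k0)// hnorm_opnorm.
  have E' : a <= (M ^+ 2 + 1) * (a - (k ^+ 2)^-1 * b).
    by apply: le_trans E _; rewrite ler_wpM2r// lerDl.
  move: E'; rewrite -ler_pdivrMl// => E'.
  rewrite -mulrA -ler_pdivrMl// mulrBl mul1r.
  by rewrite lerBrDr -lerBrDl.
have q0 : 0 <= 1 - (M ^+ 2 + 1)^-1.
  by rewrite subr_ge0 invf_le1 ?lerDr ?sqr_ge0// ltr_wpDl ?sqr_ge0.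
have : k <= k * Num.sqrt (1 - (M ^+ 2 + 1)^-1).
  apply: opnorm_le => [|x]; first by rewrite mulr_ge0 ?sqrtr_ge0 ?(ltW k0).
  rewrite -(@ler_pXn2r _ 2) ?nnegrE ?mulr_ge0 ?sqrtr_ge0 ?hnorm_ge0 ?(ltW k0)//.
  by rewrite !exprMn !hnormE sqr_sqrtr.
rewrite -[X in X <= _]mulr1 ler_pM2l// -[X in X <= _]sqrtr1 ler_sqrt//.
by rewrite lerBrDr gerDl invr_le0 leNgt ltr_wpDl ?sqr_ge0.
Qed.

End bop_complete.

(** * Uniqueness of analytic continuation *)

Section complex_derivative.
Variable R : realType.
Implicit Types (z h w D : R[i]) (f g : R[i] -> R[i]) (e d : R).

(** A first-order expansion with error e |h| instead of a quotient, so that h = 0 is included and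
    compositions need no case distinction. *)
Definition cderiv_at f z D := forall e, 0 < e -> exists2 d : R, 0 < d &
  forall h, cabs h < d -> cabs (f (z + h) - f z - D * h) <= e * cabs h.

Definition entire f := forall z, exists D, cderiv_at f z D.

(** Rescaling e by |C| + 1 absorbs the constant, so the estimates for products, compositions and the
    exponential may lose a fixed factor and assume e <= 1. *)
Lemma cderiv_at_suff f z D (C : R) :
  (forall e, 0 < e -> e <= 1 -> exists2 d : R, 0 < d & forall h, cabs h < d ->
     cabs (f (z + h) - f z - D * h) <= C * e * cabs h) ->
  cderiv_at f z D.
Proof.
move=> H e e0; pose C' := `|C| + 1.
have C0 : 0 < C' by rewrite ltr_wpDl.
pose e' := Num.min 1 (e / C').
have e'0 : 0 < e' by rewrite lt_min ltr01 divr_gt0.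
have [|d d0 Hd] := H e' e'0; first by rewrite ge_min lexx.
exists d => // h hd; apply: le_trans (Hd _ hd) _.
rewrite ler_wpM2r ?cabs_ge0//; apply: (@le_trans _ _ (C' * e')).
  by rewrite ler_wpM2r ?(ltW e'0)// (le_trans (ler_norm _))// lerDl.
by rewrite -ler_pdivlMl// mulrC ge_min lexx orbT.
Qed.

Lemma cderiv_at_lip f z D : cderiv_at f z D -> exists2 d : R, 0 < d &
  forall h, cabs h < d -> cabs (f (z + h) - f z) <= (cabs D + 1) * cabs h.
Proof.
move=> /(_ 1 ltr01)[d d0 H]; exists d => // h hd.
rewrite -[X in cabs X](subrK (D * h)); apply: le_trans (ler_cabsD _ _) _.
by rewrite cabsM mulrDl addrC lerD2l H.
Qed.

Lemma cderiv_cst c z : cderiv_at (fun=> c) z 0.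
Proof.
move=> e e0; exists 1 => // h _.
by rewrite subrr mul0r subrr cabs0 mulr_ge0 ?(ltW e0) ?cabs_ge0.
Qed.

Lemma cderiv_id z : cderiv_at id z 1.
Proof.
move=> e e0; exists 1 => // h _.
rewrite (_ : _ - _ = 0); first by rewrite cabs0 mulr_ge0 ?(ltW e0) ?cabs_ge0.
by ring.
Qed.

Lemma cderivD f g z Df Dg : cderiv_at f z Df -> cderiv_at g z Dg ->
  cderiv_at (fun w => f w + g w) z (Df + Dg).
Proof.
move=> fD gD; apply: (@cderiv_at_suff _ _ _ 2) => e e0 e1.
have [d1 d10 H1] := fD e e0; have [d2 d20 H2] := gD e e0.
exists (Num.min d1 d2); first by rewrite lt_min d10.
move=> h; rewrite lt_min => /andP[h1 h2].
have -> : f (z + h) + g (z + h) - (f z + g z) - (Df + Dg) * h =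
  (f (z + h) - f z - Df * h) + (g (z + h) - g z - Dg * h) by ring.
apply: le_trans (ler_cabsD _ _) _.
by rewrite -mulrA mulr_natl mulr2n lerD ?H1 ?H2.
Qed.

Lemma cderivM f g z Df Dg : cderiv_at f z Df -> cderiv_at g z Dg ->
  cderiv_at (fun w => f w * g w) z (Df * g z + f z * Dg).
Proof.
move=> fD gD; have [d3 d30 H3] := cderiv_at_lip gD.
set K := cabs Dg + 1 in H3.
have K0 : 0 <= K by rewrite addr_ge0 ?cabs_ge0.
apply: (@cderiv_at_suff _ _ _ (cabs (g z) + K + cabs (f z) + cabs Df * K)) => e e0 e1.
have [d1 d10 H1] := fD e e0; have [d2 d20 H2] := gD e e0.
exists (Num.min (Num.min d1 d2) (Num.min d3 e)).
  by rewrite !lt_min d10 d20 d30.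
move=> h; rewrite !lt_min => /andP[/andP[h1 h2] /andP[h3 he]].
have -> : f (z + h) * g (z + h) - f z * g z - (Df * g z + f z * Dg) * h =
  (f (z + h) - f z - Df * h) * g z + (f (z + h) - f z - Df * h) * (g (z + h) - g z)
  + f z * (g (z + h) - g z - Dg * h) + Df * h * (g (z + h) - g z) by ring.
apply: le_trans (ler_cabsD _ _) _; rewrite [leRHS](_ : _ =
  (cabs (g z) * e * cabs h + K * e * cabs h + cabs (f z) * e * cabs h)
  + cabs Df * K * e * cabs h); last by ring.
have K1 : cabs (g (z + h) - g z) <= K * e.
  by apply: le_trans (H3 _ h3) _; rewrite ler_wpM2l// ltW.
have K2 : cabs (g (z + h) - g z) <= K.
  by apply: le_trans K1 _; rewrite -[leRHS]mulr1 ler_wpM2l.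
apply: lerD; [apply: le_trans (ler_cabsD _ _) _; apply: lerD|].
- apply: le_trans (ler_cabsD _ _) _; apply: lerD; rewrite cabsM.
    by rewrite mulrC -mulrA ler_wpM2l ?cabs_ge0 ?H1.
  apply: (@le_trans _ _ (e * cabs h * K)).
    by rewrite ler_pM ?cabs_ge0 ?H1.
  by rewrite mulrC mulrA.
- by rewrite cabsM -mulrA ler_wpM2l ?cabs_ge0 ?H2.
- rewrite !cabsM -!mulrA ler_wpM2l ?cabs_ge0// mulrC mulrA.
  by rewrite ler_wpM2r ?cabs_ge0.
Qed.

Lemma cderiv_comp f g z Df Dg : cderiv_at f (g z) Df -> cderiv_at g z Dg ->
  cderiv_at (fun w => f (g w)) z (Df * Dg).
Proof.
move=> fD gD; have [d3 d30 H3] := cderiv_at_lip gD.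
set K := cabs Dg + 1 in H3.
have K0 : 0 < K by rewrite ltr_wpDl ?cabs_ge0.
apply: (@cderiv_at_suff _ _ _ (K + cabs Df)) => e e0 e1.
have [d1 d10 H1] := fD e e0; have [d2 d20 H2] := gD e e0.
exists (Num.min (Num.min (d1 / K) d2) d3).
  by rewrite !lt_min divr_gt0// d20 d30.
move=> h; rewrite !lt_min => /andP[/andP[h1 h2] h3].
set k := g (z + h) - g z.
have gk : g (z + h) = g z + k by rewrite /k [RHS]addrC subrK.
have kd : cabs k < d1.
  by apply: le_lt_trans (H3 _ h3) _; rewrite mulrC -ltr_pdivlMr.
have -> : f (g (z + h)) - f (g z) - Df * Dg * h =
  (f (g z + k) - f (g z) - Df * k) + Df * (g (z + h) - g z - Dg * h).
  by rewrite gk /k; ring.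
apply: le_trans (ler_cabsD _ _) _; rewrite -mulrA mulrDl; apply: lerD.
  apply: le_trans (H1 _ kd) _; rewrite mulrCA ler_wpM2l ?(ltW e0)//.
  exact: H3.
by rewrite cabsM ler_wpM2l ?cabs_ge0 ?H2.
Qed.

Lemma real_deriv0 (f : R -> R) (df : R) : is_derive (0 : R) 1 f df ->
  forall e, 0 < e -> exists2 d : R, 0 < d &
  forall h : R, `|h| < d -> `|f h - f 0 - df * h| <= e * `|h|.
Proof.
move=> [fd fE] e e0.
have := fd; rewrite /derivable => /cvg_ex[l /= fl].
have le : l = df by rewrite -fE /derive; apply/esym/cvg_lim.
move: fl; rewrite le => /cvgrPdist_le/(_ e e0).
rewrite near_withinE => /nbhs_ballP[d /= d0 H]; exists d => // h hd.
have [->|h0] := eqVneq h 0; first by rewrite mulr0 subrr subr0 normr0 mulr0.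
have := H h; rewrite -ball_normE /= sub0r normrN => /(_ hd h0).
rewrite addr0 [h *: 1]mulr1 => {}H.
have hp : 0 < `|h| by rewrite normr_gt0.
rewrite -ler_pdivrMr// -normfV -normrM mulrC.
suff -> : h^-1 * (f h - f 0 - df * h) = - (df - h^-1 *: (f h - f 0)) by rewrite normrN.
by rewrite /GRing.scale/=; field.
Qed.

(** Assembled from the real exp, cos and sin: differentiability at 0 comes from theirs, and
    elsewhere from [cexpD]. *)
Definition cexp z : R[i] :=
  (expR (complex.Re z) * cos (complex.Im z)) +i* (expR (complex.Re z) * sin (complex.Im z)).

Lemma cexpD z w : cexp (z + w) = cexp z * cexp w.
Proof.
case: z w => a b [c d]; rewrite /cexp /= expRD cosD sinD.
by apply/eqP; rewrite eq_complex /=; apply/andP; split; apply/eqP; ring.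
Qed.

Lemma cabs_cexp z : cabs (cexp z) = expR (complex.Re z).
Proof.
rewrite /cabs /normsq /cexp /= !exprMn -mulrDr cos2Dsin2 mulr1 sqrtr_sqr ger0_norm//
  expR_ge0.
Qed.

Lemma cexp0 : cexp 0 = 1.
Proof. by rewrite /cexp/= expR0 cos0 sin0 !mul1r. Qed.

Lemma cderiv_cexp0 : cderiv_at cexp 0 1.
Proof.
have e_d : is_derive (0 : R) 1 expR 1 by rewrite -[X in is_derive _ _ _ X]expR0; exact:
  is_derive_expR.
have c_d : is_derive (0 : R) 1 cos 0.
  by have := is_derive_cos (0 : R); rewrite sin0 oppr0.
have s_d : is_derive (0 : R) 1 sin 1 by rewrite -[X in is_derive _ _ _ X]cos0; exact:
  is_derive_sin.
(* The bounds below add up to 9 e |h|; 14 leaves slack. *)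
apply: (@cderiv_at_suff _ _ _ 14) => e e0 e1.
have [d1 d10 H1] := real_deriv0 e_d e0; have [d2 d20 H2] := real_deriv0 c_d e0.
have [d3 d30 H3] := real_deriv0 s_d e0.
exists (Num.min (Num.min d1 d2) (Num.min d3 e)); first by rewrite !lt_min d10 d20 d30.
move=> [x y]; rewrite !lt_min => /andP[/andP[h1 h2] /andP[h3 he]].
have xh : `|x| <= cabs (x +i* y) := ler_Re_cabs (x +i* y).
have yh : `|y| <= cabs (x +i* y) := ler_Im_cabs (x +i* y).
set h := cabs (x +i* y) in h1 h2 h3 he xh yh *.
have := H1 x (le_lt_trans xh h1); have := H2 y (le_lt_trans yh h2).
have := H3 y (le_lt_trans yh h3).
rewrite add0r expR0 cos0 sin0 mul1r mul0r !subr0 => A3 A2 A1.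
rewrite /cexp /= expR0 cos0 sin0 mul1r mulr0.
have E1 : `|expR x - 1| <= 2 * h.
  rewrite -[X in `|X|](subrK x); apply: le_trans (ler_normD _ _) _.
  rewrite mulr_natl mulr2n mul1r in A1 *; apply: lerD => //; apply: le_trans A1 _.
  by apply: le_trans xh; rewrite -[leRHS]mul1r ler_wpM2r.
have h1' : h <= 1 by rewrite (le_trans (ltW he)).
have h0 : 0 <= h := cabs_ge0 _.
have E2 : `|expR x| <= 3.
  rewrite -[X in `|X|](subrK 1); apply: le_trans (ler_normD _ _) _.
  rewrite normr1; apply: (@le_trans _ _ (2 * h + 1)); first by rewrite lerD2r.
  by lra.
rewrite [X in cabs X](_ : _ = (expR x * cos y - 1 - (1 * x - 0 * y)) +i*
  (expR x * sin y - (1 * y + 0 * x))); last first.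
  by apply/eqP; rewrite eq_complex /=; apply/andP; split; apply/eqP; ring.
apply: le_trans (ler_cabs_ReIm _) _ => /=.
have -> : expR x * cos y - 1 - (1 * x - 0 * y) = (expR x - 1 - 1 * x) + expR x * (cos y -
  1) by ring.
have -> : expR x * sin y - (1 * y + 0 * x) = expR x * (sin y - 1 * y) + (expR x - 1) * y
  by ring.
have B1 : `|expR x - 1 - 1 * x + expR x * (cos y - 1)| <= e * h + 3 * (e * h).
  apply: le_trans (ler_normD _ _) _; rewrite normrM lerD//.
    by apply: le_trans A1 _; rewrite ler_wpM2l// ltW.
  rewrite ler_pM//; apply: le_trans A2 _; rewrite ler_wpM2l//; exact: ltW.
have B2 : `|expR x * (sin y - 1 * y) + (expR x - 1) * y| <= 3 * (e * h) + 2 * (e * h).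
  apply: le_trans (ler_normD _ _) _; rewrite !normrM; apply: lerD.
    by rewrite ler_pM// mul1r; apply: le_trans A3 _; rewrite ler_wpM2l// ltW.
  rewrite mulrA ler_pM// (le_trans E1)// ler_wpM2l// ltW//.
apply: le_trans (lerD B1 B2) _.
have eh0 : 0 <= e * h by rewrite mulr_ge0// ltW.
by rewrite -mulrA; move: eh0; set t := e * h; lra.
Qed.

Lemma cderiv_cexp z : cderiv_at cexp z (cexp z).
Proof.
move=> e e0.
have c0 : 0 < expR (complex.Re z) := expR_gt0 _.
have [d d0 H] := cderiv_cexp0 (divr_gt0 e0 c0); exists d => // h hd.
have := H _ hd; rewrite add0r cexp0 cexpD mul1r.
have -> : cexp z * cexp h - cexp z - cexp z * h = cexp z * (cexp h - 1 - h) by ring.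
by rewrite cabsM cabs_cexp -ler_pdivlMl// mulrA [_^-1 * e]mulrC.
Qed.

Lemma entire_cst c : entire (fun=> c).
Proof. by move=> z; exists 0; exact: cderiv_cst. Qed.

Lemma entireD f g : entire f -> entire g -> entire (fun z => f z + g z).
Proof. by move=> ef eg z; have [D fD] := ef z; have [E gE] := eg z; exists (D + E);
  exact: cderivD. Qed.

Lemma entireM f g : entire f -> entire g -> entire (fun z => f z * g z).
Proof.
move=> ef eg z; have [D fD] := ef z; have [E gE] := eg z.
by exists (D * g z + f z * E); exact: cderivM.
Qed.

Lemma entire_id : entire id.
Proof. by move=> z; exists 1; exact: cderiv_id. Qed.

Lemma entire_cexp f : entire f -> entire (fun z => cexp (f z)).
Proof.
move=> ef z; have [D fD] := ef z; exists (cexp (f z) * D).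
by apply: (@cderiv_comp cexp) => //; exact: cderiv_cexp.
Qed.

Lemma entire_continuousP f (z : R[i]) : entire f -> forall e, 0 < e ->
  exists2 d : R, 0 < d & forall h, cabs h < d -> cabs (f (z + h) - f z) < e.
Proof.
move=> /(_ z)[D /cderiv_at_lip[d d0 H]] e e0.
have K0 : 0 < cabs D + 1 by rewrite ltr_wpDl ?cabs_ge0.
exists (Num.min d (e / (cabs D + 1))); first by rewrite lt_min d0 divr_gt0.
move=> h; rewrite lt_min => /andP[hd he]; apply: le_lt_trans (H _ hd) _.
by rewrite mulrC -ltr_pdivlMr.
Qed.

(** Directions w = 1 and w = i give the sides of rectangles, where continuity makes the integrals
    meaningful. *)
Lemma entire_line_continuous f (z w : R[i]) : entire f ->
  continuous (fun t : R => complex.Re (f (z + t%:C * w)) : R) /\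
  continuous (fun t : R => complex.Im (f (z + t%:C * w)) : R).
Proof.
move=> ef.
have H (t e : R) : 0 < e -> exists2 d : R, 0 < d &
    forall s : R, `|t - s| < d -> cabs (f (z + t%:C * w) - f (z + s%:C * w)) <= e.
  move=> e0; have [d d0 Hd] := entire_continuousP (z + t%:C * w) ef e0.
  have K0 : 0 < cabs w + 1 by rewrite ltr_wpDl ?cabs_ge0.
  exists (d / (cabs w + 1)); first by rewrite divr_gt0.
  move=> s ts.
  have -> : z + s%:C * w = z + t%:C * w + (s - t)%:C * w.
    by rewrite rmorphB/=; ring.
  rewrite -cabsN opprB; apply/ltW/Hd; rewrite cabsM cabs_real distrC.
  apply: (@le_lt_trans _ _ (`|t - s| * (cabs w + 1))).
    by rewrite ler_wpM2l// lerDl.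
  by rewrite -ltr_pdivlMr.
split=> t; apply/cvgrPdist_le => e e0; have [d d0 Hd] := H t e e0;
  near=> s; (apply: le_trans (Hd s _); last by near: s; exact: cvgr_dist_lt).
- by apply: le_trans (ler_Re_cabs _); case: (f _) (f _) => ? ? [].
- by apply: le_trans (ler_Im_cabs _); case: (f _) (f _) => ? ? [].
Unshelve. all: by end_near.
Qed.

End complex_derivative.

(** * Integrals of continuous functions over segments *)

Section interval_integral.
Variable R : realType.
Implicit Types (u v : R -> R) (a b c M : R).

Definition Jint u a b : R := \int[@lebesgue_measure R]_(x in `[a, b]) u x.

Lemma Jint_integrable u a b : continuous u ->
  (@lebesgue_measure R).-integrable `[a, b] (EFin \o u).
Proof.
move=> cu; apply: continuous_compact_integrable; first exact: segment_compact.
exact: continuous_subspaceT.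
Qed.

Lemma JintB u v a b : continuous u -> continuous v ->
  Jint (fun x => u x - v x) a b = Jint u a b - Jint v a b.
Proof. by move=> cu cv; rewrite /Jint RintegralB//; exact: Jint_integrable. Qed.

Lemma Jint_split u a b c : continuous u -> a <= b -> b <= c ->
  Jint u a c = Jint u a b + Jint u b c.
Proof.
move=> cu ab bc; rewrite /Jint.
have ii := Jint_integrable a c cu.
have := @Rintegral_itvB _ u (BLeft a) (BRight c) b ii.
rewrite !bnd_simp => /(_ ab bc) H.
rewrite -(@Rintegral_itv_obnd_cbnd _ b (BRight c)) -?H; last first.
  apply: integrableS (Jint_integrable b c cu) => //.
  by apply: subset_itvr; rewrite bnd_simp.
by rewrite addrC subrK.
Qed.

Lemma Jint_le u v a b : continuous u -> continuous v ->
  (forall x, a <= x <= b -> u x <= v x) -> Jint u a b <= Jint v a b.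
Proof.
move=> cu cv H; apply: le_Rintegral => //; try exact: Jint_integrable.
Qed.

Lemma Jint_cst a b c : a <= b -> Jint (fun=> c) a b = c * (b - a).
Proof.
move=> ab; rewrite /Jint Rintegral_cst//; congr (c * _).
transitivity (fine (if (a%:E < b%:E)%E then (b%:E - a%:E)%E else 0%E)).
  by congr fine; exact: lebesgue_measure_itv.
move: ab; rewrite le_eqVlt => /predU1P[->|ab]; first by rewrite ltxx subrr.
by rewrite lte_fin ab.
Qed.

Lemma Jint_ge u a b c : continuous u -> a <= b ->
  (forall x, a <= x <= b -> c <= u x) -> c * (b - a) <= Jint u a b.
Proof.
move=> cu ab H; rewrite -Jint_cst//; apply: Jint_le => // x; exact: cvg_cst.
Qed.

Lemma Jint_approx u a b c M : continuous u -> a <= b ->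
  (forall x, a <= x <= b -> `|u x - c| <= M) ->
  `|Jint u a b - c * (b - a)| <= M * (b - a).
Proof.
move=> cu ab H; rewrite ler_distl; apply/andP; split.
  rewrite -mulrBl; apply: Jint_ge => // x /H.
  by rewrite ler_distl => /andP[].
rewrite -mulrDl -Jint_cst//; apply: Jint_le => //; first by move=> x; exact: cvg_cst.
by move=> x /H; rewrite ler_distl => /andP[].
Qed.

Lemma continuous_bounded u a b : continuous u -> a <= b ->
  exists2 M : R, 0 < M & forall x, a <= x <= b -> `|u x| <= M.
Proof.
move=> cu ab.
have [|x _ Hx] := @EVT_max R (fun x => `|u x|) a b ab.
  by apply: continuous_subspaceT => x; apply: continuous_comp; [exact: cu|exact:
    norm_continuous].
exists (`|u x| + 1); first by rewrite ltr_wpDl.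
move=> y yab; apply: (@le_trans _ _ `|u x|); last by rewrite lerDl.
by apply: Hx; rewrite in_itv.
Qed.

End interval_integral.

(** * Goursat's theorem for rectangles *)

Section goursat.
Variable R : realType.
Variable f : R[i] -> R[i].
Hypothesis ef : entire f.

(* Real part of the integral of f along the boundary of the rectangle
   [a, a + w] x [c, c + h]. *)
Let hor (c a b : R) : R := Jint (fun x => complex.Re (f (x +i* c))) a b.
Let ver (a c d : R) : R := Jint (fun y => complex.Im (f (a +i* y))) c d.
(** On a vertical side dz = i dy, and the real part of i f is minus the imaginary part of f; this
    gives the signs for the counterclockwise boundary. *)
Let bd (a c w h : R) : R :=
  hor c a (a + w) - hor (c + h) a (a + w) - ver (a + w) c (c + h) + ver a c (c + h).

Let cRe c : continuous (fun x : R => complex.Re (f (x +i* c)) : R).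
Proof.
have [H _] := entire_line_continuous (0 +i* c) 1 ef.
suff -> : (fun x : R => complex.Re (f (x +i* c)) : R) =
  (fun t : R => complex.Re (f (0 +i* c + t%:C * 1)) : R) by [].
by apply/funext => x; congr (complex.Re (f _)); rewrite mulr1 addrC; apply/eqP; rewrite
  eq_complex /= addr0 add0r !eqxx.
Qed.

Let cIm a : continuous (fun y : R => complex.Im (f (a +i* y)) : R).
Proof.
have [_ H] := entire_line_continuous (a +i* 0) 'i ef.
suff -> : (fun y : R => complex.Im (f (a +i* y)) : R) =
  (fun t : R => complex.Im (f (a +i* 0 + t%:C * 'i)) : R) by [].
apply/funext => y; congr (complex.Im (f _)); apply/eqP; rewrite eq_complex /=.
by apply/andP; split; apply/eqP; ring.
Qed.

Let bd_split (a c w h : R) : 0 <= w -> 0 <= h ->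
  bd a c (w + w) (h + h) = bd a c w h + bd (a + w) c w h + bd a (c + h) w h + bd (a + w)
    (c + h) w h.
Proof.
move=> w0 h0; rewrite /bd.
have H c' : hor c' a (a + (w + w)) = hor c' a (a + w) + hor c' (a + w) (a + w + w).
  by rewrite addrA; apply: Jint_split => //; rewrite lerDl.
have V a' : ver a' c (c + (h + h)) = ver a' c (c + h) + ver a' (c + h) (c + h + h).
  by rewrite addrA; apply: Jint_split => //; rewrite lerDl.
rewrite !H !V !addrA; ring.
Qed.

(** Pigeonhole on the four terms of [bd_split]. *)
Let bd_quarter (a c w h : R) : 0 <= w -> 0 <= h -> exists ac : R * R,
  [/\ a <= ac.1 <= a + w, c <= ac.2 <= c + h
    & `|bd a c (w + w) (h + h)| <= 4 * `|bd ac.1 ac.2 w h| ].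
Proof.
move=> w0 h0; rewrite bd_split//.
set p := bd a c w h; set q := bd (a + w) c w h; set r := bd a (c + h) w h.
set s := bd (a + w) (c + h) w h.
have N : `|p + q + r + s| <= `|p| + `|q| + `|r| + `|s|.
  apply: le_trans (ler_normD _ _) _; rewrite lerD2r.
  apply: le_trans (ler_normD _ _) _; rewrite lerD2r; exact: ler_normD.
have [P|P] := leP (`|p + q + r + s|) (4 * `|p|).
  by exists (a, c); rewrite /= !lexx !lerDl w0 h0; split.
have [Q|Q] := leP (`|p + q + r + s|) (4 * `|q|).
  by exists (a + w, c); rewrite /= !lexx !lerDl w0 h0; split.
have [T|T] := leP (`|p + q + r + s|) (4 * `|r|).
  by exists (a, c + h); rewrite /= !lexx !lerDl w0 h0; split.
exists (a + w, c + h); rewrite /= !lexx !lerDl w0 h0; split=> //.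
by lra.
Qed.

(** Near z, f is affine with slope D up to the error e (w + h). The affine part contributes w h Im D
    on the horizontal sides and the opposite on the vertical ones, so only the errors remain. *)
Let bd_local z D (e : R) : 0 < e -> cderiv_at f z D -> exists2 d : R, 0 < d &
  forall a c w h : R, 0 <= w -> 0 <= h -> w + h < d ->
    a <= complex.Re z <= a + w -> c <= complex.Im z <= c + h ->
    `|bd a c w h| <= 2 * e * (w + h) ^+ 2.
Proof.
move=> e0 fD; have [d d0 Hd] := fD e e0; exists d => // a c w h w0 h0 wh.
case: z fD Hd => zx zy /= fD Hd /andP[xa xw] /andP[yc yh].
have near x y : a <= x <= a + w -> c <= y <= c + h ->
    cabs (f (x +i* y) - f (zx +i* zy) - D * ((x - zx) +i* (y - zy))) <= e * (w + h).
  move=> /andP[x1 x2] /andP[y1 y2].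
  set k := (x - zx) +i* (y - zy).
  have kE : x +i* y = (zx +i* zy) + k.
    by apply/eqP; rewrite eq_complex /= ![_ + (_ - _)]addrC !subrK !eqxx.
  have kwh : cabs k <= w + h.
    apply: le_trans (ler_cabs_ReIm _) _ => /=.
    by apply: lerD; rewrite ler_norml; apply/andP; split; lra.
  rewrite kE; apply: le_trans (Hd _ _) _; first exact: le_lt_trans wh.
  by rewrite ler_wpM2l// ltW.
have horE : hor c a (a + w) - hor (c + h) a (a + w) =
    Jint (fun x => complex.Re (f (x +i* c)) - complex.Re (f (x +i* (c + h)))) a (a + w).
  by rewrite JintB.
have verE : ver (a + w) c (c + h) - ver a c (c + h) =
    Jint (fun y => complex.Im (f ((a + w) +i* y)) - complex.Im (f (a +i* y))) c (c + h).
  by rewrite JintB.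
have A : `|hor c a (a + w) - hor (c + h) a (a + w) - (complex.Im D * h) * (a + w - a)| <=
    2 * (e * (w + h)) * (a + w - a).
  rewrite horE; apply: Jint_approx.
  - by move=> x; apply: cvgB; exact: cRe.
  - by rewrite lerDl.
  move=> x xa'.
  have cc : c <= c <= c + h by rewrite lexx lerDl.
  have ch : c <= c + h <= c + h by rewrite lexx lerDl h0.
  have N1 := le_trans (ler_Re_cabs _) (near x c xa' cc).
  have N2 := le_trans (ler_Re_cabs _) (near x (c + h) xa' ch).
  move: N1 N2; case: (f (x +i* c)) (f (x +i* (c + h))) (f (zx +i* zy)) D {fD Hd near horE
    verE} => [u1 v1] [u2 v2] [u3 v3] [d1' d2'] /=.
  rewrite !ler_norml => /andP[? ?] /andP[? ?]; apply/andP; split; lra.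
have B : `|ver (a + w) c (c + h) - ver a c (c + h) - (complex.Im D * w) * (c + h - c)| <=
    2 * (e * (w + h)) * (c + h - c).
  rewrite verE; apply: Jint_approx.
  - by move=> x; apply: cvgB; exact: cIm.
  - by rewrite lerDl.
  move=> y yc'.
  have aa : a <= a <= a + w by rewrite lexx lerDl.
  have aw : a <= a + w <= a + w by rewrite lexx lerDl w0.
  move: (le_trans (ler_Im_cabs _) (near a y aa yc')) (le_trans (ler_Im_cabs _) (near (a +
    w) y aw yc')).
  case: (f (a +i* y)) (f ((a + w) +i* y)) (f (zx +i* zy)) D {fD Hd near horE verE A} =>
    [u1 v1] [u2 v2] [u3 v3] [d1' d2'] /=.
  rewrite !ler_norml => /andP[? ?] /andP[? ?]; apply/andP; split; lra.
rewrite /bd; have -> : 2 * e * (w + h) ^+ 2 =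
   2 * (e * (w + h)) * (a + w - a) + 2 * (e * (w + h)) * (c + h - c) by ring.
apply: le_trans (lerD A B).
apply: le_trans (ler_normB _ _).
by rewrite le_eqVlt; apply/orP; left; apply/eqP; congr (`| _ |); ring.
Qed.

Lemma goursat_rectangle (a c w h : R) : 0 < w -> 0 < h -> bd a c w h = 0.
Proof.
move=> w0 h0; apply/eqP; apply/negPn/negP => bd0.
pose eta := `|bd a c w h|; have eta0 : 0 < eta by rewrite normr_gt0.
pose W n := w / 2 ^+ n; pose H n := h / 2 ^+ n.
have W0 n : 0 <= W n by rewrite divr_ge0 ?exprn_ge0// ltW.
have H0 n : 0 <= H n by rewrite divr_ge0 ?exprn_ge0// ltW.
have WS n : W n = W n.+1 + W n.+1 by rewrite /W exprS; field; rewrite ?expf_neq0.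
have HS n : H n = H n.+1 + H n.+1 by rewrite /H exprS; field; rewrite ?expf_neq0.
pose step n (ac : R * R) : R * R := projT1 (cid (bd_quarter ac.1 ac.2 (W0 n.+1) (H0 n.+1))).
pose ac := fix ac n := if n is m.+1 then step m (ac m) else (a, c).
have acP n : [/\ (ac n).1 <= (ac n.+1).1 <= (ac n).1 + W n.+1,
     (ac n).2 <= (ac n.+1).2 <= (ac n).2 + H n.+1
    & `|bd (ac n).1 (ac n).2 (W n) (H n)| <= 4 * `|bd (ac n.+1).1 (ac n.+1).2 (W n.+1) (H
      n.+1)| ].
  rewrite [W n]WS [H n]HS /= /step; case: cid => p /=.
  by [].
have big n : eta <= 4 ^+ n * `|bd (ac n).1 (ac n).2 (W n) (H n)|.
  elim: n => [|n IH]; first by rewrite expr0 mul1r /W /H !expr0 !divr1.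
  apply: le_trans IH _; rewrite exprSr -mulrA ler_wpM2l ?exprn_ge0//.
  by have [] := acP n.
(* Nested intervals, one coordinate at a time: the corners increase to a point common to all the
   rectangles. *)
have nest (u V : nat -> R) : (forall n, V n = V n.+1 + V n.+1) -> (forall n, 0 <= V n) ->
    (forall n, u n <= u n.+1 <= u n + V n.+1) ->
    exists l, forall n, u n <= l <= u n + V n.
  move=> VS V0 uV.
  have mono n m : (n <= m)%N -> u n <= u m <= u n + V n - V m.
    move=> /subnKC <-; elim: (m - n)%N => [|k /andP[IH1 IH2]].
      by rewrite addn0 lexx addrK lexx.
    have /andP[u1 u2] := uV (n + k)%N; rewrite addnS (le_trans IH1)//=.
    by have := VS (n + k)%N; lra.
  have nd : nondecreasing_seq u by move=> n m /mono/andP[].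
  have ub : has_ubound (range u).
    exists (u 0%N + V 0%N) => _ [n _ <-]; have /andP[_ H'] := mono 0%N n isT.
    by apply: le_trans H' _; rewrite gerBl.
  exists (sup (range u)) => n; apply/andP; split.
    by apply: ub_le_sup => //; exists n.
  apply: sup_le_ub; first by exists (u 0%N), 0%N.
  move=> _ [m _ <-]; have [nm|mn] := leqP n m.
    by have /andP[_ H'] := mono n m nm; apply: le_trans H' _; rewrite gerBl.
  by apply: le_trans (nd _ _ (ltnW mn)) _; rewrite lerDl.
have [zx Hx] := nest (fun n => (ac n).1) W WS W0 (fun n => let: And3 p _ _ := acP n in p).
have [zy Hy] := nest (fun n => (ac n).2) H HS H0 (fun n => let: And3 _ p _ := acP n in p).
have [D fD] := ef (zx +i* zy).
(* With this e, 4^n times the local bound 2 e ((w + h) / 2^n)^2 is eta / 2, which contradicts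
   [big]. *)
pose e := eta / (4 * (w + h) ^+ 2).
have wh0 : 0 < w + h by rewrite addr_gt0.
have e0 : 0 < e by rewrite divr_gt0// mulr_gt0// exprn_gt0.
have [d d0 Hd] := bd_local e0 fD.
have [n nd] : exists n, (2^-1) ^+ n * (w + h) < d.
  by apply: geometric_small => //; rewrite ?ltW//; apply/andP; split; lra.
have WHn : W n + H n = (2^-1) ^+ n * (w + h) by rewrite /W /H exprVn; ring.
have := Hd (ac n).1 (ac n).2 (W n) (H n) (W0 n) (H0 n).
rewrite WHn => /(_ nd (Hx n) (Hy n)) K.
have := big n; rewrite leNgt => /negP; apply.
apply: (@le_lt_trans _ _ (4 ^+ n * (2 * e * ((2^-1) ^+ n * (w + h)) ^+ 2))).
  by rewrite ler_wpM2l// exprn_ge0.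
have -> : 4 ^+ n * (2 * e * (2^-1 ^+ n * (w + h)) ^+ 2) = eta / 2.
  have -> : (4 : R) ^+ n = 2 ^+ n * 2 ^+ n by rewrite -exprMn; congr (_ ^+ n); ring.
  have t0 : (2 : R) ^+ n != 0 by rewrite expf_neq0.
  by rewrite /e exprVn; field; rewrite t0 gt_eqF.
by rewrite ltr_pdivrMr// ltr_pMr// ltr1n.
Qed.

End goursat.

(** * Entire functions that vanish on the real line *)

Section uniqueness.
Variable R : realType.

(* Cauchy's theorem for G(z) exp(- n (z - iB)^2) on [-A, A] x [0, B] with A > B:
   the integrand vanishes on the bottom side and is O(exp(- n)) on the vertical
   sides, so the integral along the top side is too small for large n, where
   the Gaussian concentrates at iB, unless G(iB) = 0. *)
Lemma entire_eq0 (G : R[i] -> R[i]) (B : R) : entire G ->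
  (forall t : R, G t%:C = 0) -> 0 < B -> G (0 +i* B) = 0.
Proof.
move=> eG G0 B0; apply/eqP; apply/negPn/negP => v0.
set v := G (0 +i* B) in v0.
(* Multiplying by the conjugate of v makes the value at iB equal to |v|^2 > 0, so real parts alone
   decide. *)
pose W z := v^* * G z.
have eW : entire W by apply: entireM => //; exact: entire_cst.
have W0 t : W t%:C = 0 by rewrite /W G0 mulr0.
pose kappa := normsq v / 2.
have k0 : 0 < kappa.
  rewrite divr_gt0// lt_def normsq_ge0 andbT.
  by apply: contra_neq v0; exact: normsq_eq0.
have WB : complex.Re (W (0 +i* B)) = kappa + kappa.
  by rewrite /W -/v /kappa /normsq; case: (v) => a b /=; field.
pose g (x : R) : R := complex.Re (W (x +i* B)).
have cg : continuous g.
  have [H _] := entire_line_continuous (0 +i* B) 1 eW.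
  suff -> : g = (fun t : R => complex.Re (W (0 +i* B + t%:C * 1)) : R) by [].
  apply/funext => x; congr (complex.Re (W _)); apply/eqP.
  by rewrite mulr1 eq_complex /= add0r addr0 !eqxx.
(* On the vertical sides x^2 - (y - B)^2 >= A^2 - B^2 >= 1, whence the factor exp(- n) there. *)
pose A := B + 1.
have A0 : 0 < A by rewrite addr_gt0.
(* The bound 2 eta <= 1 serves twice: for eta <= A, and for exp(- n) <= exp(- n (2 eta)^2). *)
have [eta [eta0 eta1 Heta]] : exists eta : R, [/\ 0 < eta, 2 * eta <= 1 &
    forall x, `|x| <= 2 * eta -> kappa <= g x].
  have : \forall x \near (0 : R), kappa <= g x.
    apply: cvgr_ge (cg 0) _ _; rewrite /g WB; lra.
  move=> /nbhs_ballP[d /= d0 Hd]; exists (Num.min (d / 4) 2^-1); split.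
  - by rewrite lt_min divr_gt0//= invr_gt0.
  - by rewrite -ler_pdivlMl// mulr1 ge_min lexx orbT.
  - move=> x xd; apply: Hd; rewrite -ball_normE /= sub0r normrN.
    apply: le_lt_trans xd _; apply: (@le_lt_trans _ _ (2 * (d / 4))).
      by rewrite ler_pM2l// ge_min lexx.
    by lra.
have [M M0 HM] : exists2 M : R, 0 < M & forall x, -A <= x <= A -> `|g x| <= M.
  by apply: continuous_bounded => //; lra.
have side a : exists2 N : R, 0 < N & forall y, 0 <= y <= B -> cabs (W (a +i* y)) <= N.
  have [H1 H2] := entire_line_continuous (a +i* 0) 'i eW.
  have [N1 N10 HN1] := continuous_bounded H1 (ltW B0).
  have [N2 N20 HN2] := continuous_bounded H2 (ltW B0).
  exists (N1 + N2); first by rewrite addr_gt0.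
  move=> y yB; apply: le_trans (ler_cabs_ReIm _) _.
  have -> : a +i* y = a +i* 0 + y%:C * 'i.
    by apply/eqP; rewrite eq_complex /=; apply/andP; split; apply/eqP; ring.
  by rewrite lerD ?HN1 ?HN2.
have [N1 N10 HN1] := side A; have [N2 N20 HN2] := side (- A).
(* q^n is the ratio of the Gaussian weights at 2 eta and at eta, as (2 eta)^2 - eta^2 = 3 eta^2. *)
pose q := expR (- (3 * eta ^+ 2)).
have e20 : 0 < eta ^+ 2 by rewrite exprn_gt0.
have q1 : 0 <= q < 1 by rewrite expR_ge0 /= -expR0 ltr_expR oppr_lt0 mulr_gt0.
have [n Hn] : exists n, q ^+ n * (2 * A * M + B * N1 + B * N2) < 2 * eta * kappa.
  have ek0 : 0 < 2 * eta * kappa by rewrite mulr_gt0// mulr_gt0.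
  have c0 : 0 <= 2 * A * M + B * N1 + B * N2 by rewrite !addr_ge0// !mulr_ge0// ltW.
  exact: geometric_small.
pose p z : R[i] := - n%:R%:C * ((z + - (0 +i* B)) * (z + - (0 +i* B))).
pose f z := W z * cexp (p z).
have ef : entire f.
  apply: entireM => //; apply: entire_cexp; apply: entireM; first exact: entire_cst.
  by apply: entireM; apply: entireD; (exact: entire_id || exact: entire_cst).
have pE x y : p (x +i* y) = (- n%:R * (x ^+ 2 - (y - B) ^+ 2)) +i* (- n%:R * (2 * x * (y
  - B))).
  by apply/eqP; rewrite /p eq_complex /=; apply/andP; split; apply/eqP; ring.
have := goursat_rectangle ef (- A) 0 (w := A + A) (h := B).
rewrite addr_gt0// B0 => /(_ isT isT).
rewrite [- A + (A + A)]addKr add0r.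
have -> : Jint (fun x => complex.Re (f (x +i* 0))) (- A) A = 0.
  rewrite (_ : (fun x => _) = (fun=> 0 : R)); first by rewrite Jint_cst ?mul0r//; lra.
  by apply/funext => x; rewrite /f -[x +i* 0]/(x%:C) W0 mul0r.
have top x : complex.Re (f (x +i* B)) = g x * expR (- n%:R * x ^+ 2).
  rewrite /f pE subrr /cexp /= mulr0 mulr0 cos0 sin0 mulr1 mulr0 expr0n subr0 /g.
  by case: (W _) => a b /=; rewrite mulr0 subr0.
set V1 := Jint (fun y => complex.Im (f (A +i* y))) 0 B.
set V2 := Jint (fun y => complex.Im (f (- A +i* y))) 0 B.
have sideV a N : a ^+ 2 = A ^+ 2 -> (forall y, 0 <= y <= B -> cabs (W (a +i* y)) <= N) ->
  0 < N ->
    `|Jint (fun y => complex.Im (f (a +i* y))) 0 B| <= N * expR (- n%:R) * B.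
  move=> aA HN N0.
  have := @Jint_approx R (fun y => complex.Im (f (a +i* y))) 0 B 0 (N * expR (- n%:R)).
  rewrite mul0r !subr0; apply.
  - have [_ H2] := entire_line_continuous (a +i* 0) 'i ef.
    suff -> : (fun y => complex.Im (f (a +i* y))) = (fun t : R => complex.Im (f (a +i* 0
      + t%:C * 'i)) : R) by [].
    apply/funext => y; congr (complex.Im (f _)); apply/eqP; rewrite eq_complex /=.
    by apply/andP; split; apply/eqP; ring.
  - exact: ltW.
  move=> y yB; rewrite subr0; apply: le_trans (ler_Im_cabs _) _.
  rewrite /f cabsM cabs_cexp pE /= ler_pM ?cabs_ge0 ?expR_ge0 ?HN// ler_expR aA.
  rewrite mulNr lerN2 -[leLHS]mulr1 ler_wpM2l// /A.
  by move: yB => /andP[? ?]; nra.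
have S1 : `|V1| <= N1 * expR (- n%:R) * B by apply: sideV.
have S2 : `|V2| <= N2 * expR (- n%:R) * B by apply: sideV => //; rewrite sqrrN.
pose u x := g x * expR (- n%:R * x ^+ 2).
have cu : continuous u.
  move=> x; apply: cvgM; first exact: cg.
  apply: (@cvg_comp _ _ _ (fun x : R => - n%:R * x ^+ 2) expR); last exact: continuous_expR.
  by apply: cvgM; [exact: cvg_cst|exact: exprn_continuous].
have -> : Jint (fun x => complex.Re (f (x +i* B))) (- A) A = Jint u (- A) A.
  by congr Jint; apply/funext => x; exact: top.
have eA : eta <= A by rewrite /A; lra.
have JI : Jint u (- A) A = Jint u (- A) (- eta) + (Jint u (- eta) eta + Jint u eta A).
  rewrite -!Jint_split//; clear -eta0 eA A0; lra.
(* The integrand is nonnegative up to |x| = 2 eta, and the Gaussian is small beyond. Nothing can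
   then offset the positive integral over |x| <= eta. *)
have outer x : - A <= x <= A -> - (M * expR (- n%:R * (2 * eta) ^+ 2)) <= u x.
  move=> xA; rewrite /u; have [xe|xe] := leP `|x| (2 * eta).
    apply: (@le_trans _ _ 0).
      by rewrite oppr_le0 mulr_ge0 ?expR_ge0 ?(ltW M0).
    by rewrite mulr_ge0 ?expR_ge0// (le_trans (ltW k0)) ?Heta.
  have := HM x xA; rewrite ler_norml => /andP[gM _].
  have E : expR (- n%:R * x ^+ 2) <= expR (- n%:R * (2 * eta) ^+ 2).
    rewrite ler_expR !mulNr lerN2 ler_wpM2l// -[x ^+ 2]real_normK ?num_real//.
    by rewrite ler_pXn2r ?nnegrE// ?(ltW xe)// mulr_ge0// ltW.
  apply: (@le_trans _ _ (- M * expR (- n%:R * x ^+ 2))).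
      by rewrite [leRHS]mulNr lerN2 ler_wpM2l// ltW.
  by rewrite ler_wpM2r ?expR_ge0.
set E4 := M * expR (- n%:R * (2 * eta) ^+ 2) in outer.
have J1 : - E4 * (- eta - - A) <= Jint u (- A) (- eta).
  apply: Jint_ge => //; first by rewrite lerN2.
  by move=> x /andP[x1 x2]; apply: outer; clear -x1 x2 eA eta0; apply/andP; split; lra.
have J3 : - E4 * (A - eta) <= Jint u eta A.
  apply: Jint_ge => // x /andP[x1 x2]; apply: outer; clear -x1 x2 eta0 A0; apply/andP;
    split; lra.
have J2 : kappa * expR (- n%:R * eta ^+ 2) * (eta - - eta) <= Jint u (- eta) eta.
  apply: Jint_ge => //; first by clear -eta0; lra.
  move=> x xe; have xn : `|x| <= eta by rewrite ler_norml.
  rewrite /u ler_pM ?expR_ge0 ?(ltW k0)//.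
    by apply: Heta; apply: le_trans xn _; clear -eta0; lra.
  rewrite ler_expR !mulNr lerN2 ler_wpM2l// -[x ^+ 2]real_normK ?num_real//.
  by rewrite ler_pXn2r ?nnegrE// ltW.
move=> bd0.
set X := expR (- n%:R * eta ^+ 2) in J2.
have X0 : 0 < X := expR_gt0 _.
have E4q : expR (- n%:R * (2 * eta) ^+ 2) = X * q ^+ n.
  by rewrite /X /q -expRM_natl -expRD; congr expR; rewrite -mulr_natl; ring.
have Enq : expR (- n%:R) <= X * q ^+ n.
  rewrite -E4q ler_expR mulNr lerN2 -[leRHS]mulr1 ler_wpM2l//.
  by rewrite exprn_ile1// mulr_ge0// ltW.
have E4E : E4 = M * (X * q ^+ n) by rewrite /E4 E4q.
have Up : Jint u (- A) A <= N1 * (X * q ^+ n) * B + N2 * (X * q ^+ n) * B.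
  have V1' : `|V1| <= N1 * (X * q ^+ n) * B.
    by apply: le_trans S1 _; rewrite ler_wpM2r ?(ltW B0)// ler_wpM2l// ltW.
  have V2' : `|V2| <= N2 * (X * q ^+ n) * B.
    by apply: le_trans S2 _; rewrite ler_wpM2r ?(ltW B0)// ler_wpM2l// ltW.
  move: V1' V2' bd0; rewrite !ler_norml; clear; move=> /andP[? ?] /andP[? ?]; lra.
have Lo : X * (2 * eta * kappa) <= Jint u (- A) A + 2 * A * E4.
  have E40 : 0 <= E4 by rewrite mulr_ge0 ?expR_ge0 ?(ltW M0).
  have E4e : 0 <= E4 * eta by rewrite mulr_ge0// ltW.
  move: J1 J2 J3 E4e E40; rewrite JI; clear; nra.
have : X * (2 * eta * kappa) <= X * (q ^+ n * (2 * A * M + B * N1 + B * N2)).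
  apply: le_trans Lo _; apply: le_trans (lerD Up (lexx _)) _.
  by rewrite E4E le_eqVlt; apply/orP; left; apply/eqP; ring.
by rewrite ler_pM2l// leNgt Hn.
Qed.

End uniqueness.

(** * The Toeplitz algebra and its dynamics *)

Section coefficients.
Variables (R : realType) (I : choiceType).
Notation bop := (bop R I).
Notation ell2 := (ell2 R I).

Lemma csum_single (F : I -> R[i]) (i : I) : (forall j, j != i -> F j = 0) ->
  csum F = F i.
Proof.
move=> F0; have H (g : I -> R) : (forall j, j != i -> g j = 0) -> rsum g = g i.
  move=> g0; rewrite /rsum.
  have E (k : I -> R) : (forall j, j != i -> k j = 0) -> 0 <= k i ->
      \esum_(j in [set: I]) (k j)%:E = (k i)%:E.
    move=> k0 ki; rewrite -[RHS](@esum_set1 R I i (fun j => (k j)%:E)) ?lee_fin//.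
    rewrite [RHS]esum_mkcond; apply: eq_esum => j _.
    by rewrite in_set1; case: eqP => // /eqP/k0 ->.
  rewrite !E ?maxr_ge0r//=; first by rewrite -maxr_decomp.
  - by move=> j /g0 ->; rewrite oppr0 maxxx.
  - by move=> j /g0 ->; rewrite maxxx.
by rewrite /csum !H; [case: (F i)| |] => // j /F0 ->.
Qed.

Lemma dot_ebasis (f : ell2) i : dot f (ebasis R i) = f i.
Proof.
rewrite /dot (@csum_single _ i) /= ?eqxx ?conjC1 ?mulr1// => j /negPf ->.
by rewrite conjC0 mulr0.
Qed.

Lemma hnorm_ebasis i : hnorm (ebasis R i : ell2) = 1.
Proof.
rewrite /hnorm; have := dotxx (ebasis R i); rewrite dot_ebasis /= eqxx.
by move=> [<-]; rewrite sqrtr1.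
Qed.

Lemma cabs_coef (T : bop) x y : cabs (T (ebasis R x) y) <= opnorm T.
Proof.
apply: le_trans (cabs_le_hnorm _ _) _; apply: le_trans (hnorm_opnorm _ _) _.
by rewrite hnorm_ebasis mulr1.
Qed.

Lemma ell2D (f g : ell2) i : (f + g) i = f i + g i. Proof. by []. Qed.
Lemma ell2Z c (f : ell2) i : (c *: f) i = c * f i. Proof. by []. Qed.
Lemma coefD (S T : bop) x y : (S + T) (ebasis R x) y = S (ebasis R x) y + T (ebasis R x) y.
Proof. by []. Qed.
Lemma coefZ c (T : bop) x y : (c *: T) (ebasis R x) y = c * T (ebasis R x) y.
Proof. by []. Qed.
Lemma coefB (S T : bop) x y : (S - T) (ebasis R x) y = S (ebasis R x) y - T (ebasis R x) y.
Proof. by rewrite bopB. Qed.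
Lemma coef0 x y : (0 : bop) (ebasis R x) y = 0.
Proof. by rewrite bop0E. Qed.

(** The coordinate of T^* f at x is the inner product of f with T e_x, so the columns of T determine
    T^* on all of l^2 at once, with no limit of finitely supported vectors. *)
Lemma coef_ext (S T : bop) : (forall x y, S (ebasis R x) y = T (ebasis R x) y) -> S = T.
Proof.
move=> ST; rewrite -[S]adjK -[T]adjK; congr adj.
apply: bop_ext => f; apply: ell2_ext => x.
rewrite -!(dot_ebasis _ x) dotC [RHS]dotC -!dot_adj; congr (_^*).
suff -> : S (ebasis R x) = T (ebasis R x) by [].
exact: ell2_ext.
Qed.

End coefficients.

(** * Common multiples in P *)

Section monoid.

Lemma pmulA x y z : pmul x (pmul y z) = pmul (pmul x y) z.
Proof.
case: x y z => m [a a0] [n [b b0]] [k [c c0]]; congr pair => /=.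
  by rewrite mulnDr mulnA addnA.
by apply: val_inj => /=; rewrite mulnA.
Qed.

Definition pone : PP := (0%N, pos_one).

Lemma pmul1x x : pmul pone x = x.
Proof.
by case: x => m [a a0]; congr pair => /=; [rewrite mul1n|apply: val_inj; rewrite /= mul1n].
Qed.

Lemma pair_posE (x y : PP) : x.1 = y.1 -> val x.2 = val y.2 -> x = y.
Proof. by case: x y => m a [n b] /= -> /val_inj ->. Qed.

(** P is quasi-lattice ordered: if y P and z P meet, they do so in a principal right ideal. The
    first coordinate of its generator is the least common element l of the progressions m + a N and
    n + b N, the second is the lcm of a and b. *)
Lemma pmul_lub (y z w0 u0 : PP) : pmul y w0 = pmul z u0 ->
  exists y1 z1, pmul y y1 = pmul z z1 /\
    forall w u, pmul y w = pmul z u -> exists k, w = pmul y1 k /\ u = pmul z1 k.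
Proof.
case: y z w0 u0 => m [a a0] [n [b b0]] [i0 [c0 c00]] [j0 [d0 d00]] [] /= E _.
pose P l := [&& (m <= l)%N, (a %| l - m)%N, (n <= l)%N & (b %| l - n)%N].
have exP : exists l, P l.
  by exists (m + a * i0)%N; rewrite /P {3 4}E !leq_addr !addKn !dvdn_mulr.
pose l := ex_minn exP.
have [/and4P[ml al nl bl] lmin] : P l /\ forall l', P l' -> (l <= l')%N.
  by rewrite /l; case: ex_minnP.
pose c := lcmn a b.
have cpos : (0 < c)%N by rewrite lcmn_gt0 a0.
have ac : (a %| c)%N := dvdn_lcml a b.
have bc : (b %| c)%N := dvdn_lcmr a b.
have ca0 : (0 < c %/ a)%N by rewrite divn_gt0// dvdn_leq.
have cb0 : (0 < c %/ b)%N by rewrite divn_gt0// dvdn_leq.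
exists (((l - m) %/ a)%N, exist _ (c %/ a)%N ca0), (((l - n) %/ b)%N, exist _ (c %/ b)%N
  cb0).
split.
  apply: pair_posE => /=; rewrite ![(_ * (_ %/ _))%N]mulnC !divnK// ?subnKC//.
move=> [i [e e0]] [j [f f0]] [] /= E1 E2.
have Pl' : P (m + a * i)%N.
  by rewrite /P {3 4}E1 !leq_addr !addKn !dvdn_mulr.
have ll := lmin _ Pl'.
(* A common element of both progressions exceeds l by a multiple of a and of b, hence of c. *)
have cl : (c %| (m + a * i) - l)%N.
  rewrite dvdn_lcm; apply/andP; split.
    have -> : (m + a * i - l = a * i - (l - m))%N by clear -ml ll; lia.
    by apply: dvdn_sub => //; exact: dvdn_mulr.
  have -> : (m + a * i - l = b * j - (l - n))%N by clear -nl ll E1; lia.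
  by apply: dvdn_sub => //; exact: dvdn_mulr.
have ce : (c %| a * e)%N by rewrite dvdn_lcm dvdn_mulr// E2 dvdn_mulr.
case/dvdnP: cl => s Es; case/dvdnP: ce => t Et.
have t0 : (0 < t)%N by move: e0 a0 Et; case: t => //; lia.
have [ca cb] : (c = c %/ a * a /\ c = c %/ b * b)%N by rewrite !divnK.
have [la lb] : (l - m = (l - m) %/ a * a /\ l - n = (l - n) %/ b * b)%N by rewrite !divnK.
set ca' := (c %/ a)%N in ca *; set cb' := (c %/ b)%N in cb *.
set la' := ((l - m) %/ a)%N in la *; set lb' := ((l - n) %/ b)%N in lb *.
have Ei : (a * i = la' * a + s * (ca' * a))%N.
  by rewrite -la -ca -Es; clear -ml ll; lia.
have Ej : (b * j = lb' * b + s * (cb' * b))%N.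
  by rewrite -lb -cb -Es; clear -nl ll E1; lia.
have Ee : (a * e = t * (ca' * a))%N by rewrite -ca.
have Ef : (b * f = t * (cb' * b))%N by rewrite -cb -E2.
exists (s, exist _ t t0); split; apply: pair_posE => /=; apply/eqP.
- by rewrite -(eqn_pmul2l a0); apply/eqP; clear -Ei; lia.
- by rewrite -(eqn_pmul2l a0); apply/eqP; clear -Ee; lia.
- by rewrite -(eqn_pmul2l b0); apply/eqP; clear -Ej; lia.
- by rewrite -(eqn_pmul2l b0); apply/eqP; clear -Ef; lia.
Qed.

End monoid.

(** * Density of the span of the monomials T_x T_y^* *)

Section toeplitz_algebra.
Variable R : realType.
Local Notation bop := (bop R PP).
Local Notation ell2 := (ell2 R PP).
Local Notation Tiso := (Tiso R).
Local Notation toeplitz := (@toeplitz R).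
Local Notation e_ := (ebasis R).
Implicit Types (S T : bop) (x y z w u : PP).

Lemma adj_TisoE x (f : ell2) w : adj (Tiso x) f w = f (pmul x w).
Proof. by []. Qed.

Lemma TisoE x (f : ell2) w : Tiso x f (pmul x w) = f w.
Proof. exact: (shift_funE (@pmul_inj x)). Qed.

Lemma Tiso_out x (f : ell2) w : (forall k, w <> pmul x k) -> Tiso x f w = 0.
Proof. by move=> H; apply: shift_fun_out => -[k _ kw]; apply: (H k). Qed.

(** Compared through adjoints: T_x^* is plain composition with left multiplication by x, whereas T_x
    involves a case distinction. *)
Lemma TisoM x y : Tiso x * Tiso y = Tiso (pmul x y).
Proof.
rewrite -[LHS]adjK -[RHS]adjK; congr adj; rewrite adjM.
by apply: bop_ext => f; apply: ell2_ext => w; rewrite bopM !adj_TisoE pmulA.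
Qed.

Lemma Tiso1 : Tiso pone = 1.
Proof.
rewrite -[LHS]adjK -[RHS]adjK; congr adj; rewrite adj_one.
by apply: bop_ext => f; apply: ell2_ext => w; rewrite adj_TisoE pmul1x.
Qed.

Lemma adj_TisoK x : adj (Tiso x) * Tiso x = 1.
Proof.
by apply: bop_ext => f; apply: ell2_ext => w; rewrite bopM adj_TisoE TisoE.
Qed.

Lemma Tiso_e x u : Tiso x (e_ u) = e_ (pmul x u).
Proof. exact: shift_op_ebasis. Qed.

Definition mon x y : bop := Tiso x * adj (Tiso y).

Lemma mon1 : mon pone pone = 1.
Proof. by rewrite /mon Tiso1 adj_one mulr1. Qed.

Lemma mon_e x y k : mon x y (e_ (pmul y k)) = e_ (pmul x k).
Proof. by rewrite bopM -Tiso_e -[X in Tiso x X]bopM adj_TisoK Tiso_e. Qed.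

Lemma mon_e0 x y u : (forall k, u <> pmul y k) -> mon x y (e_ u) = 0.
Proof.
move=> H; rewrite bopM (_ : adj (Tiso y) (e_ u) = 0) ?bop0//.
apply: ell2_ext => w; rewrite adj_TisoE /=; case: eqP => // E.
by case: (H w).
Qed.

Lemma Tiso_pow1 m : Tiso (1%N, pos_one) ^+ m = Tiso (m, pos_one).
Proof.
elim: m => [|m IH]; first by rewrite expr0 -Tiso1.
rewrite exprS IH TisoM; congr Tiso; apply: pair_posE => //=.
by rewrite mul1n add1n.
Qed.

Lemma adjX T n : adj (T ^+ n) = adj T ^+ n.
Proof. by elim: n => [|n IH]; rewrite ?expr0 ?adj_one// exprSr adjM IH exprS. Qed.

Lemma monoE m a b n : mono R m a b n = mon (m, a) (n, b).
Proof.
have sv k (c : posnat) : s_op R ^+ k * v_op R c = Tiso (k, c).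
  rewrite /s_op /v_op Tiso_pow1 TisoM; congr Tiso; apply: pair_posE => /=.
    by rewrite addn0.
  by rewrite mul1n.
by rewrite /mono sv -adjX -mulrA -adjM sv.
Qed.

Lemma mon_adj x y : adj (mon x y) = mon y x.
Proof. by rewrite adjM adjK. Qed.

(** Nica covariance. If y P and z P are disjoint, T_y and T_z have orthogonal ranges; otherwise y1
    and z1 come from [pmul_lub]. This closes the span of the monomials under products. *)
Lemma adj_Tiso_Tiso y z : adj (Tiso y) * Tiso z = 0 \/
  exists y1 z1, adj (Tiso y) * Tiso z = mon y1 z1.
Proof.
have [[w0 [u0 wu0]]|H] := pselect (exists w u, pmul y w = pmul z u); last first.
  left; apply: bop_ext => f; apply: ell2_ext => w.
  rewrite bopM adj_TisoE Tiso_out ?bop0E// => k E.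
  by apply: H; exists w, k.
right; have [y1 [z1 [E H1]]] := pmul_lub wu0; exists y1, z1.
apply: bop_ext => f; apply: ell2_ext => w.
rewrite bopM adj_TisoE bopM.
have [[u yw]|N] := pselect (exists u, pmul y w = pmul z u).
  have [k [wk uk]] := H1 _ _ yw.
  by rewrite yw TisoE uk wk TisoE.
rewrite Tiso_out; last by move=> k yk; apply: N; exists k.
rewrite Tiso_out// => k wk; apply: N; exists (pmul z1 k).
by rewrite wk !pmulA E.
Qed.

(** The linear span of the monomials, made inductive to allow induction on the number of terms. *)
Inductive tspan : bop -> Prop :=
| tspan0 : tspan 0
| tspanS c x y T : tspan T -> tspan (c *: mon x y + T).

Lemma tspanD S T : tspan S -> tspan T -> tspan (S + T).
Proof.
move=> sS sT; elim: sS => [|c x y U _ IH]; first by rewrite add0r.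
by rewrite -addrA; exact: tspanS.
Qed.

Lemma tspanZ c T : tspan T -> tspan (c *: T).
Proof.
elim=> [|d x y U _ IH]; first by rewrite scaler0; exact: tspan0.
by rewrite scalerDr scalerA; exact: tspanS.
Qed.

Lemma tspan_mon x y : tspan (mon x y).
Proof. by rewrite -[mon x y]scale1r -[_ *: _]addr0; apply: tspanS; exact: tspan0. Qed.

Lemma tspan_mon_mon x y z w : tspan (mon x y * mon z w).
Proof.
rewrite /mon -mulrA [X in _ * X]mulrA.
have [->|[y1 [z1 ->]]] := adj_Tiso_Tiso y z.
  by rewrite mul0r mulr0; exact: tspan0.
rewrite /mon -mulrA -adjM mulrA !TisoM; exact: tspan_mon.
Qed.

Lemma tspanM S T : tspan S -> tspan T -> tspan (S * T).
Proof.
elim=> [|c x y U _ IH] sT; first by rewrite mul0r; exact: tspan0.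
rewrite mulrDl bopZAl; apply: tspanD; last exact: IH.
apply: tspanZ; elim: sT => [|d z w V _ IHV]; first by rewrite mulr0; exact: tspan0.
rewrite mulrDr bopZAr; apply: tspanD => //; apply: tspanZ; exact: tspan_mon_mon.
Qed.

Lemma tspan_adj T : tspan T -> tspan (adj T).
Proof.
elim=> [|c x y U _ IH].
  have -> : adj (0 : bop) = 0 by have := adjZ 0 (1 : bop); rewrite conjC0 !scale0r.
  exact: tspan0.
by rewrite adjD adjZ mon_adj; exact: tspanS.
Qed.

Lemma opnorm_approxM S S' T T' (e : R) : 0 < e -> e <= 1 -> opnorm (S - S') < e -> opnorm
  (T - T') < e ->
  opnorm (S * T - S' * T') <= (opnorm S + opnorm T + 1) * e.
Proof.
move=> e0 e1 SS TT; have -> : S * T - S' * T' = S * (T - T') + (S - S') * T'.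
  by rewrite mulrBr mulrBl addrA subrK.
have T'T : opnorm T' <= opnorm T + 1.
  have -> : T' = T - (T - T') by rewrite opprB addrC subrK.
  apply: le_trans (ler_opnormD _ _) _; rewrite opnormN lerD2l.
  by apply: le_trans e1; exact: ltW.
apply: le_trans (ler_opnormD _ _) _; rewrite -[_ + _ + 1]addrA [leRHS]mulrDl; apply: lerD.
  by apply: le_trans (opnormM _ _) _; rewrite ler_wpM2l ?opnorm_ge0// ltW.
apply: le_trans (opnormM _ _) _; rewrite mulrC ler_pM ?opnorm_ge0//; exact: ltW.
Qed.

(** By minimality of [toeplitz], this gives the density of the monomials. *)
Lemma closure_tspan_cstar : cstar_subalgebra (closure tspan).
Proof.
split.
- exact: closed_closure.
- move=> c S T /bop_closureP cS /bop_closureP cT; apply/bop_closureP => e e0.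
  have k0 : 0 < cabs c + 1 by rewrite ltr_wpDl ?cabs_ge0.
  have e2 : 0 < e / 2 by rewrite divr_gt0.
  have [S' sS SS] := cS _ (divr_gt0 e2 k0).
  have [T' sT TT] := cT _ e2.
  exists (c *: S' + T'); first by apply: tspanD => //; exact: tspanZ.
  have -> : c *: S + T - (c *: S' + T') = c *: (S - S') + (T - T').
    by rewrite scalerBr opprD addrACA.
  apply: le_lt_trans (ler_opnormD _ _) _; rewrite [ltRHS](splitr e).
  apply: ler_ltD => //; rewrite opnormZ -[Num.sqrt _]/(cabs c).
  apply: (@le_trans _ _ ((cabs c + 1) * opnorm (S - S'))).
    by rewrite ler_wpM2r ?opnorm_ge0// lerDl.
  by rewrite mulrC -ler_pdivlMr// ltW.
- move=> S T /bop_closureP cS /bop_closureP cT; apply/bop_closureP => e e0.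
  have k0 : 0 < opnorm S + opnorm T + 1 by rewrite ltr_wpDl ?addr_ge0 ?opnorm_ge0.
  (* d <= 1 keeps the norm of T' below that of T plus 1, which makes the error of the product linear
     in d. *)
  pose d := Num.min 1 (e / 2 / (opnorm S + opnorm T + 1)).
  have d0 : 0 < d by rewrite lt_min ltr01 !divr_gt0.
  have [S' sS SS] := cS _ d0; have [T' sT TT] := cT _ d0.
  exists (S' * T'); first exact: tspanM.
  have d1 : d <= 1 by rewrite ge_min lexx.
  apply: le_lt_trans (opnorm_approxM d0 d1 SS TT) _.
  apply: (@le_lt_trans _ _ (e / 2)); last by rewrite ltr_pdivrMr// ltr_pMr// ltr1n.
  by rewrite mulrC -ler_pdivlMr// ge_min lexx orbT.
- move=> T /bop_closureP cT; apply/bop_closureP => e /cT[S sS TS].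
  by exists (adj S); [exact: tspan_adj|rewrite -adjB opnorm_adj].
Qed.

Lemma toeplitz_cstar : cstar_subalgebra toeplitz.
Proof.
split.
- by apply: closed_bigI => A [[]].
- by move=> c S T TS TT A AA; have [[cA lA mA aA] gA] := AA; apply: lA; [exact: TS|exact:
  TT].
- by move=> S T TS TT A AA; have [[cA lA mA aA] gA] := AA; apply: mA; [exact: TS|exact: TT].
- by move=> T TT A AA; have [[cA lA mA aA] gA] := AA; apply: aA; exact: TT.
Qed.

Lemma toeplitz_Tiso x : toeplitz (Tiso x).
Proof. by move=> A [_ gA]; apply: gA; exists x. Qed.

Lemma toeplitz_mon x y : toeplitz (mon x y).
Proof.
have [_ _ mA aA] := toeplitz_cstar.
by apply: mA; [|apply: aA]; exact: toeplitz_Tiso.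
Qed.

Lemma toeplitz1 : toeplitz 1.
Proof. by rewrite -Tiso1; exact: toeplitz_Tiso. Qed.

Lemma toeplitzM S T : toeplitz S -> toeplitz T -> toeplitz (S * T).
Proof. by have [_ _ mA _] := toeplitz_cstar; exact: mA. Qed.

Lemma toeplitz_adj T : toeplitz T -> toeplitz (adj T).
Proof. by have [_ _ _ aA] := toeplitz_cstar; exact: aA. Qed.

Lemma toeplitz_lin c S T : toeplitz S -> toeplitz T -> toeplitz (c *: S + T).
Proof. by have [_ lA _ _] := toeplitz_cstar; exact: lA. Qed.

Lemma toeplitz0 : toeplitz 0.
Proof. by have := toeplitz_lin (-1) toeplitz1 toeplitz1; rewrite scaleN1r addNr. Qed.

Lemma toeplitzB S T : toeplitz S -> toeplitz T -> toeplitz (S - T).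
Proof. by move=> tS tT; rewrite addrC -scaleN1r; exact: toeplitz_lin. Qed.

Lemma toeplitz_tspan T : tspan T -> toeplitz T.
Proof.
elim=> [|c x y U _ IH]; first exact: toeplitz0.
by apply: toeplitz_lin => //; exact: toeplitz_mon.
Qed.

Lemma toeplitz_unital : closed_unital_algebra toeplitz.
Proof. by have [cA lA mA aA] := toeplitz_cstar; split=> //; exact: toeplitz1. Qed.

Lemma toeplitz_approx T : toeplitz T -> forall e : R, 0 < e ->
  exists2 S, tspan S & opnorm (T - S) < e.
Proof.
move=> tT; apply/bop_closureP; apply: tT; split; first exact: closure_tspan_cstar.
move=> _ [x _ <-]; apply: subset_closure.
rewrite (_ : Tiso x = mon x pone); first exact: tspan_mon.
by rewrite /mon Tiso1 adj_one mulr1.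
Qed.

(** The density argument of all that follows, with L the difference of the two sides of an identity.
    Linearity and the bound are asked on [toeplitz] alone, where E and sigma are constrained. *)
Lemma toeplitz_functional_eq0 (L : bop -> R[i]) (C : R) :
  (forall c S T, toeplitz S -> toeplitz T -> L (c *: S + T) = c * L S + L T) ->
  (forall T, toeplitz T -> cabs (L T) <= C * opnorm T) ->
  (forall x y, L (mon x y) = 0) ->
  forall T, toeplitz T -> L T = 0.
Proof.
move=> lL bL L0 T tT.
have Ls S : tspan S -> L S = 0.
  elim=> [|c x y U sU IH].
    by have := lL (-1) 1 1 toeplitz1 toeplitz1; rewrite scaleN1r addNr mulN1r addNr.
  rewrite lL ?L0 ?IH ?mulr0 ?addr0//; first exact: toeplitz_mon.
  exact: toeplitz_tspan.
apply: cabs_eq0; apply/eqP; rewrite eq_le cabs_ge0 andbT.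
apply/ler_addgt0Pl => e e0; rewrite addr0.
have k0 : 0 < `|C| + 1 by rewrite ltr_wpDl.
have [S sS TS] := toeplitz_approx tT (divr_gt0 e0 k0).
have -> : L T = L (T - S).
  have := lL (-1) S T (toeplitz_tspan sS) tT.
  by rewrite (Ls S sS) mulr0 add0r scaleN1r addrC => ->.
apply: le_trans (bL _ _) _; first by apply: toeplitzB => //; exact: toeplitz_tspan.
apply: (@le_trans _ _ ((`|C| + 1) * opnorm (T - S))).
  by rewrite ler_wpM2r ?opnorm_ge0// (le_trans (ler_norm _))// lerDl.
by rewrite mulrC -ler_pdivlMr// ltW.
Qed.

End toeplitz_algebra.

(** * The conditional expectation and the diagonal *)

Section expectation.
Variable R : realType.
Local Notation bop := (bop R PP).
Local Notation Tiso := (Tiso R).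
Local Notation mon := (mon R).
Local Notation toeplitz := (@toeplitz R).
Local Notation toeplitz_fix := (@toeplitz_fix R).
Local Notation e_ := (ebasis R).
Implicit Types (S T : bop) (x y z w u : PP).

Lemma coef_mon_diag x u : mon x x (e_ u) = 0 \/ mon x x (e_ u) = e_ u.
Proof.
have [[k ->]|N] := pselect (exists k, u = pmul x k).
  by right; rewrite mon_e.
by left; apply: mon_e0 => k uk; apply: N; exists k.
Qed.

Lemma coef_closed (D : set bop) (x y : PP) T : closure D T ->
  (forall S, D S -> S (e_ x) y = 0) -> T (e_ x) y = 0.
Proof.
move=> /bop_closureP cT D0; apply: cabs_eq0; apply/eqP.
rewrite eq_le cabs_ge0 andbT; apply/ler_addgt0Pl => e e0; rewrite addr0.
have [S DS /ltW TS] := cT _ e0; apply: le_trans TS.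
by apply: le_trans (cabs_coef _ x y); rewrite coefB (D0 _ DS) subr0.
Qed.

(** Each [mon x x] is the projection onto the span of the e_u with u in x P, and the vanishing of a
    coefficient survives norm limits. *)
Lemma fix_off_diag T x y : toeplitz_fix T -> x != y -> T (e_ x) y = 0.
Proof.
move=> fT xy; apply: coef_closed fT _ => _ [n [c [f ->]]].
rewrite bop_sum; elim: (index_enum _) => [|i s IH]; first by rewrite big_nil.
rewrite big_cons ell2D IH addr0 bopZ ell2Z monoE.
have [->|->] := coef_mon_diag (((f i).1, (f i).2)) x; first by rewrite mulr0.
by rewrite /= eq_sym (negPf xy) mulr0.
Qed.

Lemma fix_toeplitz T : toeplitz_fix T -> toeplitz T.
Proof.
move=> /bop_closureP cT; have [cA _ _ _] := toeplitz_cstar R.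
apply: bop_closed_mem cA _ => e /cT[S [n [c [f ->]]] TS].
eexists; last exact: TS.
elim: (index_enum _) => [|i s IH]; first by rewrite big_nil; exact: toeplitz0.
by rewrite big_cons; apply: toeplitz_lin => //; rewrite monoE; exact: toeplitz_mon.
Qed.

Lemma fix_mon x : toeplitz_fix (mon x x).
Proof.
apply: subset_closure; exists 1%N, (fun=> 1), (fun=> x).
by rewrite big_ord1 scale1r monoE; case: x.
Qed.

Variable E : bop -> bop.
Hypothesis canE : is_canonical_expectation E.

Lemma E_fix T : toeplitz T -> toeplitz_fix (E T).
Proof. by case: canE => -[[H _ _ _] _] _; exact: H. Qed.

Lemma E_id T : toeplitz_fix T -> E T = T.
Proof. by case: canE => -[[_ H _ _] _] _; exact: H. Qed.

Lemma E_lin c S T : toeplitz S -> toeplitz T -> E (c *: S + T) = c *: E S + E T.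
Proof. by case: canE => -[[_ _ H _] _] _; exact: H. Qed.

Lemma E_opnorm T : toeplitz T -> opnorm (E T) <= opnorm T.
Proof.
case: canE => -[[_ _ _ H] _] _ /H; by rewrite !normbopE lecR.
Qed.

Lemma E_pos T : toeplitz T -> exists2 S, toeplitz_fix S & E (adj T * T) = adj S * S.
Proof. by case: canE => -[_ [H _ _]] _ /H[S []]; exists S. Qed.

Lemma E_bimod S T U : toeplitz_fix S -> toeplitz T -> toeplitz_fix U ->
  E (S * T * U) = S * E T * U.
Proof. by case: canE => -[_ [_ H _]] _; exact: H. Qed.

Lemma E_mon x y : E (mon x y) = if x == y then mon x y else 0.
Proof.
case: canE => _ H; have := H x.1 y.1 x.2 y.2.
by rewrite !monoE -!surjective_pairing => ->; case: x y => m a [n b].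
Qed.

Lemma fix1 : toeplitz_fix 1.
Proof. by rewrite -mon1; exact: fix_mon. Qed.

(** [toeplitz_fix] is defined as a closed span. That it is an algebra is read off from E, which maps
    into it and fixes its elements: E is linear, and the bimodule rule with middle factor 1 handles
    products. *)
Lemma fix_unital : closed_unital_algebra toeplitz_fix.
Proof.
split.
- exact: closed_closure.
- move=> c S T fS fT; rewrite -(E_id fS) -(E_id fT) -E_lin; try exact: fix_toeplitz.
  by apply: E_fix; apply: toeplitz_lin; exact: fix_toeplitz.
- move=> S T fS fT.
  have := E_bimod fS (@toeplitz1 R) fT.
  rewrite (E_id fix1) mulr1 => <-; apply: E_fix.
  by apply: toeplitzM; exact: fix_toeplitz.
- exact: fix1.
Qed.

(** P is right cancellative: x k = y k gives equal second coordinates, then equal first ones. *)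
Lemma mon_diag0 x y u : x != y -> mon x y (e_ u) u = 0.
Proof.
move=> xy; have [[k ->]|N] := pselect (exists k, u = pmul y k).
  rewrite mon_e /=; case: eqP => // H; case/eqP: xy.
  have := congr1 (fun z : PP => val z.2) H; have := congr1 fst H => /= H1 /eqP.
  rewrite eqn_pmul2r ?(valP k.2)// => /eqP H2; rewrite H2 in H1.
  by apply: pair_posE => //; move/addIn: H1.
by rewrite mon_e0// => k uk; apply: N; exists k.
Qed.

(** E keeps the diagonal monomials and kills the others, whose diagonal is 0 already; density does
    the rest. *)
Lemma E_diag T x : toeplitz T -> E T (e_ x) x = T (e_ x) x.
Proof.
move=> tT; apply/eqP; rewrite -subr_eq0; apply/eqP.
pose L T := E T (e_ x) x - T (e_ x) x.
apply: (@toeplitz_functional_eq0 R L 2) tT => [c S U tS tU|S tS|y z].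
- by rewrite /L E_lin// !coefD !coefZ; ring.
- rewrite /L; apply: le_trans (ler_cabsD _ _) _; rewrite cabsN mulr_natl mulr2n.
  apply: lerD; apply: le_trans (cabs_coef _ _ _) _ => //.
  exact: E_opnorm.
- rewrite /L E_mon; case: eqP => [->|/eqP yz]; first by rewrite subrr.
  by rewrite coef0 mon_diag0// subrr.
Qed.

Lemma E_eq S T : toeplitz S -> toeplitz T ->
  (forall x, S (e_ x) x = T (e_ x) x) -> E S = E T.
Proof.
move=> tS tT ST; apply: coef_ext => x y; have [->|xy] := eqVneq x y.
  by rewrite !E_diag.
by rewrite !fix_off_diag//; exact: E_fix.
Qed.

End expectation.

(** * The dynamics on matrix coefficients *)

Section dynamics.
Variable R : realType.
Local Notation bop := (bop R PP).
Local Notation Tiso := (Tiso R).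
Local Notation mon := (mon R).
Local Notation toeplitz := (@toeplitz R).
Local Notation e_ := (ebasis R).
Implicit Types (S T : bop) (x y z w u : PP).

(* sigma_t multiplies the (x, y) coefficient of an operator by
   exp(i t (lnp y - lnp x)). *)
Definition lnp x : R := ln (val x.2)%:R.

Lemma lnp_mul x y : lnp (pmul x y) = lnp x + lnp y.
Proof.
rewrite /lnp /= natrM lnM// posrE ltr0n; [exact: (valP x.2)|exact: (valP y.2)].
Qed.

Variable sigma : R -> bop -> bop.
Hypothesis dyn : is_dynamics sigma.

Let sigmaM t S T : toeplitz S -> toeplitz T -> sigma t (S * T) = sigma t S * sigma t T.
Proof. by case: dyn => -[H _ _ _] _; have [_ _ K _] := H t; exact: K. Qed.

Let sigmaa t T : toeplitz T -> sigma t (adj T) = adj (sigma t T).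
Proof. by case: dyn => -[H _ _ _] _; have [_ _ _ K] := H t; exact: K. Qed.

Let sigmal t c S T : toeplitz S -> toeplitz T -> sigma t (c *: S + T) = c *: sigma t S +
  sigma t T.
Proof. by case: dyn => -[H _ _ _] _; have [_ K _ _] := H t; exact: K. Qed.

Let sigmas t : sigma t (s_op R) = s_op R.
Proof. by case: dyn => _ [H _]; exact: H. Qed.

(** A [star_endomorphism] may fail to be unital; here 1 = s^* s and s is invariant. *)
Let sigma1 t : sigma t 1 = 1.
Proof.
have ts : toeplitz (s_op R) by exact: toeplitz_Tiso.
by rewrite -(@adj_TisoK R (1%N, pos_one)) sigmaM ?sigmaa ?sigmas//; exact: toeplitz_adj.
Qed.

Let rot (a : R) : R[i] := cexp (0 +i* a).

Let rotD a b : rot (a + b) = rot a * rot b.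
Proof. by rewrite /rot -cexpD; congr cexp; apply/eqP; rewrite eq_complex /= addr0 !eqxx.
  Qed.

Let rot0 : rot 0 = 1.
Proof. exact: cexp0. Qed.

Let rot_conj a : (rot a)^* = rot (- a).
Proof. by rewrite /rot /cexp /= cosN sinN mulrN. Qed.

Lemma v_opM (a b c : posnat) : val c = (val a * val b)%N -> v_op R c = v_op R a * v_op R b.
Proof.
move=> cE; rewrite /v_op TisoM; congr Defs.Tiso; apply: pair_posE => //=.
by rewrite muln0.
Qed.

(** The dynamics is prescribed on s and the v_p only; strong induction on a splits off its least
    prime factor. *)
Let sigma_v t (a : posnat) : sigma t (v_op R a) = rot (t * ln (val a)%:R) *: v_op R a.
Proof.
case: a => a; have [n] := ubnP a; elim: n a => // n IH a; rewrite ltnS => an a0.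
have [a1|a1] := eqVneq a 1%N.
  have -> : v_op R (exist _ a a0) = 1.
    by rewrite /v_op -Tiso1; congr Defs.Tiso; exact: pair_posE.
  by rewrite sigma1 /= a1 ln1 mulr0 rot0 scale1r.
have a2 : (1 < a)%N by rewrite ltn_neqAle eq_sym a1.
have pp := pdiv_prime a2; have p0 := prime_gt0 pp.
pose p : prime_nat := exist _ (pdiv a) pp.
have q0 : (0 < a %/ pdiv a)%N by rewrite divn_gt0// pdiv_leq.
have qa : (a %/ pdiv a < n)%N by rewrite (leq_trans _ an)// ltn_Pdiv// prime_gt1.
have aE : a = (pdiv a * (a %/ pdiv a))%N by rewrite mulnC divnK// pdiv_dvd.
pose q : posnat := exist _ (a %/ pdiv a)%N q0.
rewrite (@v_opM (prime_pos p) q (exist _ a a0 : posnat))//.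
rewrite sigmaM; try exact: toeplitz_Tiso.
have Hq : sigma t (v_op R q) = rot (t * ln (val q)%:R) *: v_op R q := IH _ qa q0.
have Hp : sigma t (v_op R (prime_pos p)) = ipow (val p) t *: v_op R (prime_pos p).
  by case: dyn => _ [_ H]; exact: H.
rewrite Hq Hp.
rewrite bopZAl bopZAr scalerA; congr (_ *: _).
have lnE : ln (a%:R : R) = ln (pdiv a)%:R + ln (a %/ pdiv a)%:R.
  by rewrite {1}aE natrM lnM ?posrE ?ltr0n.
rewrite /= lnE mulrDr rotD; congr (_ * _).
by rewrite /ipow /rot /cexp /= expR0 !mul1r.
Qed.

Let sigma_Tiso t x : sigma t (Tiso x) = rot (t * lnp x) *: Tiso x.
Proof.
have E : Tiso x = s_op R ^+ x.1 * v_op R x.2.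
  rewrite /s_op /v_op Tiso_pow1 TisoM; congr Defs.Tiso; apply: pair_posE => /=.
    by rewrite addn0.
  by rewrite mul1n.
have ts n : toeplitz (s_op R ^+ n) by rewrite /s_op Tiso_pow1; exact: toeplitz_Tiso.
have sn n : sigma t (s_op R ^+ n) = s_op R ^+ n.
  elim: n => [|n IH]; first by rewrite expr0 sigma1.
  by rewrite exprS sigmaM ?sigmas ?IH//; exact: toeplitz_Tiso.
by rewrite {1}E sigmaM ?sn ?sigma_v ?bopZAr -?E//; exact: toeplitz_Tiso.
Qed.

Let sigma_mon t x y : sigma t (mon x y) = rot (t * (lnp x - lnp y)) *: mon x y.
Proof.
rewrite sigmaM; [|exact: toeplitz_Tiso|by apply: toeplitz_adj; exact: toeplitz_Tiso].
rewrite sigmaa; last exact: toeplitz_Tiso.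
rewrite !sigma_Tiso adjZ rot_conj bopZAl bopZAr scalerA -rotD.
by rewrite mulrBr.
Qed.

Lemma sigma_coef t T u w : toeplitz T ->
  sigma t T (e_ u) w = cexp (0 +i* (t * (lnp w - lnp u))) * T (e_ u) w.
Proof.
move=> tT; apply/eqP; rewrite -subr_eq0; apply/eqP.
pose c : R[i] := rot (t * (lnp w - lnp u)).
pose L T := sigma t T (e_ u) w - c * T (e_ u) w.
apply: (@toeplitz_functional_eq0 R L (1 + cabs c)) tT => [d S U tS tU|S tS|x y].
- by rewrite /L sigmal// !coefD !coefZ; ring.
- rewrite /L; apply: le_trans (ler_cabsD _ _) _; rewrite cabsN cabsM mulrDl mul1r.
  apply: lerD; last by rewrite ler_wpM2l ?cabs_ge0 ?cabs_coef.
  apply: le_trans (cabs_coef _ _ _) _.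
  exact: (star_hom_contractive (@toeplitz_unital R) (@toeplitz_adj R) (@sigmal t)
    (@sigmaM t) (@sigmaa t) (sigma1 t) tS).
- rewrite /L sigma_mon coefZ -mulrBl.
  have [[k uk]|N] := pselect (exists k, u = pmul y k); last first.
    by rewrite mon_e0 ?mulr0// => k uk; apply: N; exists k.
  rewrite uk mon_e /=; case: eqP => [wk|_]; last by rewrite mulr0.
  rewrite /c uk wk !lnp_mul opprD addrACA subrr addr0 subrr mul0r//.
Qed.

(** A coefficient is a linear functional of norm at most 1, so the difference quotients of F pass to
    it. *)
Lemma derivable_coef_entire (F : R[i]^o -> bop) u w :
  (forall z : R[i]^o, derivable F z 1) -> entire (fun z : R[i] => F z (e_ u) w).
Proof.
move=> dF z; have /cvg_ex[D /= FD] := dF z.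
exists (D (e_ u) w) => e e0.
have e0' : 0 < e%:C by rewrite ltcR.
move/cvgrPdist_le: FD => /(_ _ e0'); rewrite near_withinE => /nbhs_ballP[[d d'] /= d0 Hd].
have [/eqP d'0 d1] : d' == 0 /\ 0 < d by move: d0; rewrite ltcE /= => /andP[].
exists d => // h hd; have [->|h0] := eqVneq h 0.
  by rewrite addr0 mulr0 subrr subr0 cabs0 mulr0.
have := Hd h; rewrite -ball_normE /= sub0r normrN cabsE d'0 ltcR => /(_ hd h0).
rewrite normbopE lecR => H.
have h1 : 0 < cabs h.
  by rewrite lt_def cabs_ge0 andbT; apply: contra_neq h0; exact: cabs_eq0.
have -> : F (z + h) (e_ u) w - F z (e_ u) w - D (e_ u) w * h =
   - h * (D - h^-1 *: (F (h *: 1 + z) - F z)) (e_ u) w.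
  rewrite coefB coefZ coefB [h *: 1]mulr1 [h + z]addrC.
  by field.
rewrite cabsM cabsN mulrC ler_wpM2r ?cabs_ge0//.
by apply: le_trans (cabs_coef _ _ _) H.
Qed.

Lemma analytic_coef T F (b : R) u w : 0 < b -> toeplitz T -> analytic_extension sigma T F ->
  F (0 +i* b) (e_ u) w = (expR (- b * (lnp w - lnp u)))%:C * T (e_ u) w.
Proof.
move=> b0 tT [_ dF Ft].
set l := lnp w - lnp u.
(* exp(- i l z) undoes the rotation of the coefficient on the real line, so G vanishes there. At z =
   i b it equals exp(b l), the inverse of the factor claimed. *)
pose G (z : R[i]) : R[i] := F z (e_ u) w * cexp (- (0 +i* l) * z) + (- T (e_ u) w).
have eG : entire G.
  apply: entireD; last exact: entire_cst.
  apply: entireM; first exact: derivable_coef_entire.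
  apply: entire_cexp; apply: entireM; [exact: entire_cst|exact: entire_id].
have G0 t : G t%:C = 0.
  rewrite /G Ft sigma_coef// -/l mulrAC -cexpD.
  rewrite (_ : _ + _ * t%:C = 0) ?cexp0 ?mul1r ?subrr//.
  by apply/eqP; rewrite eq_complex /=; apply/andP; split; apply/eqP; ring.
have := entire_eq0 eG G0 b0; rewrite /G => /eqP; rewrite subr_eq0 => /eqP <-.
rewrite mulrCA -[LHS]mulr1; congr (_ * _).
apply/eqP; rewrite eq_complex /cexp /=; apply/andP; split; apply/eqP.
  rewrite [X in cos X](_ : _ = 0); last by ring.
  rewrite [X in sin X](_ : _ = 0); last by ring.
  rewrite cos0 sin0 !mulr0 subr0 mulr1 -expRD.
  by rewrite [X in expR X](_ : _ = 0) ?expR0//; ring.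
rewrite [X in sin X](_ : _ = 0); last by ring.
by rewrite sin0 !mulr0 mul0r addr0.
Qed.

End dynamics.

(** * The measures *)

Section discrete_probability.
Context d (T : measurableType d) (R : realType).
Variables (c : nat -> {nonneg R}) (N : nat -> nat) (x : nat -> nat -> T).

(** Level k carries N k atoms of equal weight c k. The levels p^k of X_p and the integers a = k + 1
    of the low-temperature measures both have this shape. *)
Definition atomic_measure : set T -> \bar R :=
  mseries (fun k => msum (fun j => mscale (c k) (dirac (x k j))) (N k)) 0.

HB.instance Definition _ := Measure.on atomic_measure.

Lemma atomic_measureE A : atomic_measure A =
  (\sum_(0 <= k <oo) \sum_(j < N k) (c k)%:num%:E * \d_(x k j) A)%E.
Proof. by []. Qed.

Hypothesis total : (\sum_(0 <= k <oo) ((c k)%:num * (N k)%:R)%:E = 1)%E.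

Let atomicT : atomic_measure setT = 1%E.
Proof.
rewrite atomic_measureE -[RHS]total; apply: eq_eseriesr => k _.
rewrite (eq_bigr (fun=> (c k)%:num%:E)); last by move=> j _; rewrite diracT mule1.
by rewrite sumEFin sumr_const card_ord mulr_natr.
Qed.

HB.instance Definition _ := Measure_isProbability.Build _ _ _ atomic_measure atomicT.

Definition atomic_probability : probability T R := atomic_measure.

End discrete_probability.

(** * Series and a count of residues *)

Section series_facts.
Variable R : realType.

Lemma nneseries_EFin (u : nat -> R) (l : R) : series u @ \oo --> l ->
  (\sum_(0 <= k <oo) (u k)%:E = l%:E)%E.
Proof.
move=> ul; apply/cvg_lim => //.
rewrite (_ : (fun n => _) = EFin \o series u).
  by apply: cvg_EFin => //; exact: nearW.
by apply/funext => n; rewrite /= sumEFin.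
Qed.

Lemma nneseries_geometric (a z : R) : 0 <= z < 1 ->
  (\sum_(0 <= k <oo) (a * z ^+ k)%:E = (a * (1 - z)^-1)%:E)%E.
Proof.
move=> /andP[z0 z1]; apply: nneseries_EFin.
by apply: cvg_geometric_series; rewrite ger0_norm.
Qed.

Lemma nneseries_shift (u : nat -> \bar R) k : (forall i, (0 <= u i)%E) ->
  (forall i, (i < k)%N -> u i = 0%E) ->
  (\sum_(0 <= i <oo) u i = \sum_(0 <= i <oo) u (k + i)%N)%E.
Proof.
move=> u0 uk; rewrite !nneseries_esumT//.
rewrite (@esum_shift R nat (addn k)) //; first by move=> i j /addnI.
move=> i H; apply: uk; rewrite ltnNge; apply/negP => ki; apply: H.
by exists (i - k)%N => //; rewrite subnKC.
Qed.

Lemma sum_congruent (a b m : nat) : (0 < b)%N -> (b %| a)%N ->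
  (\sum_(r < a) ((r %% b == m %% b) : nat))%N = (a %/ b)%N.
Proof.
move=> b0 /dvdnP[t ->]; rewrite mulnK//.
elim: t => [|t IH]; first by rewrite mul0n big_ord0.
rewrite mulSnr big_split_ord /= IH -addn1; congr (_ + _)%N.
have mb : (m %% b < b)%N by rewrite ltn_pmod.
rewrite (bigD1 (Ordinal mb)) //= modnMDl modn_mod eqxx big1 ?addn0// => i.
rewrite -val_eqE /= => im; rewrite modnMDl modn_small//.
by rewrite (negPf im).
Qed.

End series_facts.

Local Notation sdvd := Defs.sdvd.

(** * Cylinder sets of Omega_B and X_p *)

Section cylinders.

Definition Wcyl (x : PP) : set OmegaB := [set w : OmegaB | val (val w : Omega) x].
Definition Xcyl p (x : PP) : set (Xp p) := [set w : Xp p | val (val w : Omega) x].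

Lemma Omega_eval_continuous (x : PP) :
  continuous (fun w : Omega => val w x : bool).
Proof.
move=> w; apply: (@continuous_comp _ _ _ (val : Omega -> {ptws PP -> bool}) (fun f => f x)).
  exact: initial_continuous.
exact: (@proj_continuous PP (fun=> bool) x).
Qed.

Lemma open_Wcyl x : open (Wcyl x).
Proof.
have c : continuous (fun w : OmegaB => val (val w : Omega) x : bool).
  move=> w; apply: (@continuous_comp _ _ _ (val : OmegaB -> Omega) (fun f : Omega => val
    f x : bool)).
    exact: initial_continuous.
  exact: Omega_eval_continuous.
have /continuousP/(_ [set true]) := c.
by apply; exact: discrete_open.
Qed.

Lemma open_Xcyl p x : open (@Xcyl p x).
Proof.
have c : continuous (fun w : Xp p => val (val w : Omega) x : bool).
  move=> w; apply: (@continuous_comp _ _ _ (val : Xp p -> Omega) (fun f : Omega => val f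
    x : bool)).
    exact: initial_continuous.
  exact: Omega_eval_continuous.
have /continuousP/(_ [set true]) := c.
by apply; exact: discrete_open.
Qed.

Lemma measurable_Wcyl x : measurable (Wcyl x : set (Borel OmegaB)).
Proof. by apply: sub_sigma_algebra; exact: open_Wcyl. Qed.

Lemma measurable_Xcyl p x : measurable (@Xcyl p x : set (Borel (Xp p))).
Proof. by apply: sub_sigma_algebra; exact: open_Xcyl. Qed.

Lemma BsetE N (r : Zmod N) (m : nat) (a : posnat) :
  val (Bset r) (m, a) <-> exists2 d : divisor N, val d = a & (m %% val a)%N = residue r d.
Proof. by split=> [/asboolP|?]; [|apply/asboolP]. Qed.

Lemma residue_Zint N (d : divisor N) m : residue (Zint N m) d = (m %% dval d)%N :> nat.
Proof. by []. Qed.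

Definition to_divisor N (a : posnat) (H : sdvd (snat a) N) : divisor N :=
  exist _ a (asboolT H).

Lemma Bset_Zint N (r m : nat) (a : posnat) :
  val (Bset (Zint N r)) (m, a) <-> sdvd (snat a) N /\ (r %% val a)%N = (m %% val a)%N.
Proof.
split=> [/BsetE[d da ->]|[aN rm]].
  split; first by rewrite -da; apply/asboolP; exact: valP d.
  by rewrite residue_Zint /dval da.
by apply/BsetE; exists (to_divisor aN) => //; rewrite residue_Zint.
Qed.

Lemma sdvd_snat (a b : posnat) : sdvd (snat a) (snat b) <-> (val a %| val b)%N.
Proof.
split=> [H|ab p /=]; last by apply: dvdn_leq_log => //; exact: (valP b).
apply/dvdn_partP => [|p]; first exact: (valP a).
rewrite mem_primes => /and3P[pp _ _].
rewrite p_part pfactor_dvdn//; last exact: (valP b).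
exact: (H (exist _ p pp)).
Qed.

Lemma divisor_inj N (d e : divisor N) : val d = val e -> d = e.
Proof. by move=> /val_inj. Qed.

Lemma Zmod_ext N (r s : Zmod N) : (forall d, residue r d = residue s d :> nat) -> r = s.
Proof.
move=> rs; apply: val_inj; apply: functional_extensionality_dep => d.
by apply: val_inj; exact: rs.
Qed.

End cylinders.

(** * Z/N for finite N *)

Section finite_Zmod.

(** N is described by its finite divisors instead of an equation with [snat a], which spares a
    transport of dependent types for [ppow p (Some k)]. The inverse map reads the residue at the
    largest divisor a. *)
Lemma Zint_snat_bij (a : posnat) N : (forall b : posnat, sdvd (snat b) N <-> (val b %|
  val a)%N) ->
  set_bij `I_(val a) [set: Zmod N] (Zint N).
Proof.
move=> aN; have aa : sdvd (snat a) N by apply/aN.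
pose t := to_divisor aa; split=> //.
- move=> i j; rewrite !inE /= => ia ja ij.
  have := congr1 (fun r => residue r t : nat) ij; rewrite !residue_Zint /dval /=.
  by rewrite !modn_small.
- move=> r _; exists (residue r t : nat); first exact: ltn_ord (residue r t).
  apply: Zmod_ext => d; rewrite residue_Zint residueP//.
  by apply/aN; apply/asboolP; exact: valP (d : {a | _}).
Qed.

Lemma esum_Zmod (R : realType) (a : posnat) N (F : Zmod N -> \bar R) :
  (forall b : posnat, sdvd (snat b) N <-> (val b %| val a)%N) ->
  (forall r, (0 <= F r)%E) ->
  (\esum_(r in [set: Zmod N]) F r = \sum_(j < val a) F (Zint N j))%E.
Proof.
move=> aN F0; rewrite (reindex_esum _ _ _ _ (Zint_snat_bij aN)).
rewrite esum_fset//; apply: esym.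
exact: (@fsbig_ord _ _ _ (val a) (fun j => F (Zint N j))).
Qed.

Lemma pos_exp_gt0 (p : prime_nat) k : (0 < val p ^ k)%N.
Proof. by rewrite expn_gt0 prime_gt0 ?(valP p). Qed.

Definition pos_exp (p : prime_nat) k : posnat :=
  exist _ (val p ^ k)%N (pos_exp_gt0 p k).

End finite_Zmod.

(** * Powers a^-beta, with beta = oo allowed *)

Section epow_facts.
Variable R : realType.
Implicit Types (beta : \bar R) (a b k : nat).

Lemma epow_ge0 a (e : \bar R) : 0 <= epow a e.
Proof. by case: e => [r| |] //=; exact: powR_ge0. Qed.

Lemma epow1 beta : (1 <= beta)%E -> epow 1 (- beta) = 1 :> R.
Proof. by case: beta => [r| |] //= _; rewrite powR1. Qed.

Lemma epowM a b beta : (0 < a)%N -> (0 < b)%N -> (1 <= beta)%E ->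
  epow (a * b) (- beta) = epow a (- beta) * epow b (- beta) :> R.
Proof.
move=> a0 b0; case: beta => [r| |] //= _; first by rewrite natrM powRM.
by rewrite muln_eq1 -natrM mulnb.
Qed.

Lemma epowX a k beta : (0 < a)%N -> (1 <= beta)%E ->
  epow (a ^ k) (- beta) = epow a (- beta) ^+ k :> R.
Proof.
move=> a0 b1; elim: k => [|k IH]; first by rewrite expn0 epow1.
by rewrite expnS epowM ?expn_gt0 ?a0// IH exprS.
Qed.

(** For beta = +oo the delicate level is k = 0: there the product of +oo and 0 is 0 and the weight
    is 1, in agreement with the zeroth power. For a > 1 the higher levels get weight 0. *)
Lemma epow_muln a k beta : (1 <= beta)%E ->
  epow a (- (beta * k%:R%:E)) = epow a (- beta) ^+ k :> R.
Proof.
case: beta => [r| |] //= _.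
  by rewrite -mulNr powRrM powR_mulrn// powR_ge0.
case: k => [|k]; first by rewrite mule0 /= oppr0 powRr0.
by rewrite gt0_mulye ?lte_fin ?ltr0n//=; case: eqP => _; rewrite ?expr1n ?expr0n.
Qed.

(** The ratio of consecutive levels of the series: p times as many atoms, each scaled by p^-beta. *)
Lemma epow_1sub (p : prime_nat) beta : (1 <= beta)%E ->
  epow (val p) (1 - beta) = (val p)%:R * epow (val p) (- beta) :> R.
Proof.
have p0 : (val p)%:R != 0 :> R by rewrite pnatr_eq0 -lt0n prime_gt0// (valP p).
case: beta => [r| |] //= _; first by rewrite powRD ?p0 ?implybT// powRr1.
by rewrite (gtn_eqF (prime_gt1 (valP p))) mulr0.
Qed.

Lemma epow_1sub_lt1 (p : prime_nat) beta : (1 < beta)%E ->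
  0 <= (val p)%:R * (epow (val p) (- beta) : R) < 1.
Proof.
move=> b1; rewrite mulr_ge0 ?epow_ge0//=.
rewrite -epow_1sub ?(ltW b1)//; case: beta b1 => [r| |] //=; last first.
  by rewrite (gtn_eqF (prime_gt1 (valP p))).
rewrite lte_fin => r1; have p1 := prime_gt1 (valP p).
rewrite /powR pnatr_eq0 -leqn0 leqNgt (ltnW p1) /= -[ltRHS]expR0 ltr_expR.
by rewrite nmulr_rlt0 ?subr_lt0// ln_gt0// ltr1n.
Qed.

Lemma epow_prod (s : seq nat) (l : nat -> nat) beta : (1 <= beta)%E ->
  (forall q, q \in s -> (0 < q)%N) ->
  epow (\prod_(q <- s) q ^ l q) (- beta) = \prod_(q <- s) epow q (- beta) ^+ l q :> R.
Proof.
move=> b1; elim: s => [|q s IH] H; first by rewrite !big_nil epow1.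
have q0 : (0 < q)%N by apply: H; rewrite mem_head.
have H' r : r \in s -> (0 < r)%N by move=> rs; apply: H; rewrite in_cons rs orbT.
rewrite !big_cons epowM ?expn_gt0 ?q0//; first by rewrite epowX// IH.
rewrite big_seq; apply: prodn_cond_gt0 => r /H' r0.
by rewrite expn_gt0 r0.
Qed.

End epow_facts.

(** * The measures mu_(beta,p) on cylinders *)

Section prime_measures.
Variable R : realType.
Implicit Types (beta : \bar R) (p : prime_nat).

Lemma ppowE p k : ppow p (Some k) = snat (pos_exp p k).
Proof.
apply: functional_extensionality_dep => q; rewrite /ppow /snat /= lognX.
rewrite logn_prime ?(valP p)//; have [->|] := eqVneq q p; first by rewrite eqxx muln1.
by rewrite -val_eqE /= => /negPf ->; rewrite muln0.
Qed.

Lemma sdvd_ppow_Some p k (b : posnat) :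
  sdvd (snat b) (ppow p (Some k)) <-> (val b %| val (pos_exp p k))%N.
Proof. by rewrite ppowE; exact: sdvd_snat. Qed.

Lemma sdvd_ppow p k (e : option nat) : exp_le (Some k) e ->
  sdvd (snat (pos_exp p k)) (ppow p e).
Proof.
move=> ke q; have := congr1 (fun f => f q) (ppowE p k); rewrite /ppow => <-.
by case: ifP.
Qed.

Lemma mu_seriesE beta p (A : set (Borel (Xp p))) :
  mu_series beta A = ((1 - epow (val p) (1 - beta))%:E *
   \sum_(0 <= k <oo) \sum_(j < val p ^ k) (epow (val p) (- (beta * k%:R%:E)))%:E *
     \d_(Xp_el (Zint (ppow p (Some k)) j) : Borel (Xp p)) A)%E.
Proof.
rewrite /mu_series; congr (_ * _)%E; apply: eq_eseriesr => k _.
rewrite (@esum_Zmod R (pos_exp p k))//; first exact: sdvd_ppow_Some.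
by move=> r; rewrite mule_ge0// lee_fin epow_ge0.
Qed.

(** Put q = p^-beta. The p^k atoms of level k weigh (1 - p q) q^k each, and the geometric series of
    ratio p q = p^(1-beta) < 1 gives total mass 1. *)
Lemma mu_series_probability beta p : (1 < beta)%E ->
  exists mu : probability (Borel (Xp p)) R,
    forall A, measurable A -> mu A = mu_series beta A.
Proof.
move=> b1; set q : R := epow (val p) (- beta).
have /andP[pq0 pq1] := epow_1sub_lt1 p b1; rewrite -/q in pq0 pq1.
have q0 : 0 <= q := epow_ge0 _ _.
have C0 : 0 <= 1 - (val p)%:R * q by rewrite subr_ge0 ltW.
have cq k : 0 <= (1 - (val p)%:R * q) * q ^+ k by rewrite mulr_ge0// exprn_ge0.
pose c k : {nonneg R} := NngNum (cq k).
pose x k j : Borel (Xp p) := Xp_el (Zint (ppow p (Some k)) j).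
have tot : (\sum_(0 <= k <oo) ((c k)%:num * (val p ^ k)%:R)%:E = 1)%E.
  rewrite (eq_eseriesr (g := fun k => ((1 - (val p)%:R * q) * ((val p)%:R * q) ^+ k)%:E)).
    rewrite nneseries_geometric ?pq0// divff// gt_eqF// subr_gt0//.
  move=> k _; congr EFin; rewrite /= exprMn natrX; ring.
exists (atomic_probability x tot) => A mA.
rewrite mu_seriesE epow_1sub ?(ltW b1)// -/q.
rewrite -nneseriesZl; last first.
  by move=> k _; apply: sume_ge0 => j _; rewrite mule_ge0// lee_fin epow_ge0.
apply: eq_eseriesr => k _; rewrite ge0_sume_distrr; last first.
  by move=> j _; rewrite mule_ge0// lee_fin epow_ge0.
apply: eq_bigr => j _; rewrite epow_muln ?(ltW b1)// -/q.
by rewrite muleA -EFinM.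
Qed.

(** B(r, p^j) contains (m, p^k) iff k <= j and r = m mod p^k, which holds for p^(j-k) of the p^j
    residues r. What remains is q^k times the total mass. *)
Lemma mu_series_cyl beta p m k : (1 < beta)%E ->
  mu_series beta (Xcyl (p := p) (m, pos_exp p k) : set (Borel (Xp p))) =
  (epow (val p) (- beta) ^+ k)%:E.
Proof.
move=> b1; rewrite mu_seriesE epow_1sub ?(ltW b1)//; set q : R := epow _ (- beta).
have /andP[pq0 pq1] := epow_1sub_lt1 p b1; rewrite -/q in pq0 pq1.
have q0 : 0 <= q := epow_ge0 _ _.
have p0 : (val p)%:R != 0 :> R by rewrite pnatr_eq0 -lt0n prime_gt0// (valP p).
have E j : (\sum_(r < val p ^ j) (epow (val p) (- (beta * j%:R%:E)))%:E *
     \d_(Xp_el (Zint (ppow p (Some j)) r) : Borel (Xp p)) (Xcyl (m, pos_exp p k)))%E =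
     (if (k <= j)%N then q ^+ j * (val p ^ (j - k))%:R else 0)%:E.
  rewrite epow_muln ?(ltW b1)// -/q.
  rewrite (eq_bigr (fun r : 'I__ => (q ^+ j * ((k <= j)%N && (r %% val p ^ k == m %% val
    p ^ k)%N : nat)%:R)%:E)); last first.
    move=> r _; rewrite diracE EFinM; congr (_ * (_ %:R%:E))%E; congr nat_of_bool.
    apply/idP/idP => [|/andP[kj /eqP rm]]; rewrite inE /Xcyl /=.
      move=> /Bset_Zint[/sdvd_ppow_Some/= pk /= ->]; rewrite eqxx andbT.
      by move: pk; rewrite dvdn_Pexp2l// prime_gt1// (valP p).
    apply/Bset_Zint; split=> //=; exact: sdvd_ppow.
  rewrite sumEFin; congr EFin; case: ifPn => [kj|/negPf kj]; last first.
    by rewrite big1// => r _; rewrite mulr0.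
  rewrite -mulr_sumr -natr_sum; congr (_ * _%:R).
  rewrite sum_congruent ?expn_gt0 ?prime_gt0 ?(valP p)//; last exact: dvdn_exp2l.
  by rewrite expnB// prime_gt0// (valP p).
under eq_eseriesr do rewrite E.
rewrite (@nneseries_shift R _ k); first last.
- by move=> i ik; rewrite leqNgt ik.
- by move=> i; rewrite lee_fin; case: ifP => // _; rewrite mulr_ge0// exprn_ge0.
rewrite (eq_eseriesr (g := fun i => (q ^+ k * ((val p)%:R * q) ^+ i)%:E)); last first.
  move=> i _; congr EFin; rewrite leq_addr addKn exprD natrX exprMn; ring.
rewrite nneseries_geometric ?pq0// -EFinM; congr EFin.
by rewrite mulrCA divff ?mulr1// gt_eqF// subr_gt0.
Qed.

(** Translation by i carries the class of 0 to the class of i, so the [dval d] classes, which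
    partition Z/N, have equal mass. *)
Lemma haar_residue N (lambda : probability (Borel (Zmod N)) R) (d : divisor N) (j :
  'I_(dval d)) :
  is_haar lambda -> lambda [set r | residue r d = j] = ((dval d)%:R^-1)%:E.
Proof.
move=> haar; pose A (i : 'I_(dval d)) : set (Borel (Zmod N)) := [set r | residue r d = i].
have oA i : open (A i : set (Zmod N)).
  have c : continuous (fun r : Zmod N => residue r d : discrete_topology 'I_(dval d)).
    move=> r; apply: (@continuous_comp _ _ _ (val : Zmod N -> prod_topology (fun d :
      divisor N => discrete_topology 'I_(dval d))) (fun f => f d)).
      exact: initial_continuous.
    exact: (@proj_continuous (divisor N) (fun d => discrete_topology 'I_(dval d)) d).
  have /continuousP/(_ [set i]) := c.
  by apply; exact: discrete_open.
have mA i : measurable (A i) by apply: sub_sigma_algebra; exact: oA.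
have Aj i : lambda (A i) = lambda (A (Ordinal (dval_gt0 d))).
  rewrite -(haar (Zint N i) _ (mA i)); congr (lambda _).
  apply/seteqP; split=> r; rewrite /A /=.
    move=> /(congr1 (@nat_of_ord _)) H0; apply: val_inj => /=.
    have H : ((i + residue r d) %% dval d)%N = i.
      by rewrite -[RHS]H0 -{1}(modn_small (ltn_ord i)).
    have r0 := ltn_ord (residue r d); have i0 := ltn_ord i.
    have [lt|le] := ltnP (i + residue r d) (dval d).
      by move: H; rewrite modn_small// -[RHS]addn0 => /addnI.
    have {}H : (i + residue r d - dval d)%N = i.
      have lt2 : (i + residue r d - dval d < dval d)%N by lia.
      by rewrite -[RHS]H -[in RHS](subnK le) modnDr modn_small.
    lia.
  move=> H; apply: val_inj.
  transitivity ((i %% dval d + residue r d) %% dval d)%N => //.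
  by rewrite H /= addn0 modn_mod modn_small.
have S1 : (\sum_(i < dval d) lambda (A i) = 1)%E.
  rewrite -(@probability_setT _ _ _ lambda).
  have -> : [set: Borel (Zmod N)] = \big[setU/set0]_(i < dval d) A i.
    apply/seteqP; split=> // r _.
    by rewrite (bigD1 (residue r d))//=; left.
  rewrite measure_bigsetU_ord//; apply/trivIsetP => i i' _ _ ii'.
  by apply/seteqP; split=> // r [] /= H1 H2; move: ii'; rewrite -H1 -H2 eqxx.
rewrite (Aj j); move: S1; rewrite (eq_bigr (fun=> lambda (A (Ordinal (dval_gt0 d))))) =>
  [|i _]; last exact: Aj.
have fin : lambda (A (Ordinal (dval_gt0 d))) \is a fin_num by apply: fin_num_measure.
rewrite -(fineK fin) sumEFin sumr_const card_ord => -[] /eqP.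
move=> /eqP H; congr EFin.
have d0 : (dval d)%:R != 0 :> R by rewrite pnatr_eq0 -lt0n dval_gt0.
by rewrite -[LHS](mulfK d0) mulr_natr H mul1r.
Qed.

Lemma mu_p_cyl beta p (mu : probability (Borel (Xp p)) R) m k : (1 <= beta)%E ->
  is_mu_p beta mu -> mu (Xcyl (m, pos_exp p k)) = (epow (val p) (- beta) ^+ k)%:E.
Proof.
move=> b1; rewrite /is_mu_p; case: eqP => [->|/eqP nb1 H]; last first.
  rewrite H; last exact: measurable_Xcyl.
  by apply: mu_series_cyl; rewrite lt_neqAle eq_sym nb1.
move=> [lambda [haar muE]]; rewrite muE; last exact: measurable_Xcyl.
have pkN : sdvd (snat (pos_exp p k)) (ppow p None) by exact: sdvd_ppow.
pose d := to_divisor pkN.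
have := @haar_residue _ lambda d (Ordinal (ltn_pmod m (dval_gt0 d))) haar.
rewrite (_ : [set r | _] = (fun r => Xp_el r) @^-1` Xcyl (m, pos_exp p k)).
  move=> ->; congr EFin; rewrite /dval /= natrX -exprVn; congr (_ ^+ _).
  by rewrite -powR_inv1.
apply/seteqP; split=> r /=.
  by move=> /(congr1 val) /= H; apply/BsetE; exists d => //; rewrite H.
move=> /BsetE[e ek me]; apply: val_inj => /=.
have -> : d = e by apply: divisor_inj; rewrite ek.
by rewrite -me /dval ek.
Qed.

End prime_measures.

(** * From the primes to Omega_B *)

Section product_measure.
Variable R : realType.

Lemma modn_primes a x y : (0 < a)%N ->
  (forall p, p \in primes a -> x = y %[mod p ^ logn p a]) -> x = y %[mod a].
Proof.
move=> a0; wlog xy : x y / (y <= x)%N => [W H|H].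
  have [/W|/ltnW/W H'] := leqP y x; first exact.
  by apply/esym/H' => p pa; apply/esym/H.
apply/eqP; rewrite eqn_mod_dvd//; apply/dvdn_partP => // p pa.
by rewrite p_part -eqn_mod_dvd// H.
Qed.

Definition prime_seq (a : nat) : seq prime_nat := pmap insub (primes a).

Lemma map_prime_seq a : map val (prime_seq a) = primes a.
Proof.
rewrite /prime_seq pmap_filter; last exact: insubK.
apply/all_filterP/allP => p; rewrite mem_primes => /and3P[pp _ _] /=.
by rewrite insubT.
Qed.

Lemma mem_prime_seq a (p : prime_nat) : (p \in prime_seq a) = (val p \in primes a).
Proof. by rewrite /prime_seq mem_pmap_sub. Qed.

(** [Xproj] chooses a representative (N, r) of w. Exposing that very choice lets w and all its
    projections be computed from one pair. *)
Lemma OmegaB_rep (w : OmegaB) : exists N (r : Zmod N), w = OmegaB_el r /\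
  forall p, Xproj p w = Xp_el (Zres (ppow_dvd p N) r).
Proof.
pose t := projT1 (cid (OmegaB_inv w)).
exists (projT1 t), (projT2 t); split=> //.
exact: projT2 (cid (OmegaB_inv w)).
Qed.

(** Chinese remainder theorem: a | N and m = r mod a can be tested at the prime powers exactly
    dividing a. Finitely many primes occur, so [is_mu] evaluates the right-hand side. *)
Lemma Wcyl_prime m (a : posnat) : Wcyl (m, a) =
  [set w | forall p, p \in prime_seq (val a) -> Xcyl (m, pos_exp p (logn (val p) (val
    a))) (Xproj p w)].
Proof.
apply/seteqP; split=> w /=; have [N [r [wE pE]]] := OmegaB_rep w.
  rewrite {1}wE => /BsetE[d da mr] p _; rewrite pE.
  set k := logn (val p) (val a).
  have kN : sdvd (snat (pos_exp p k)) (ppow p (N p)).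
    apply: sdvd_ppow; have /asboolP/(_ p) := valP (d : {a | _}).
    by rewrite da.
  apply/BsetE; exists (to_divisor kN) => //.
  have dv : (dval (widen_divisor (ppow_dvd p N) (to_divisor kN)) %| dval d)%N.
    by rewrite /dval da; exact: pfactor_dvdnn.
  have := residueP r dv; rewrite -mr /dval /= modn_dvdm.
    by move=> ->.
  exact: pfactor_dvdnn.
move=> H; rewrite wE.
have H' p (pa : val p \in primes (val a)) : exists d : divisor N,
    val d = pos_exp p (logn (val p) (val a)) /\
    (m %% val p ^ logn (val p) (val a))%N = residue r d :> nat.
  have := H p; rewrite mem_prime_seq pE => /(_ pa) /BsetE[d da mr].
  by exists (widen_divisor (ppow_dvd p N) d).
have aN : sdvd (snat a) N.
  move=> p; have [pa|] := boolP (val p \in primes (val a)).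
    have [d [da _]] := H' p pa; have /asboolP/(_ p) := valP (d : {a | _}).
    by rewrite da /= pfactorK// (valP p).
  rewrite /snat -logn_gt0 -leqNgt leqn0 => /eqP ->.
  by case: (N p).
apply/BsetE; exists (to_divisor aN) => //.
rewrite -(modn_small (ltn_ord (residue r (to_divisor aN)))).
apply: modn_primes; first exact: (valP a).
move=> q qa; have qp : prime q by move: qa; rewrite mem_primes => /andP[].
have [d [da ->]] := H' (exist _ q qp) qa.
have dv : (dval d %| dval (to_divisor aN))%N.
  by rewrite /dval da; exact: pfactor_dvdnn.
by rewrite -(residueP r dv) /dval da.
Qed.

Lemma is_mu_Wcyl (beta : \bar R) (mu_p : forall p, probability (Borel (Xp p)) R)
    (mu : probability (Borel OmegaB) R) (x : PP) :
  (1 <= beta)%E -> (forall p, is_mu_p beta (mu_p p)) -> is_mu mu_p mu ->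
  mu (Wcyl x) = (epow (val x.2) (- beta))%:E.
Proof.
move=> b1 Hp Hmu; case: x => m a; rewrite Wcyl_prime.
rewrite (Hmu (prime_seq (val a)) (fun p => Xcyl (m, pos_exp p (logn (val p) (val a)))));
  first last.
- by move=> p; exact: measurable_Xcyl.
- by apply: pmap_sub_uniq; exact: primes_uniq.
rewrite (eq_bigr (fun p => (epow (val p) (- beta) ^+ logn (val p) (val a))%:E)); last first.
  by move=> p _; exact: mu_p_cyl.
rewrite -(big_map val xpredT (fun q => (epow q (- beta) ^+ logn q (val a))%:E))
  map_prime_seq.
rewrite prodEFin; congr EFin.
rewrite [in RHS](prod_prime_decomp (valP a)) prime_decompE big_map epow_prod//.
by move=> q; rewrite mem_primes => /and3P[/prime_gt0].
Qed.

(** Given the common solution z.1, the congruences modulo x.2 and y.2 amount to one modulo the lcm,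
    and the lcm divides N iff x.2 and y.2 do. *)
Lemma Wcyl_meet (x y z : PP) : (val z.2 = lcmn (val x.2) (val y.2))%N ->
  z.1 = x.1 %[mod val x.2] -> z.1 = y.1 %[mod val y.2] ->
  Wcyl x `&` Wcyl y = Wcyl z.
Proof.
case: x y z => m a [n b] [l c] cE la lb.
have {}cE : val c = lcmn (val a) (val b) := cE.
have {}la : l = m %[mod val a] := la.
have {}lb : l = n %[mod val b] := lb.
apply/seteqP; split=> w; have [N [r [-> _]]] := OmegaB_rep w.
  move=> [/BsetE[d da mr] /BsetE[e eb nr]].
  have cN : sdvd (snat c) N.
    move=> p; rewrite /snat cE; apply: logn_lcm_le.
    - exact: (valP a).
    - exact: (valP b).
    - by have /asboolP/(_ p) := valP (d : {a | _}); rewrite da.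
    - by have /asboolP/(_ p) := valP (e : {a | _}); rewrite eb.
  apply/BsetE; exists (to_divisor cN) => //.
  rewrite -(modn_small (ltn_ord (residue r (to_divisor cN)))) /dval /=.
  have H (u v : nat) : u = v %[mod val a] -> u = v %[mod val b] -> u = v %[mod val c].
    rewrite cE; wlog uv : u v / (v <= u)%N => [W|] H1 H2.
      have [/W|/ltnW/W W'] := leqP v u; first exact.
      by apply/esym/W'.
    by apply/eqP; rewrite eqn_mod_dvd// dvdn_lcm -!eqn_mod_dvd// H1 H2 !eqxx.
  apply: H.
    have dv : (dval d %| dval (to_divisor cN))%N by rewrite /dval da /= cE dvdn_lcml.
    have de : dval d = val a by rewrite /dval da.
    by rewrite la mr -(residueP r dv) de.
  have dv : (dval e %| dval (to_divisor cN))%N by rewrite /dval eb /= cE dvdn_lcmr.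
  have ee : dval e = val b by rewrite /dval eb.
  by rewrite lb nr -(residueP r dv) ee.
move=> /BsetE[f fc lr]; split; apply/BsetE.
  have aN : sdvd (snat a) N.
    move=> p; have /asboolP/(_ p) := valP (f : {a | _}); rewrite fc; apply: exp_le_trans.
    by apply: dvdn_leq_log; [exact: (valP c)|rewrite cE dvdn_lcml].
  exists (to_divisor aN) => //.
  have dv : (dval (to_divisor aN) %| dval f)%N by rewrite /dval fc /= cE dvdn_lcml.
  by rewrite -(residueP r dv) -lr /dval /= modn_dvdm ?cE ?dvdn_lcml.
have bN : sdvd (snat b) N.
  move=> p; have /asboolP/(_ p) := valP (f : {a | _}); rewrite fc; apply: exp_le_trans.
  by apply: dvdn_leq_log; [exact: (valP c)|rewrite cE dvdn_lcmr].
exists (to_divisor bN) => //.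
have dv : (dval (to_divisor bN) %| dval f)%N by rewrite /dval fc /= cE dvdn_lcmr.
by rewrite -(residueP r dv) -lr /dval /= modn_dvdm ?cE ?dvdn_lcmr.
Qed.

End product_measure.

(** * Atomic measures for beta = 3, 4, .. *)

Section low_temperature.
Variables (R : realType) (t : nat).

(** With a = k + 1 and s = t + 3, [g] is a^-s, the unnormalised weight of one atom, and [u] is
    a^(1-s), that of the a atoms B(r, a) together. *)
Let g (k : nat) : R := k.+1%:R^-1 ^+ t.+3.
Let u (k : nat) : R := g k * k.+1%:R.

Let k0 k : 0 < k.+1%:R :> R. Proof. exact: ltr0Sn. Qed.

Let uE k : u k = k.+1%:R^-1 ^+ t.+2.
Proof. by rewrite /u /g exprSr -mulrA mulVf ?mulr1// gt_eqF. Qed.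

(** As s >= 3, a^(1-s) <= a^-2, and (a + 1)^-2 <= 1/a - 1/(a + 1) telescopes to the bound 2. *)
Let u_cvg : exists2 Z : R, 0 < Z & series u @ \oo --> Z.
Proof.
have u0 k : 0 <= u k by rewrite uE exprn_ge0// invr_ge0.
have nd : nondecreasing_seq (series u) by apply: nondecreasing_series.
have u00 : u 0%N = 1 by rewrite uE invr1 expr1n.
have bd n : series u n.+1 <= 2 - n.+1%:R^-1.
  elim: n => [|n IH].
    by rewrite seriesSr /series/= big_geq// add0r u00 invr1; lra.
  rewrite seriesSr; apply: le_trans (lerD IH (lexx _)) _.
  have h : u n.+1 <= n.+2%:R^-1 ^+ 2.
    rewrite uE -[t.+2]addn2 exprD -[leRHS]mul1r ler_wpM2r ?sqr_ge0//.
    by rewrite exprn_ile1 ?invr_ge0// invf_le1// ler1n.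
  have e (a : R) : 0 < a -> (a + 1)^-1 ^+ 2 <= a^-1 - (a + 1)^-1.
    move=> a0; have a1 : 0 < a + 1 by rewrite addr_gt0.
    have -> : a^-1 - (a + 1)^-1 = (a + 1)^-1 ^+ 2 + (a + 1)^-1 ^+ 2 * a^-1.
      by field; rewrite !gt_eqF.
    by rewrite lerDl mulr_ge0 ?sqr_ge0// invr_ge0 ltW.
  have := e _ (k0 n); rewrite natr1 => {}e.
  have {}h := le_trans h e.
  by rewrite -addrA lerD2l -lerBrDl opprK addrC.
have bd2 n : series u n <= 2.
  apply: le_trans (nd _ _ (leqnSn n)) _; apply: le_trans (bd n) _.
  by rewrite gerBl invr_ge0.
have ub : has_ubound (range (series u)) by exists 2 => _ [n _ <-]; exact: bd2.
exists (sup (range (series u))); last exact: nondecreasing_cvgn.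
apply: (@lt_le_trans _ _ (series u 1%N)).
  by rewrite seriesSr /series/= big_geq// add0r u00.
by apply: ub_le_sup => //; exists 1%N.
Qed.

(* For s = t + 3, mu_s is the atomic measure
   zeta(s - 1)^-1 sum_a sum_(r < a) a^-s delta_(B(r, a)). *)
Lemma exists_atomic_mu : exists mu : probability (Borel OmegaB) R,
  forall x, mu (Wcyl x) = (epow (val x.2) (- (t.+3%:R)%:E))%:E.
Proof.
have [Z Z0 uZ] := u_cvg.
have c0 k : 0 <= g k / Z by rewrite divr_ge0 ?(ltW Z0)// exprn_ge0// invr_ge0.
pose c k : {nonneg R} := NngNum (c0 k).
pose pt k j : Borel OmegaB := OmegaB_el (Zint (snat (exist (fun a => (0 < a)%N) k.+1
  isT)) j).
have tot : (\sum_(0 <= k <oo) ((c k)%:num * (k.+1)%:R)%:E = 1)%E.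
  apply: nneseries_EFin; rewrite (_ : series _ = (fun n => Z^-1 * series u n)).
    have <- : Z^-1 * Z = 1 by rewrite mulVf// gt_eqF.
    by apply: cvgM => //; exact: cvg_cst.
  apply/funext => n; rewrite /series/= mulr_sumr; apply: eq_bigr => k _.
  by rewrite /u; ring.
exists (atomic_probability pt tot) => -[m b].
rewrite [LHS]atomic_measureE.
have E k : (\sum_(j < k.+1) (c k)%:num%:E * \d_(pt k j) (Wcyl (m, b) : set (Borel
  OmegaB)))%E =
    (if (val b %| k.+1)%N then (g k / Z) * (k.+1 %/ val b)%:R else 0)%:E.
  rewrite (eq_bigr (fun j : 'I__ => (g k / Z * ((val b %| k.+1)%N && (j %% val b == m %%
    val b)%N : nat)%:R)%:E)); last first.
    move=> j _; rewrite diracE EFinM; congr (_ * (_ %:R%:E))%E; congr nat_of_bool.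
    apply/idP/idP => [|/andP[kj /eqP rm]]; rewrite inE /Wcyl /=.
      by move=> /Bset_Zint[/sdvd_snat/= -> /= ->]; rewrite eqxx.
    by apply/Bset_Zint; split=> //=; apply/sdvd_snat.
  rewrite sumEFin; congr EFin; case: ifPn => [kj|/negPf kj]; last first.
    by rewrite big1// => r _; rewrite mulr0.
  rewrite -mulr_sumr -natr_sum; congr (_ * _%:R).
  by rewrite sum_congruent// (valP b).
under eq_eseriesr do rewrite E.
have b0 : (0 < val b)%N := valP b.
have Epos k : (0 <= (if (val b %| k.+1)%N then (g k / Z) * (k.+1 %/ val b)%:R else 0)%:E)%E.
  by rewrite lee_fin; case: ifP => // _; rewrite mulr_ge0// (c0 k).
(* Only multiples of b contribute. For k + 1 = b (i + 1) an atom weighs b^-s times one of level i,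
   and i + 1 of them lie in the cylinder, so the sum is b^-s times the total mass. *)
pose h i := (val b * i.+1).-1.
have hS i : (h i).+1 = (val b * i.+1)%N by rewrite prednK// muln_gt0 b0.
have h_inj : injective h.
  move=> i j /(congr1 S); rewrite !hS => /eqP.
  by rewrite eqn_pmul2l// => /eqP[].
rewrite nneseries_esumT// (@esum_shift R nat h h_inj); last first.
  move=> k H; case: ifPn => // /dvdnP[[//|i] ki]; case: H; exists i => //.
  by apply: succn_inj; rewrite hS ki mulnC.
rewrite -nneseries_esumT//.
rewrite (eq_eseriesr (g := fun i => ((val b)%:R^-1 ^+ t.+3)%:E * ((c i)%:num *
  i.+1%:R)%:E)%E); last first.
  move=> i _; rewrite hS dvdn_mulr// mulKn// -EFinM; congr EFin.
  have -> : g (h i) = (val b)%:R^-1 ^+ t.+3 * g i by rewrite /g hS natrM invfM exprMn.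
  by rewrite !mulrA.
rewrite nneseriesZl; last by move=> i _; rewrite lee_fin mulr_ge0// (c0 i).
rewrite tot mule1; congr EFin.
by rewrite /= powRN powR_mulrn// exprVn.
Qed.

End low_temperature.

(** * The KMS condition *)

Section integral_state.
Variables (R : realType) (mu : probability (Borel OmegaB) R).
Implicit Types f g : Omega -> R[i]^o.

(** For the functions Theta T, boundedness comes from [Theta_contractive] rather than from
    compactness of Omega. *)
Definition bounded_continuous f := continuous f /\ exists M : R, forall w, cabs (f w) <= M.

Let re f (w : Borel OmegaB) : R := complex.Re (f (val (w : OmegaB))).
Let im f (w : Borel OmegaB) : R := complex.Im (f (val (w : OmegaB))).

Lemma continuous_complex_part (X : topologicalType) (h : X -> R[i]^o) (g : R[i] -> R) :
  (forall a b, `|g a - g b| <= cabs (a - b)) -> continuous h -> continuous (fun x => g (h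
    x) : R).
Proof.
move=> gl ch x; apply/cvgrPdist_le => e e0.
have e0' : 0 < e%:C by rewrite ltcR.
have /cvgrPdist_le/(_ _ e0') := ch x.
apply: filterS => y; rewrite cabsE lecR.
exact: le_trans (gl _ _).
Qed.

Lemma Re_lip (a b : R[i]) : `|complex.Re a - complex.Re b| <= cabs (a - b).
Proof. by apply: le_trans (ler_Re_cabs _); case: a b => ? ? []. Qed.

Lemma Im_lip (a b : R[i]) : `|complex.Im a - complex.Im b| <= cabs (a - b).
Proof. by apply: le_trans (ler_Im_cabs _); case: a b => ? ? []. Qed.

Lemma continuous_Borel_measurable (h : OmegaB -> R) : continuous h ->
  measurable_fun [set: Borel OmegaB] (h : Borel OmegaB -> R).
Proof.
move=> ch; apply: (measurability _ (measurable_realfun.RGenOInfty.measurableE R)).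
move=> _ [_ [x ->] <-]; rewrite setTI; apply: sub_sigma_algebra.
move/continuousP: ch; apply; exact: interval_open.
Qed.

Let part_integrable f (g : R[i] -> R) : (forall a b, `|g a - g b| <= cabs (a - b)) ->
  (forall a, `|g a| <= cabs a) ->
  bounded_continuous f ->
  mu.-integrable setT (EFin \o (fun w : Borel OmegaB => g (f (val (w : OmegaB))))).
Proof.
move=> gl gb [cf [M fM]]; apply: measurable_bounded_integrable => //.
- have m1 : mu [set: Borel OmegaB] = 1%E := probability_setT mu.
  have lt1 : (mu [set: Borel OmegaB] < +oo)%E by rewrite m1 ltry.
  exact: lt1.
- apply: continuous_Borel_measurable.
  apply: (@continuous_complex_part _ (fun w : OmegaB => f (val w))) => // w.
  apply: (@continuous_comp _ _ _ (val : OmegaB -> Omega) f); last exact: cf.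
  exact: initial_continuous.
- exists M; split; first exact: num_real.
  move=> K MK w _ /=; apply: le_trans (ltW MK); apply: le_trans (gb _) (fM _).
Qed.

Let re_int f : bounded_continuous f -> mu.-integrable setT (EFin \o re f).
Proof. by apply: part_integrable => [a b|a]; [exact: Re_lip|exact: ler_Re_cabs]. Qed.

Let im_int f : bounded_continuous f -> mu.-integrable setT (EFin \o im f).
Proof. by apply: part_integrable => [a b|a]; [exact: Im_lip|exact: ler_Im_cabs]. Qed.

Let intZ (a : R) (f : Borel OmegaB -> R) : mu.-integrable setT (EFin \o f) ->
  mu.-integrable setT (EFin \o (fun w => a * f w)).
Proof.
move=> fi; rewrite (_ : _ \o _ = (fun w => a%:E * (EFin \o f) w)%E).
  exact: integrableZl.
by apply/funext.
Qed.

Lemma mu_state_lin (c : R[i]) f g h : bounded_continuous f -> bounded_continuous g ->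
  (forall w, h w = c * f w + g w) ->
  mu_state mu h = c * mu_state mu f + mu_state mu g.
Proof.
move=> bf bg hE; case: c hE => a b hE.
have Ire := re_int bf; have Iim := im_int bf.
have Jre := re_int bg; have Jim := im_int bg.
have sub (u v : Borel OmegaB -> R) : mu.-integrable setT (EFin \o u) ->
    mu.-integrable setT (EFin \o v) -> mu.-integrable setT (EFin \o (fun w => u w + v w)).
  move=> iu iv; rewrite (_ : _ \o _ = (EFin \o u) \+ (EFin \o v))%E.
    exact: integrableD.
  by apply/funext.
apply/eqP; rewrite eq_complex /mu_state /=; apply/andP; split; apply/eqP.
  rewrite (_ : (fun w => _) = (fun w => (a * re f w + (- b) * im f w) + re g w)); last
    first.
    by apply/funext => w; rewrite hE /re /im; case: (f _) (g _) => ? ? [] ? ? /=; ring.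
  rewrite !RintegralD//; [|exact: intZ|exact: intZ|by apply: sub; exact: intZ].
  by rewrite !RintegralZl// mulNr.
rewrite (_ : (fun w => _) = (fun w => (a * im f w + b * re f w) + im g w)); last first.
  by apply/funext => w; rewrite hE /re /im; case: (f _) (g _) => ? ? [] ? ? /=; ring.
rewrite !RintegralD//; [|exact: intZ|exact: intZ|by apply: sub; exact: intZ].
by rewrite !RintegralZl.
Qed.

Let int_bound (M : R) (u : Borel OmegaB -> R) : mu.-integrable setT (EFin \o u) ->
  (forall w, `|u w| <= M) -> `|\int[mu]_w u w| <= M.
Proof.
move=> iu uM; apply: le_trans (le_normr_Rintegral _ iu) _ => //.
have cM : mu.-integrable setT (EFin \o (fun=> M : R)) by exact:
  finite_measure_integrable_cst.
apply: le_trans (le_Rintegral _ _ cM _) _ => //.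
  exact: integrable_norm.
have m1 : mu [set: Borel OmegaB] = 1%E := probability_setT mu.
rewrite Rintegral_cst// -[leRHS]mulr1 le_eqVlt; apply/orP; left; apply/eqP.
by congr (M * _); exact: (congr1 fine m1).
Qed.

(** The factor 2 comes from bounding real and imaginary parts separately; density arguments tolerate
    any constant. *)
Lemma mu_state_bound f (M : R) : continuous f -> (forall w, cabs (f w) <= M) ->
  cabs (mu_state mu f) <= 2 * M.
Proof.
move=> cf fM; have bf : bounded_continuous f by split=> //; exists M.
apply: le_trans (ler_cabs_ReIm _) _; rewrite mulr_natl mulr2n; apply: lerD => /=.
  by apply: int_bound => [|w]; [exact: re_int|apply: le_trans (ler_Re_cabs _) (fM _)].
by apply: int_bound => [|w]; [exact: im_int|apply: le_trans (ler_Im_cabs _) (fM _)].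
Qed.

Lemma mu_state_ge0 f : (forall w, 0 <= f w) -> 0 <= mu_state mu f.
Proof.
move=> f0; rewrite lecE /=; apply/andP; split.
  rewrite (_ : (fun w => _) = (fun=> 0 : R)); last first.
    by apply/funext => w; have := f0 (val w); rewrite lecE => /andP[/eqP ->].
  by rewrite Rintegral_cst ?mul0r.
apply: Rintegral_ge0 => w _.
by have := f0 (val w); rewrite lecE => /andP[].
Qed.

Lemma mu_state_indic f (A : set (Borel OmegaB)) : measurable A ->
  (forall w : OmegaB, f (val w) = (w \in A)%:R) ->
  mu_state mu f = (fine (mu A))%:C.
Proof.
move=> mA fA; apply/eqP; rewrite eq_complex /mu_state /=; apply/andP; split; apply/eqP.
  rewrite (_ : (fun w => _) = \1_A); last first.
    by apply/funext => w; rewrite fA indicE; case: (w \in A).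
  by rewrite /Rintegral integral_indic// setIT.
rewrite (_ : (fun w => _) = (fun=> 0 : R)); last first.
  by apply/funext => w; rewrite fA; case: (w \in A).
by rewrite Rintegral_cst ?mul0r.
Qed.

End integral_state.

(** * The state psi and products of monomials *)

Section spectral.
Variables (R : realType) (E : bop R PP -> bop R PP) (Theta : bop R PP -> Omega -> R[i]^o).
Hypotheses (canE : is_canonical_expectation E) (isoT : is_spectral_iso Theta).
Local Notation bop := (bop R PP).
Local Notation mon := (mon R).
Local Notation toeplitz := (@toeplitz R).
Local Notation toeplitz_fix := (@toeplitz_fix R).
Local Notation e_ := (ebasis R).
Implicit Types (S T : bop) (x y z w u : PP).

Lemma Theta_cont T : toeplitz_fix T -> continuous (Theta T).
Proof. by case: isoT => -[H _ _] _; exact: H. Qed.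

Lemma Theta_lin c S T v : toeplitz_fix S -> toeplitz_fix T ->
  Theta (c *: S + T) v = c * Theta S v + Theta T v.
Proof. by case: isoT => _ [H _ _ _]; exact: H. Qed.

Lemma ThetaM S T v : toeplitz_fix S -> toeplitz_fix T ->
  Theta (S * T) v = Theta S v * Theta T v.
Proof. by case: isoT => _ [_ H _ _]; exact: H. Qed.

Lemma Theta_adj T v : toeplitz_fix T -> Theta (adj T) v = (Theta T v)^*.
Proof. by case: isoT => _ [_ _ H _]; exact: H. Qed.

Lemma Theta_mon x v : Theta (mon x x) v = (val v x)%:R.
Proof. by case: x => m a; case: isoT => _ [_ _ _ H]; rewrite -monoE H. Qed.

Lemma Omega_one (v : Omega) : val v pone.
Proof.
have := valP v; rewrite inE => -[[x vx] her _]; apply: her vx.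
by rewrite /ple /= dvd1n dvd1n.
Qed.

Lemma Theta1 v : Theta 1 v = 1.
Proof. by rewrite -mon1 Theta_mon Omega_one. Qed.

(* Characters of a C*-algebra are contractive: if |Theta T v| > |T| then
   1 - T / Theta T v would be invertible in the kernel of a character. *)
Lemma Theta_contractive T v : toeplitz_fix T -> cabs (Theta T v) <= opnorm T.
Proof.
move=> fT; rewrite leNgt; apply/negP => lt.
have t0 : 0 < cabs (Theta T v) by apply: le_lt_trans lt; exact: opnorm_ge0.
have tn0 : Theta T v != 0 by apply: contraTneq t0 => ->; rewrite cabs0 ltxx.
pose c := (Theta T v)^-1.
have cabsc : cabs c = (cabs (Theta T v))^-1.
  apply: (mulfI (lt0r_neq0 t0)); rewrite -cabsM divff// divff ?gt_eqF//.
  by rewrite /cabs /normsq/= expr1n expr0n addr0 sqrtr1.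
have fU := fix_unital canE; have [_ lA _ f1] := fU.
have f0 : toeplitz_fix 0 by have := lA (-1) 1 1 f1 f1; rewrite scaleN1r addNr.
have fX : toeplitz_fix (c *: T) by rewrite -[_ *: _]addr0; exact: lA.
have X1 : opnorm (c *: T) < 1.
  by rewrite opnormZ -[Num.sqrt _]/(cabs c) cabsc mulrC ltr_pdivrMr// mul1r.
have [Y fY YX] := neumann_inverse fU fX X1.
have fZ : toeplitz_fix (1 - c *: T).
  by rewrite addrC -scaleNr; exact: lA.
have := ThetaM v fY fZ; rewrite YX Theta1 addrC -scaleNr Theta_lin// Theta1.
by rewrite mulNr mulVf// addNr mulr0 => /eqP; rewrite oner_eq0.
Qed.

Lemma fix_adj T : toeplitz_fix T -> toeplitz_fix (adj T).
Proof.
move=> /bop_closureP cT; apply/bop_closureP => e /cT[S [n [c [f ->]]] TS].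
exists (\sum_(i < n) (c i)^* *: mono R (f i).1 (f i).2 (f i).2 (f i).1).
  by exists n, (fun i => (c i)^*), f.
have -> : \sum_(i < n) (c i)^* *: mono R (f i).1 (f i).2 (f i).2 (f i).1 =
    adj (\sum_(i < n) c i *: mono R (f i).1 (f i).2 (f i).2 (f i).1).
  elim: (index_enum _) => [|i s IH].
    by rewrite !big_nil; have := adjZ 0 (1 : bop); rewrite conjC0 !scale0r.
  by rewrite !big_cons adjD adjZ IH !monoE mon_adj.
by rewrite -adjB opnorm_adj.
Qed.

Section state.
Variable mu : probability (Borel OmegaB) R.

Definition psi T : R[i] := mu_state mu (Theta (E T)).

Lemma Theta_bc T : toeplitz_fix T -> bounded_continuous (Theta T).
Proof.
move=> fT; split; first exact: Theta_cont.
by exists (opnorm T) => v; exact: Theta_contractive.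
Qed.

Lemma psi_lin c S T : toeplitz S -> toeplitz T -> psi (c *: S + T) = c * psi S + psi T.
Proof.
move=> tS tT; have fS := E_fix canE tS; have fT := E_fix canE tT.
rewrite /psi (E_lin canE)//; apply: mu_state_lin; try exact: Theta_bc.
by move=> v; exact: Theta_lin.
Qed.

Lemma psi_bound T : toeplitz T -> cabs (psi T) <= 2 * opnorm T.
Proof.
move=> tT; have fT := E_fix canE tT.
apply: mu_state_bound; first exact: Theta_cont.
move=> v; apply: le_trans (Theta_contractive _ fT) _.
exact: E_opnorm.
Qed.

Lemma psi_mon x y : psi (mon x y) = if x == y then (fine (mu (Wcyl x)))%:C else 0.
Proof.
rewrite {1}/psi (E_mon canE); case: eqP => [<-|_].
  apply: mu_state_indic; first exact: measurable_Wcyl.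
  move=> v; rewrite Theta_mon; congr (nat_of_bool _)%:R.
  by apply/idP/idP; rewrite inE.
have f1 := @fix1 R.
have Th0 v : Theta 0 v = 0.
  have := Theta_lin (-1) v f1 f1; rewrite scaleN1r addNr => ->.
  by rewrite mulN1r addNr.
have := @mu_state_indic R mu (Theta 0) set0 measurable0.
rewrite measure0; apply=> v; rewrite Th0.
by rewrite (_ : (v \in set0) = false)//; apply/negP; rewrite inE.
Qed.

(** For positivity, E(T^* T) = S^* S with S in [toeplitz_fix], and Theta turns this into |Theta
    S|^2. *)
Lemma psi_state : is_state toeplitz psi.
Proof.
split.
- by move=> c S T tS tT; exact: psi_lin.
- move=> T tT; have [S fS ES] := E_pos canE tT.
  apply: mu_state_ge0 => v; rewrite ES ThetaM//; last exact: fix_adj.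
  by rewrite Theta_adj// mulrC mul_conjC_ge0.
- rewrite -mon1 psi_mon eqxx (_ : Wcyl pone = setT) ?probability_setT//.
  by apply/seteqP; split=> // w _; exact: Omega_one.
Qed.

Lemma psi_eq S T : toeplitz S -> toeplitz T ->
  (forall u, S (e_ u) u = T (e_ u) u) -> psi S = psi T.
Proof. by move=> tS tT ST; rewrite /psi (E_eq canE tS tT ST). Qed.

Lemma psi_meet x y : psi (mon x x * mon y y) = (fine (mu (Wcyl x `&` Wcyl y)))%:C.
Proof.
have [_ _ fM _] := fix_unital canE.
rewrite /psi (E_id canE); last by apply: fM; exact: fix_mon.
apply: mu_state_indic; first by apply: measurableI; exact: measurable_Wcyl.
move=> v; rewrite ThetaM; try exact: fix_mon.
rewrite !Theta_mon -natrM mulnb; congr (nat_of_bool _)%:R.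
by apply/andP/idP; rewrite inE.
Qed.

Lemma pmul_cross x y z w r r' : pmul w r = pmul x r' -> pmul z r = pmul y r' ->
  (val w.2 * val y.2 = val x.2 * val z.2)%N.
Proof.
move=> H1 H2; have /= b1 := congr1 (fun p : PP => val p.2) H1.
have /= b2 := congr1 (fun p : PP => val p.2) H2.
have rr : (0 < val r.2 * val r'.2)%N by rewrite muln_gt0 (valP r.2) (valP r'.2).
apply/eqP; rewrite -(eqn_pmul2l rr); apply/eqP.
have e1 := congr1 (muln (val y.2 * val r'.2)) b1.
have e2 := congr1 (muln (val x.2 * val r'.2)) b2.
by clear -e1 e2; simpl in *; lia.
Qed.

(** In the group of fractions of P the first two equations say x^-1 w = r' r^-1 = y^-1 z, so w k = x
    l means the same as z k = y l. The proof clears denominators to stay within natural numbers. *)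
Lemma pmul_cancel x y z w r r' k l :
  pmul w r = pmul x r' -> pmul z r = pmul y r' ->
  pmul w k = pmul x l -> pmul z k = pmul y l.
Proof.
move=> H1 H2 H3.
have /= a1 := congr1 fst H1; have /= b1 := congr1 (fun p : PP => val p.2) H1.
have /= a2 := congr1 fst H2; have /= b2 := congr1 (fun p : PP => val p.2) H2.
have /= a3 := congr1 fst H3; have /= b3 := congr1 (fun p : PP => val p.2) H3.
have w0 : (0 < val w.2)%N := valP w.2; have r0 : (0 < val r.2)%N := valP r.2.
have r0' : (0 < val r'.2)%N := valP r'.2.
have wy := pmul_cross H1 H2.
have h1 := congr1 (muln (val w.2)) a2.
have h2 := congr1 (muln (val z.2)) a1.
have h3 := congr1 (muln (val z.2)) a3.
have h4 := congr1 (muln r'.1) wy.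
have h5 := congr1 (muln l.1) wy.
have h6 := congr1 (muln (val z.2)) b3.
have h7 := congr1 (muln (val l.2)) wy.
apply: pair_posE => /=; apply/eqP; rewrite -(eqn_pmul2l w0); apply/eqP.
  by clear -h1 h2 h3 h4 h5; simpl in *; lia.
by clear -h6 h7; simpl in *; lia.
Qed.

(* Some basis vector is fixed by mon x y * mon z w. *)
Definition compat x y z w := exists r r', pmul w r = pmul x r' /\ pmul z r = pmul y r'.

Lemma compatC x y z w : compat x y z w <-> compat z w x y.
Proof. by split=> -[r [r' [H1 H2]]]; exists r', r. Qed.

(** [mon z w] moves e_(w r) to e_(z r) and [mon x y] moves e_(y r') to e_(x r'); the entry is 1
    exactly when the two steps chain and return to u. *)
Lemma mon_mon_diag x y z w u : (mon x y * mon z w) (e_ u) u =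
  (`[< exists r r', [/\ u = pmul w r, pmul z r = pmul y r' & u = pmul x r'] >])%:R.
Proof.
rewrite bopM; have [[k uk]|N] := pselect (exists k, u = pmul w k); last first.
  rewrite mon_e0 ?bop0 => [|k uk]; last by apply: N; exists k.
  by case: asboolP => // -[r [r' [ur _ _]]]; case: N; exists r.
rewrite {1}uk mon_e; have [[l zl]|N] := pselect (exists l, pmul z k = pmul y l); last first.
  rewrite mon_e0 => [|l zl]; last by apply: N; exists l.
  case: asboolP => // -[r [r' [ur zr _]]]; case: N; exists r'.
  by rewrite -zr; congr pmul; apply: (@pmul_inj w); rewrite -uk.
rewrite zl mon_e /=; congr (nat_of_bool _)%:R; apply/eqP/asboolP => [ul|].
  by exists k, l.
move=> [r [r' [ur zr ->]]]; congr pmul; apply: (@pmul_inj y).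
by rewrite -zr -zl; congr pmul; apply: (@pmul_inj w); rewrite -uk.
Qed.

Lemma mon_mon_toeplitz x y z w : toeplitz (mon x y * mon z w).
Proof. by apply: toeplitzM; exact: toeplitz_mon. Qed.

Lemma psi0 : psi 0 = 0.
Proof.
by have := psi_lin (-1) (@toeplitz1 R) (@toeplitz1 R); rewrite scaleN1r addNr mulN1r addNr.
Qed.

Lemma psi_mon_mon_incompat x y z w : ~ compat x y z w -> psi (mon x y * mon z w) = 0.
Proof.
move=> N; rewrite -psi0; apply: psi_eq; [exact: mon_mon_toeplitz|exact: toeplitz0|].
move=> u; rewrite mon_mon_diag coef0; case: asboolP => // -[r [r' [ur zr ur']]].
by case: N; exists r, r'; rewrite -ur.
Qed.

Lemma psi_mon_mon_compat x y z w : compat x y z w ->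
  psi (mon x y * mon z w) = (fine (mu (Wcyl w `&` Wcyl x)))%:C.
Proof.
move=> [r [r' [H1 H2]]]; rewrite -psi_meet.
apply: psi_eq; [exact: mon_mon_toeplitz|exact: mon_mon_toeplitz|].
move=> u; rewrite !mon_mon_diag; congr (nat_of_bool _)%:R.
apply/asboolP/asboolP => -[k [l []]].
  by move=> uk _ ul; exists l, k; rewrite -uk -ul.
move=> ul wx uk; exists l, k; split=> //.
  exact: pmul_cancel H1 H2 (esym wx).
Qed.

(** * The KMS condition at finite beta *)

Section KMS.
Variables (b : R) (b0 : 0 < b).
Hypothesis mu_cyl : forall x, mu (Wcyl x) = (epow (val x.2) (- b%:E))%:E.

Lemma mu_cyl_meet x y r r' : pmul x r = pmul y r' ->
  mu (Wcyl x `&` Wcyl y) = (expR (- b * ln (lcmn (val x.2) (val y.2))%:R))%:E.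
Proof.
move=> xy; have l0 : (0 < lcmn (val x.2) (val y.2))%N by rewrite lcmn_gt0 (valP x.2)
  (valP y.2).
pose c : posnat := exist (fun a => (0 < a)%N) _ l0.
(* The first coordinate of a common multiple is congruent to x.1 mod x.2 and to y.1 mod y.2, so it
   serves as the residue modulo the lcm. *)
rewrite (@Wcyl_meet x y ((pmul x r).1, c)); first by rewrite mu_cyl /= /powR pnatr_eq0
  gtn_eqF.
- by [].
- by rewrite /= addnC mulnC modnMDl.
- by rewrite xy /= addnC mulnC modnMDl.
Qed.

Lemma psi_KMS_mon x y z w :
  psi (mon x y * mon z w) = (expR (- b * (lnp R w - lnp R z)))%:C * psi (mon z w * mon x y).
Proof.
have [S|N] := pselect (compat x y z w); last first.
  by rewrite !psi_mon_mon_incompat ?mulr0// => /compatC.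
have S' : compat z w x y by apply/compatC.
rewrite !psi_mon_mon_compat//; have [r [r' [H1 H2]]] := S.
rewrite (mu_cyl_meet H1) (mu_cyl_meet (esym H2)) -rmorphM /=; congr (_ %:C).
rewrite -expRD; congr expR; rewrite -mulrDr; congr (_ * _).
have wy := pmul_cross H1 H2.
(* Since w.2 y.2 = x.2 z.2, both sides are the lcm of z.2 w.2 and w.2 y.2. Logarithms turn this into
   the identity of exponents. *)
have L : (val z.2 * lcmn (val w.2) (val x.2) = val w.2 * lcmn (val y.2) (val z.2))%N.
  by rewrite !muln_lcmr wy mulnC lcmnC [(val z.2 * val x.2)%N]mulnC.
have := congr1 (fun n => ln (n%:R : R)) L; rewrite !natrM !lnM ?posrE ?ltr0n ?lcmn_gt0;
  rewrite ?(valP w.2) ?(valP x.2) ?(valP y.2) ?(valP z.2)//.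
by rewrite /lnp; lra.
Qed.

Variable sigma : R -> bop -> bop.
Hypothesis dyn : is_dynamics sigma.

Lemma psi_mulr_lin c S T U : toeplitz S -> toeplitz T -> toeplitz U ->
  psi ((c *: S + T) * U) = c * psi (S * U) + psi (T * U).
Proof.
by move=> tS tT tU; rewrite mulrDl bopZAl psi_lin//; exact: toeplitzM.
Qed.

Lemma psi_mull_lin c S T U : toeplitz S -> toeplitz T -> toeplitz U ->
  psi (U * (c *: S + T)) = c * psi (U * S) + psi (U * T).
Proof.
by move=> tS tT tU; rewrite mulrDr bopZAr psi_lin//; exact: toeplitzM.
Qed.

Lemma psi_mulr_bound S U : toeplitz S -> toeplitz U ->
  cabs (psi (S * U)) <= 2 * opnorm U * opnorm S.
Proof.
move=> tS tU; apply: le_trans (psi_bound (toeplitzM tS tU)) _.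
by rewrite -mulrA ler_wpM2l// mulrC opnormM.
Qed.

Lemma psi_mull_bound S U : toeplitz S -> toeplitz U ->
  cabs (psi (U * S)) <= 2 * opnorm U * opnorm S.
Proof.
move=> tS tU; apply: le_trans (psi_bound (toeplitzM tU tS)) _.
by rewrite -mulrA ler_wpM2l// opnormM.
Qed.

Lemma psi_KMS_left z w T : toeplitz T ->
  psi (T * mon z w) = (expR (- b * (lnp R w - lnp R z)))%:C * psi (mon z w * T).
Proof.
set k : R[i] := (expR _)%:C => tT; apply/eqP; rewrite -subr_eq0; apply/eqP.
have tm : toeplitz (mon z w) by exact: toeplitz_mon.
pose L T := psi (T * mon z w) - k * psi (mon z w * T).
apply: (@toeplitz_functional_eq0 R L (2 * opnorm (mon z w) + cabs k * (2 * opnorm (mon z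
  w)))) tT.
- by move=> c S U tS tU; rewrite /L psi_mulr_lin// psi_mull_lin//; ring.
- move=> S tS; apply: le_trans (ler_cabsD _ _) _; rewrite cabsN cabsM mulrDl.
  apply: lerD; first exact: psi_mulr_bound.
  by rewrite -mulrA ler_wpM2l ?cabs_ge0// psi_mull_bound.
- by move=> x y; rewrite /L psi_KMS_mon subrr.
Qed.

Lemma psi_KMS_analytic z w T F : toeplitz T -> analytic_extension sigma T F ->
  psi (T * mon z w) = psi (mon z w * F (0 +i* b)).
Proof.
move=> tT aF; rewrite psi_KMS_left//; set k : R[i] := (expR _)%:C.
have tm : toeplitz (mon z w) by exact: toeplitz_mon.
have tF : toeplitz (F (0 +i* b)) by case: aF.
apply/eqP; rewrite -subr_eq0; apply/eqP.
rewrite -[X in _ - X]mul1r -mulNr addrC.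
have -> : - 1 * psi (mon z w * F (0 +i* b)) + k * psi (mon z w * T) =
    - psi (mon z w * (- k *: T + F (0 +i* b))).
  by rewrite psi_mull_lin//; ring.
rewrite (_ : psi _ = 0) ?oppr0// -psi0; apply: psi_eq; last move=> u.
- by apply: toeplitzM => //; exact: toeplitz_lin.
- exact: toeplitz0.
rewrite coef0; set D := - k *: T + _.
(* The diagonal entry at u is the inner product of D e_u with [mon w z] e_u. It can be nonzero only
   for u = z l, where it is the coefficient of D from z l to w l; there F(i b) is k times T, so D
   vanishes. *)
rewrite bopM -dot_ebasis dot_adj mon_adj.
have [[l ->]|N] := pselect (exists l, u = pmul z l); last first.
  by rewrite mon_e0 ?dotr0// => l ul; apply: N; exists l.
rewrite mon_e dot_ebasis /D coefD coefZ (analytic_coef dyn _ _ b0 tT aF).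
by rewrite !lnp_mul opprD addrACA subrr addr0 -/k mulNr addNr.
Qed.

Lemma psi_KMS_fin : KMS_fin sigma b psi.
Proof.
split=> //; first exact: psi_state.
move=> c d F [tc _] [td _] aF; have tF : toeplitz (F (0 +i* b)) by case: aF.
apply/eqP; rewrite -subr_eq0; apply/eqP.
pose L T := psi (d * T) - psi (T * F (0 +i* b)).
apply: (@toeplitz_functional_eq0 R L (2 * opnorm d + 2 * opnorm (F (0 +i* b)))) tc.
- by move=> a S U tS tU; rewrite /L psi_mulr_lin// psi_mull_lin//; ring.
- move=> S tS; apply: le_trans (ler_cabsD _ _) _; rewrite cabsN mulrDl.
  by apply: lerD; [exact: psi_mull_bound|exact: psi_mulr_bound].
- by move=> x y; rewrite /L (psi_KMS_analytic _ _ td aF) subrr.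
Qed.

End KMS.

End state.

End spectral.

(** * The limit beta = oo *)

Section ground_state.
Variables (R : realType) (E : bop R PP -> bop R PP) (Theta : bop R PP -> Omega -> R[i]^o).
Hypotheses (canE : is_canonical_expectation E) (isoT : is_spectral_iso Theta).
Local Notation toeplitz := (@toeplitz R).
Local Notation psi := (psi E Theta).

Variable mu : probability (Borel OmegaB) R.
Hypothesis mu_cyl : forall x, mu (Wcyl x) = (epow (val x.2) (- +oo))%:E.

Let mu_ n : probability (Borel OmegaB) R := projT1 (cid (exists_atomic_mu R n)).

Let mu_E n x : mu_ n (Wcyl x) = (epow (val x.2) (- (n.+3%:R)%:E))%:E.
Proof. by rewrite /mu_; case: cid. Qed.

(** a^-(n+3) is 1 for a = 1 and at most 2^-(n+3) for a >= 2; these limits are the conventional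
    values of a^-oo. *)
Let cvg_mon x y (e : R) : 0 < e -> exists N, forall n, (N <= n)%N ->
  cabs (psi (mu_ n) (mon R x y) - psi mu (mon R x y)) <= e.
Proof.
move=> e0; have [xy|xy] := eqVneq x y; last first.
  by exists 0%N => n _; rewrite !psi_mon// (negPf xy) subrr cabs0 ltW.
have half : 0 <= (2^-1 : R) < 1 by apply/andP; split; lra.
have [N HN] := geometric_small half (@ler01 R) e0.
exists N => n Nn; rewrite !psi_mon// xy eqxx mu_E mu_cyl /= -rmorphB /= cabs_real.
have a0 : (0 < val y.2)%N := valP y.2.
rewrite powRN powR_mulrn// -exprVn.
have [->|a1] := eqVneq (val y.2) 1%N; first by rewrite invr1 expr1n subrr normr0 ltW.
have a2 : (2 <= val y.2)%N by rewrite ltn_neqAle eq_sym a1.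
rewrite subr0 ger0_norm ?exprn_ge0 ?invr_ge0//.
rewrite mulr1 in HN; apply: le_trans (ltW HN).
apply: (@le_trans _ _ (2^-1 ^+ n.+3)).
  by rewrite lerXn2r ?nnegrE ?invr_ge0// lef_pV2 ?posrE ?ltr0n// ler_nat.
by rewrite ler_wiXn2l ?invr_ge0 ?invf_le1 ?ler1n// (leq_trans Nn)// leqW// leqW// leqnSn.
Qed.

Let cvg_tspan S : tspan S -> forall e : R, 0 < e -> exists N, forall n, (N <= n)%N ->
  cabs (psi (mu_ n) S - psi mu S) <= e.
Proof.
elim=> [|c x y U sU IH] e e0.
  by exists 0%N => n _; rewrite !psi0// subrr cabs0 ltW.
have c0 : 0 < cabs c + 1 by rewrite ltr_wpDl ?cabs_ge0.
have e2 : 0 < e / 2 by rewrite divr_gt0.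
have [N1 H1] := cvg_mon x y (divr_gt0 e2 c0); have [N2 H2] := IH _ e2.
exists (maxn N1 N2) => n; rewrite geq_max => /andP[n1 n2].
have tm := @toeplitz_mon R x y; have tU := toeplitz_tspan sU.
rewrite !psi_lin//; set a := psi (mu_ n) (mon R x y); set a' := psi mu (mon R x y).
set p := psi (mu_ n) U; set p' := psi mu U.
have -> : c * a + p - (c * a' + p') = c * (a - a') + (p - p') by ring.
apply: le_trans (ler_cabsD _ _) _; rewrite [leRHS](splitr e) cabsM.
apply: lerD; last exact: H2.
apply: (@le_trans _ _ ((cabs c + 1) * cabs (a - a'))).
  by rewrite ler_wpM2r ?cabs_ge0// lerDl.
by rewrite mulrC -ler_pdivlMr// H1.
Qed.

Let cvg_toeplitz T : toeplitz T -> forall e : R, 0 < e -> exists N, forall n, (N <= n)%N ->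
  cabs (psi (mu_ n) T - psi mu T) <= e.
Proof.
(* [psi_bound] costs a factor 2, so e / 8 becomes e / 4 for each of the two states; the middle term
   takes e / 2. *)
move=> tT e e0; have e8 : 0 < e / 8 by rewrite divr_gt0.
have [S sS TS] := toeplitz_approx tT e8.
have e2 : 0 < e / 2 by rewrite divr_gt0.
have [N HN] := cvg_tspan sS e2; exists N => n /HN {}HN.
have tS := toeplitz_tspan sS.
have B (nu : probability (Borel OmegaB) R) : cabs (psi nu T - psi nu S) <= e / 4.
  have -> : psi nu T - psi nu S = psi nu (- 1 *: S + T) by rewrite psi_lin//; ring.
  rewrite scaleN1r addrC; apply: le_trans (psi_bound canE isoT nu (toeplitzB tT tS)) _.
  by move: TS; lra.
have -> : psi (mu_ n) T - psi mu T = (psi (mu_ n) T - psi (mu_ n) S) +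
  (psi (mu_ n) S - psi mu S) - (psi mu T - psi mu S) by ring.
apply: le_trans (ler_cabsD _ _) _; rewrite cabsN.
have := B mu; have := B (mu_ n); have := ler_cabsD (psi (mu_ n) T - psi (mu_ n) S) (psi
  (mu_ n) S - psi mu S).
move: HN; lra.
Qed.

(** The net is the sequence of states at s = n + 3; over the naturals its filter is definitionally
    that of eventual properties. *)
Lemma psi_KMS_infty sigma : is_dynamics sigma -> KMS_infty sigma (psi mu).
Proof.
move=> dyn; split; first exact: psi_state.
have nfE : net_filter (fun i j : nat => (i <= j)%N) = \oo.
  by [].
exists nat, (fun i j => (i <= j)%N), (fun n => n.+3%:R), (fun n => psi (mu_ n)); split.
- split; [exact: (inhabits 0%N)|by []|by move=> i j k; exact: leq_trans|].
  by move=> i j; exists (maxn i j); rewrite leq_maxl leq_maxr.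
- by move=> n; apply: psi_KMS_fin => //; exact: mu_E.
- rewrite nfE; apply/cvgryPge => A; near=> n.
  apply: (@le_trans _ _ n%:R); last by rewrite ler_nat leqW// leqW// leqnSn.
  by near: n; exact: nbhs_infty_ger.
- move=> T tT; rewrite nfE; apply/cvgrPdist_le => -[e e'] e0.
  have [/eqP /= e'0 e1] : e' == 0 /\ 0 < e by move: e0; rewrite ltcE /= => /andP[].
  have [N HN] := cvg_toeplitz tT e1; exists N => // n /= Nn.
  by rewrite cabsE e'0 lecR -cabsN opprB HN.
Unshelve. all: by end_near.
Qed.

End ground_state.

Theorem proposition9p1 (R : realType) :
  (forall (beta : \bar R) (p : prime_nat), (1 < beta)%E ->
     exists mu : probability (Borel (Xp p)) R,
       forall A, measurable A -> mu A = mu_series beta A) /\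
  (forall (sigma : R -> bop R PP -> bop R PP)
          (E : bop R PP -> bop R PP)
          (Theta : bop R PP -> Omega -> R[i]^o)
          (beta : \bar R)
          (mu_p : forall p, probability (Borel (Xp p)) R)
          (mu : probability (Borel OmegaB) R),
     is_dynamics sigma -> is_canonical_expectation E -> is_spectral_iso Theta ->
     (1 <= beta)%E -> (forall p, is_mu_p beta (mu_p p)) -> is_mu mu_p mu ->
     let psi := fun T => mu_state mu (Theta (E T)) in
     is_KMS sigma beta psi /\
     forall (m n : nat) (a b : posnat),
       psi (mono R m a b n) =
       if (a == b) && (m == n) then (epow (val a) (- beta))%:C else 0).
Proof.
split=> [beta p|]; first exact: mu_series_probability.
move=> sigma E Theta beta mu_p mu dyn canE isoT b1 Hp Hmu psi0.
have cyl x : mu (Wcyl x) = (epow (val x.2) (- beta))%:E by exact: is_mu_Wcyl.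
split.
  case: beta b1 cyl {Hp} => [b| |] //= b1 cyl; last exact: psi_KMS_infty.
  apply: psi_KMS_fin => //; apply: lt_le_trans ltr01 _.
  by rewrite -lee_fin.
move=> m n a b; rewrite monoE [LHS](psi_mon canE isoT) cyl.
by rewrite andbC.
Qed.
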